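(* There exists a collisionless $2\pi$-periodic solution $(q_1(t),q_2(t),q_3(t),q_4(t)):\mathbb{R}\to(\mathbb{R}^2)^4$ of the planar four-body problem with equal masses $$\frac{d^2q_k}{dt^2}=-\sum_{j\neq k}\frac{q_k-q_j}{|q_k-q_j|^3},\qquad q_k\in\mathbb{R}^2,\quad k=1,2,3,4,$$ such that $$P_y q_1(0)>0,\qquad P_x q_2(0)>0,\qquad P_x q_1\left(\tfrac{\pi}{4}\right)>0,\qquad P_y q_1\left(\tfrac{\pi}{4}\right)<0,$$ and such that for every $t\in\mathbb{R}$ $$q_1(t)=R_y q_1(-t)=R_x q_2\left(\tfrac{\pi}{2}-t\right),\qquad q_2(t)=R_x q_2(-t),$$ $$q_1(t)=-q_3(t),\qquad q_2(t)=-q_4(t).$$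
   Context: $P_x,P_y:\mathbb{R}^2\to\mathbb{R}$ are the coordinate projections $P_x(x,y)=x$, $P_y(x,y)=y$. $R_x,R_y:\mathbb{R}^2\to\mathbb{R}^2$ are the reflections with respect to the $x$- and $y$-axis: $R_x(x,y)=(x,-y)$, $R_y(x,y)=(-x,y)$. Collisionless means that $q_i(t)\neq q_j(t)$ for all $i\neq j$ and all $t\in\mathbb{R}$. *)

(* Defs.v *)
From Stdlib Require Import Reals.
From Coquelicot Require Import Coquelicot.
Open Scope R_scope.

(* The plane is [R * R] with Coquelicot's product structure, whose [norm] is
   the Euclidean one (and not the sup norm). *)
Definition plane : Type := (R * R)%type.

Definition Px (p : plane) : R := fst p.
Definition Py (p : plane) : R := snd p.

Definition Rx (p : plane) : plane := (fst p, - snd p).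
Definition Ry (p : plane) : plane := (- fst p, snd p).

Definition has_second_derivative (f g : R -> plane) : Prop :=
  exists f' : R -> plane,
    (forall t, is_derive f t (f' t)) /\ (forall t, is_derive f' t (g t)).

(* The bodies are numbered 1, ..., n; a motion of n bodies is a map
   [q : nat -> R -> plane] whose values outside these indices are irrelevant. *)

Definition collisionless (n : nat) (q : nat -> R -> plane) : Prop :=
  forall i j : nat, (1 <= i <= n)%nat -> (1 <= j <= n)%nat -> i <> j ->
  forall t : R, q i t <> q j t.

Definition acceleration (n : nat) (q : nat -> R -> plane) (k : nat) (t : R) : plane :=
  opp (sum_n_m (fun j : nat =>
    if Nat.eqb j k then zero
    else scal (/ norm (minus (q k t) (q j t)) ^ 3) (minus (q k t) (q j t))) 1 n).

Definition n_body_solution (n : nat) (q : nat -> R -> plane) : Prop :=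
  forall k : nat, (1 <= k <= n)%nat ->
  has_second_derivative (q k) (acceleration n q k).

Definition periodic (n : nat) (T : R) (q : nat -> R -> plane) : Prop :=
  forall k : nat, (1 <= k <= n)%nat -> forall t : R, q k (t + T) = q k t.

(* Main.v *)
(* The configuration is kept a parallelogram (q3 = - q1, q4 = - q2), and the
   symmetries reduce the claim to a boundary value problem on an eighth of the
   period: at one end q1 lies on the y-axis and q2 on the
   x-axis, both with orthogonal velocities; at the other end q1 and q2 are
   exchanged by the reflection R_x, with time reversed. Reflecting a solution
   repeatedly gives the periodic orbit, and a homothety adjusts the period.

   The boundary value problem is solved by a Newton-type contraction around a
   numerically computed polynomial p. Writing the solution as p + Y xi, where Y
   is a polynomial approximation of the fundamental matrix of the linearised
   equation, makes xi' small. Columns 0-3 of Y satisfy the linearised boundary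
   conditions at the left end and columns 4-7 those at the right end, so that
   the boundary conditions become xi_k = 0 at one end or the other and xi is an
   integral of its derivative. All the estimates needed (p and Y nearly solve
   their equations, Y is nearly symplectic) are bounds on polynomials on [-1, 1],
   obtained from the absolute sum of Chebyshev coefficients in exact integer
   arithmetic. *)
Require Import Defs.
From Stdlib Require Import Reals ZArith List Lra Lia Psatz FunctionalExtensionality.
From Coquelicot Require Import Coquelicot.
Import ListNotations.
Open Scope R_scope.

(** * Chebyshev series with integer coefficients *)

(** Two devices keep every verification polynomial. The force contains the inverse cube of a length.
    Each separation q therefore comes with a polynomial u approximating 1/|q|, and homogeneity of
    the force moves every estimate to the vector u q, whose squared length differs from 1 by at most
    2 / 10^14. Secondly, Y has to be inverted. The reduced equations are Hamiltonian, and the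
    boundary conditions at either end define a Lagrangian subspace. So columns 0-3 and columns 4-7
    each span an isotropic family, and the two families can be normalised to be dual to each other;
    this is why Y is nearly symplectic and why a signed permutation of its own entries nearly
    inverts it. The unknown of the contraction is not xi but z with xi' = Z z, where Z is this
    approximate inverse: the boundary conditions are built into the integration, and the iteration
    takes place among bounded continuous functions. No accuracy of the data is assumed; only defects
    are bounded. *)

Fixpoint cheb (n : nat) (x : R) : R :=
  match n with
  | O => 1
  | S m => match m with O => x | S p => 2 * x * cheb m x - cheb p x end
  end.

(** Pairing with an arbitrary sequence instead of Chebyshev polynomials only: inductions on the list
    can shift [f], and the same identities serve products, derivatives and endpoint values. *)
Fixpoint lin (l : list Z) (f : nat -> R) : R :=
  match l with
  | nil => 0
  | a :: l' => IZR a * f O + lin l' (fun i => f (S i))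
  end.

Definition ceval (l : list Z) (x : R) : R := lin l (fun i => cheb i x).

Lemma cheb_SS n x : cheb (S (S n)) x = 2 * x * cheb (S n) x - cheb n x.
Proof. reflexivity. Qed.

Lemma cheb_cos n t : cheb n (cos t) = cos (INR n * t).
Proof.
  enough (H : cheb n (cos t) = cos (INR n * t) /\
              cheb (S n) (cos t) = cos (INR (S n) * t)) by apply H.
  induction n as [|n [IH1 IH2]].
  - simpl. rewrite Rmult_0_l, cos_0, Rmult_1_l. auto.
  - split; [exact IH2|].
    rewrite cheb_SS, IH1, IH2.
    replace (INR (S (S n)) * t) with (INR (S n) * t + t)
      by (rewrite (S_INR (S n)); ring).
    replace (INR n * t) with (INR (S n) * t - t) by (rewrite (S_INR n); ring).
    rewrite cos_plus, cos_minus. ring.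
Qed.

Lemma cheb_bound n x : -1 <= x <= 1 -> Rabs (cheb n x) <= 1.
Proof.
  intros Hx. rewrite <- (cos_acos x Hx), cheb_cos.
  apply Rabs_le. apply COS_bound.
Qed.

(** * Products of Chebyshev series *)

Definition ndist (m n : nat) : nat := ((m - n) + (n - m))%nat.

Lemma cheb_mul m n x : -1 <= x <= 1 ->
  2 * (cheb m x * cheb n x) = cheb (m + n) x + cheb (ndist m n) x.
Proof.
  intros Hx. rewrite <- (cos_acos x Hx), !cheb_cos. set (t := acos x).
  assert (H : cos (INR (ndist m n) * t) = cos (INR m * t - INR n * t)).
  { unfold ndist. destruct (Nat.le_ge_cases m n) as [H|H].
    - replace (m - n)%nat with O by lia. rewrite Nat.add_0_l, minus_INR by lia.
      rewrite <- cos_neg. f_equal. ring.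
    - replace (n - m)%nat with O by lia. rewrite Nat.add_0_r, minus_INR by lia.
      f_equal. ring. }
  rewrite H, plus_INR, Rmult_plus_distr_r, cos_plus, cos_minus. ring.
Qed.

Lemma lin_ext l f g : (forall i, f i = g i) -> lin l f = lin l g.
Proof.
  revert f g; induction l as [|a l IH]; intros f g H; simpl; auto.
  rewrite H, (IH _ (fun i => g (S i))); auto.
Qed.

Lemma lin_plus l f g : lin l (fun i => f i + g i) = lin l f + lin l g.
Proof.
  revert f g; induction l as [|a l IH]; intros f g; simpl; [ring|].
  rewrite IH. ring.
Qed.

Lemma lin_scal l c f : lin l (fun i => c * f i) = c * lin l f.
Proof.
  revert f; induction l as [|a l IH]; intros f; simpl; [ring|].
  rewrite IH. ring.
Qed.

Fixpoint norm1 (l : list Z) : Z :=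
  match l with nil => 0%Z | a :: l' => (Z.abs a + norm1 l')%Z end.

Lemma lin_bound l f : (forall i, Rabs (f i) <= 1) -> Rabs (lin l f) <= IZR (norm1 l).
Proof.
  revert f; induction l as [|a l IH]; intros f H; simpl.
  - rewrite Rabs_R0. lra.
  - rewrite plus_IZR, abs_IZR.
    eapply Rle_trans; [apply Rabs_triang|].
    apply Rplus_le_compat; [|apply IH; auto].
    rewrite Rabs_mult. rewrite <- (Rmult_1_r (Rabs (IZR a))) at 2.
    apply Rmult_le_compat_l; [apply Rabs_pos|auto].
Qed.

Lemma ceval_bound l x : -1 <= x <= 1 -> Rabs (ceval l x) <= IZR (norm1 l).
Proof. intros Hx. apply lin_bound. intros i. apply cheb_bound, Hx. Qed.

Fixpoint ladd (a b : list Z) : list Z :=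
  match a, b with
  | nil, _ => b
  | _, nil => a
  | x :: a', y :: b' => (x + y)%Z :: ladd a' b'
  end.

Definition lscal (c : Z) (a : list Z) : list Z := map (Z.mul c) a.

Lemma lin_ladd a b f : lin (ladd a b) f = lin a f + lin b f.
Proof.
  revert b f; induction a as [|x a IH]; intros [|y b] f; simpl; try ring.
  rewrite IH, plus_IZR. ring.
Qed.

Lemma lin_lscal c a f : lin (lscal c a) f = IZR c * lin a f.
Proof.
  revert f; induction a as [|x a IH]; intros f; simpl; [ring|].
  unfold lscal in IH. rewrite IH, mult_IZR. ring.
Qed.

Lemma ceval_ladd a b x : ceval (ladd a b) x = ceval a x + ceval b x.
Proof. apply lin_ladd. Qed.

Lemma ceval_lscal c a x : ceval (lscal c a) x = IZR c * ceval a x.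
Proof. apply lin_lscal. Qed.

Definition shift (m : nat) (l : list Z) : list Z := repeat 0%Z m ++ l.

Lemma lin_shift m l f : lin (shift m l) f = lin l (fun n => f (m + n)%nat).
Proof.
  revert f; induction m as [|m IH]; intros f; [apply lin_ext; reflexivity|].
  change (shift (S m) l) with (0%Z :: shift m l). cbn [lin]. rewrite IH.
  rewrite Rmult_0_l, Rplus_0_l. reflexivity.
Qed.

(** Sends index n to |m - n|: the entries before index [m] are written backwards one at a time, and
    from [m] on the rest of the list starts again at 0. *)
Fixpoint reflect_at (m : nat) (l : list Z) : list Z :=
  match m, l with
  | O, _ => l
  | S _, nil => nil
  | S p, y :: l' => ladd (shift m (y :: nil)) (reflect_at p l')
  end.

Lemma lin_reflect_at m l f : lin (reflect_at m l) f = lin l (fun n => f (ndist m n)).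
Proof.
  revert l f; induction m as [|m IH]; intros l f.
  { apply lin_ext; intros n. unfold ndist. rewrite Nat.sub_0_r. reflexivity. }
  destruct l as [|y l]; [reflexivity|].
  change (reflect_at (S m) (y :: l)) with (ladd (shift (S m) (y :: nil)) (reflect_at m l)).
  rewrite lin_ladd, lin_shift, IH. cbn [lin]. rewrite Rplus_0_r.
  unfold ndist. simpl. rewrite Nat.add_0_r. reflexivity.
Qed.

(* Both [T_(m + n)] and [T_|m - n|] in the expansion of [2 T_m T_n] carry the
   coefficient [a_m b_n], so each product of coefficients is computed once. *)
Fixpoint cmul2_from (m : nat) (a b : list Z) : list Z :=
  match a with
  | nil => nil
  | x :: a' => let row := lscal x b in
               ladd (ladd (shift m row) (reflect_at m row)) (cmul2_from (S m) a' b)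
  end.

Definition cmul2 : list Z -> list Z -> list Z := cmul2_from 0.

Lemma lin_cmul2_from m a b f : lin (cmul2_from m a b) f =
  lin a (fun i => lin b (fun n => f (m + i + n)%nat + f (ndist (m + i) n))).
Proof.
  revert m; induction a as [|x a IH]; intros m; [reflexivity|].
  cbn [cmul2_from lin]. rewrite !lin_ladd, lin_shift, lin_reflect_at, !lin_lscal, IH.
  rewrite <- Rmult_plus_distr_l, <- lin_plus, Nat.add_0_r. f_equal.
  apply lin_ext; intros i. apply lin_ext; intros n. rewrite Nat.add_succ_r. reflexivity.
Qed.

Lemma ceval_cmul2 a b x : -1 <= x <= 1 -> ceval (cmul2 a b) x = 2 * (ceval a x * ceval b x).
Proof.
  intros Hx. unfold ceval, cmul2. rewrite lin_cmul2_from. set (B := lin b _).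
  replace (2 * (lin a (fun i => cheb i x) * B)) with ((2 * B) * lin a (fun i => cheb i x)) by ring.
  rewrite <- lin_scal. apply lin_ext; intros m.
  replace (2 * B * cheb m x) with ((2 * cheb m x) * B) by ring.
  unfold B. rewrite <- lin_scal. apply lin_ext; intros n.
  rewrite <- cheb_mul by exact Hx. simpl. ring.
Qed.

(** Chebyshev polynomials of the second kind with shifted index, U_(n-1), so that T_n' = n U_(n-1)
    needs no exception at n = 0. *)
Fixpoint chebV (n : nat) (x : R) : R :=
  match n with
  | O => 0
  | S m => match m with O => 1 | S p => 2 * x * chebV m x - chebV p x end
  end.

Lemma chebV_SS n x : chebV (S (S n)) x = 2 * x * chebV (S n) x - chebV n x.
Proof. reflexivity. Qed.

Lemma chebV_diff n x : chebV (S (S n)) x - chebV n x = 2 * cheb (S n) x.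
Proof.
  enough (H : chebV (S (S n)) x - chebV n x = 2 * cheb (S n) x /\
              chebV (S (S (S n))) x - chebV (S n) x = 2 * cheb (S (S n)) x)
    by apply H.
  induction n as [|n [IH1 IH2]].
  - simpl. split; ring.
  - split; [exact IH2|].
    rewrite (chebV_SS (S (S n))), (cheb_SS (S n)), (chebV_SS n) in *.
    transitivity (2 * x * (2 * cheb (S (S n)) x) - 2 * cheb (S n) x); [|ring].
    rewrite <- IH1, <- IH2. ring.
Qed.

Lemma is_derive_cheb n x : is_derive (cheb n) x (INR n * chebV n x).
Proof.
  enough (H : is_derive (cheb n) x (INR n * chebV n x) /\
              is_derive (cheb (S n)) x (INR (S n) * chebV (S n) x)) by apply H.
  induction n as [|n [IH1 IH2]].
  - split.
    + apply is_derive_ext with (fun _ => 1); [reflexivity|].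
      auto_derive; auto. simpl; ring.
    + apply is_derive_ext with (fun x => x); [reflexivity|].
      auto_derive; auto. simpl; ring.
  - split; [exact IH2|].
    apply is_derive_ext with (fun x => 2 * x * cheb (S n) x - cheb n x); [reflexivity|].
    assert (A : forall f g df dg, is_derive f x df -> is_derive g x dg ->
              is_derive (fun y => 2 * y * f y - g y) x (2 * f x + 2 * x * df - dg)).
    { intros f g df dg Hf Hg. auto_derive; [repeat split; eexists; eassumption|].
      rewrite (is_derive_unique _ _ _ Hf : Derive (fun x => f x) x = df).
      rewrite (is_derive_unique _ _ _ Hg : Derive (fun x => g x) x = dg). ring. }
    eapply (eq_ind _ (is_derive _ x)); [exact (A _ _ _ _ IH2 IH1)|].
    pose proof (chebV_diff n x : _ = _ :> R) as H.
    match goal with |- ?a = ?b => change (a = b :> R) end.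
    rewrite (chebV_SS n) in *. rewrite !S_INR.
    replace (cheb (S n) x) with ((2 * x * chebV (S n) x - chebV n x - chebV n x) / 2) by lra.
    field.
Qed.

Fixpoint weights (k : Z) (l : list Z) : list Z :=
  match l with nil => nil | a :: l' => (k * a)%Z :: weights (k + 1) l' end.

(** Each entry is added to every second later one. This is what differentiation requires, as U_(n-1)
    = 2 (T_(n-1) + T_(n-3) + ...) with T_0, if it occurs, counted only once. *)
Fixpoint suffix_sums (l : list Z) : list Z :=
  match l with
  | nil => nil
  | a :: l' => let r := suffix_sums l' in (a + nth 1 r 0%Z)%Z :: r
  end.

Definition cder (l : list Z) : list Z :=
  match suffix_sums (weights 1 (tl l)) with
  | nil => nil
  | e :: r => e :: lscal 2 r
  end.

Lemma lin_weights k l f : lin (weights k l) f = lin l (fun i => (IZR k + INR i) * f i).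
Proof.
  revert k f; induction l as [|a l IH]; intros k f; cbn [lin weights]; auto.
  rewrite IH, mult_IZR. f_equal; [simpl; ring|].
  apply lin_ext; intros i. rewrite plus_IZR, S_INR. ring.
Qed.

(** Summation by parts with step two, which leaves two boundary terms. *)
Lemma lin_suffix_sums l g :
  lin (suffix_sums l) (fun j => g (S (S j)) - g j) =
  lin l (fun j => g (S (S j))) -
  IZR (nth 0 (suffix_sums l) 0%Z) * g O - IZR (nth 1 (suffix_sums l) 0%Z) * g 1%nat.
Proof.
  revert g; induction l as [|a l IH]; intros g; simpl; [ring|].
  rewrite (IH (fun j => g (S j))), plus_IZR.
  change (match suffix_sums l with nil => 0%Z | a :: _ => a end) with (nth 0 (suffix_sums l) 0%Z).
  ring.
Qed.

Lemma ceval_cder l x : ceval (cder l) x = lin l (fun i => INR i * chebV i x).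
Proof.
  destruct l as [|a l]; [reflexivity|].
  (* The value -1 in front is U_(-2): it makes the difference at j = 0 equal to 2 T_0, and its
     boundary term accounts for T_0 being counted once. *)
  pose (g := fun j => match j with O => -1 | S i => chebV i x end).
  transitivity (lin (weights 1 l) (fun j => g (S (S j)))).
  - pose proof (lin_suffix_sums (weights 1 l) g) as H.
    rewrite (lin_ext _ _ (fun j => 2 * cheb j x)) in H.
    2:{ intros [|j]; simpl; [ring|]. apply chebV_diff. }
    rewrite lin_scal in H. unfold cder, ceval; simpl tl.
    destruct (suffix_sums (weights 1 l)) as [|e r]; simpl in *.
    + rewrite Rmult_0_r in H. lra.
    + rewrite lin_lscal. lra.
  - rewrite lin_weights. simpl. rewrite Rmult_0_l, Rmult_0_r, Rplus_0_l.
    apply lin_ext; intros i.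
    replace (1 + INR i) with (INR (S i)) by (rewrite S_INR; ring). reflexivity.
Qed.

Lemma is_derive_ceval l x : is_derive (ceval l) x (ceval (cder l) x).
Proof.
  rewrite ceval_cder. unfold ceval.
  enough (H : forall k, is_derive (fun x => lin l (fun i => cheb (i + k) x)) x
                          (lin l (fun i => INR (i + k) * chebV (i + k) x))).
  { specialize (H O).
    rewrite (lin_ext l (fun i => INR i * chebV i x) (fun i => INR (i + 0) * chebV (i + 0) x))
      by (intros i; rewrite Nat.add_0_r; reflexivity).
    apply is_derive_ext with (fun x => lin l (fun i => cheb (i + 0) x)); [|exact H].
    intros t. apply lin_ext; intros i. rewrite Nat.add_0_r. reflexivity. }
  induction l as [|a l IH]; intros k; simpl.
  - apply (is_derive_const (K := R_AbsRing) (V := R_NormedModule)).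
  - apply (is_derive_plus (K := R_AbsRing) (V := R_NormedModule)
             (fun x => IZR a * cheb k x)).
    + apply is_derive_scal, is_derive_cheb.
    + specialize (IH (S k)).
      rewrite (lin_ext l _ (fun i => INR (i + S k) * chebV (i + S k) x))
        by (intros i; rewrite <- plus_n_Sm; reflexivity).
      apply is_derive_ext with (fun x => lin l (fun i => cheb (i + S k) x)); [|exact IH].
      intros t. apply lin_ext; intros i. rewrite <- plus_n_Sm. reflexivity.
Qed.

(** * Values at the endpoints *)

Lemma cheb_1 n : cheb n 1 = 1.
Proof. rewrite <- cos_0, cheb_cos, Rmult_0_r. reflexivity. Qed.

Lemma cheb_m1 n : cheb n (-1) = IZR ((-1) ^ Z.of_nat n).
Proof.
  enough (H : cheb n (-1) = IZR ((-1) ^ Z.of_nat n) /\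
              cheb (S n) (-1) = IZR ((-1) ^ Z.of_nat (S n))) by apply H.
  induction n as [|n [IH1 IH2]]; [simpl; split; lra|].
  split; [exact IH2|]. rewrite cheb_SS, IH1, IH2.
  rewrite !Nat2Z.inj_succ, !Z.pow_succ_r, !mult_IZR by lia. lra.
Qed.

Definition sum1 (l : list Z) : Z := fold_right Z.add 0%Z l.
Fixpoint altsum (l : list Z) : Z :=
  match l with nil => 0%Z | a :: l' => (a - altsum l')%Z end.

Lemma ceval_1 l : ceval l 1 = IZR (sum1 l).
Proof.
  unfold ceval. rewrite (lin_ext _ _ (fun _ => 1)) by (intros; apply cheb_1).
  induction l as [|a l IH]; simpl; auto. rewrite IH, plus_IZR. ring.
Qed.

Lemma ceval_m1 l : ceval l (-1) = IZR (altsum l).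
Proof.
  unfold ceval. rewrite (lin_ext _ _ (fun i => IZR ((-1) ^ Z.of_nat i))) by (intros; apply cheb_m1).
  induction l as [|a l IH]; cbn [lin altsum]; auto.
  rewrite (lin_ext _ _ (fun i => (-1) * IZR ((-1) ^ Z.of_nat i))).
  - rewrite lin_scal, IH, minus_IZR. simpl. ring.
  - intros i. rewrite Nat2Z.inj_succ, Z.pow_succ_r, mult_IZR by lia. ring.
Qed.

(** * Chebyshev models: integer Chebyshev series with an error bound *)

Record model : Type := Model { mpoly : list Z; merr : Z }.

Definition encl (s : Z) (f : R -> R) (t : model) : Prop :=
  forall x, -1 <= x <= 1 ->
  Rabs (IZR (2 ^ s) * f x - ceval (mpoly t) x) <= IZR (merr t).

Definition mbound (t : model) : Z := (norm1 (mpoly t) + merr t)%Z.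

Lemma IZR_pow2_pos s : (0 <= s)%Z -> 0 < IZR (2 ^ s).
Proof. intros H. apply IZR_lt. apply Z.pow_pos_nonneg; lia. Qed.

Lemma encl_bound s f t : encl s f t ->
  forall x, -1 <= x <= 1 -> IZR (2 ^ s) * Rabs (f x) <= IZR (mbound t).
Proof.
  intros H x Hx. specialize (H x Hx). pose proof (ceval_bound (mpoly t) x Hx) as Hb.
  unfold mbound. rewrite plus_IZR.
  destruct (Z_le_gt_dec 0 s) as [Hs|Hs].
  - rewrite <- (Rabs_pos_eq (IZR (2 ^ s))) by (apply Rlt_le, IZR_pow2_pos, Hs).
    rewrite <- Rabs_mult.
    replace (IZR (2 ^ s) * f x) with
      ((IZR (2 ^ s) * f x - ceval (mpoly t) x) + ceval (mpoly t) x) by ring.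
    eapply Rle_trans; [apply Rabs_triang|]. lra.
  (* For negative [s] the integer 2^s is 0, and only nonnegativity of [mbound t] has to be shown. *)
  - rewrite Z.pow_neg_r in * by lia. pose proof (Rabs_pos (ceval (mpoly t) x)).
    rewrite !Rmult_0_l in *. pose proof (Rabs_pos (0 - ceval (mpoly t) x)). lra.
Qed.

Definition mconst (s c : Z) : model := Model ((c * 2 ^ s)%Z :: nil) 0.
Definition mexact (l : list Z) : model := Model l 0.
Definition madd (a b : model) : model := Model (ladd (mpoly a) (mpoly b)) (merr a + merr b).
Definition mscal (c : Z) (a : model) : model := Model (lscal c (mpoly a)) (Z.abs c * merr a).

Lemma encl_const s c : encl s (fun _ => IZR c) (mconst s c).
Proof.
  intros x _. unfold ceval; simpl. rewrite mult_IZR.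
  replace (_ - _) with 0 by ring. rewrite Rabs_R0. lra.
Qed.

Lemma encl_exact s l : (0 <= s)%Z -> encl s (fun x => ceval l x / IZR (2 ^ s)) (mexact l).
Proof.
  intros Hs x _. simpl. pose proof (IZR_pow2_pos s Hs).
  replace (_ - _) with 0 by (field; lra). rewrite Rabs_R0. lra.
Qed.

Lemma encl_ext s f g t : (forall x, -1 <= x <= 1 -> f x = g x) -> encl s f t -> encl s g t.
Proof. intros E H x Hx. rewrite <- E by exact Hx. apply H, Hx. Qed.

Lemma encl_add s f g a b : encl s f a -> encl s g b -> encl s (fun x => f x + g x) (madd a b).
Proof.
  intros Ha Hb x Hx. specialize (Ha x Hx). specialize (Hb x Hx).
  simpl. rewrite ceval_ladd, plus_IZR.
  replace (_ - _) with ((IZR (2 ^ s) * f x - ceval (mpoly a) x) +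
    (IZR (2 ^ s) * g x - ceval (mpoly b) x)) by ring.
  eapply Rle_trans; [apply Rabs_triang|]. lra.
Qed.

Lemma encl_scal s c f a : encl s f a -> encl s (fun x => IZR c * f x) (mscal c a).
Proof.
  intros Ha x Hx. specialize (Ha x Hx).
  simpl. rewrite ceval_lscal, mult_IZR, abs_IZR.
  replace (_ - _) with (IZR c * (IZR (2 ^ s) * f x - ceval (mpoly a) x)) by ring.
  rewrite Rabs_mult. apply Rmult_le_compat_l; [apply Rabs_pos|exact Ha].
Qed.

Fixpoint trim (l : list Z) : list Z :=
  match l with
  | nil => nil
  | a :: l' => match trim l' with
               | nil => if Z.eqb a 0 then nil else a :: nil
               | r => a :: r
               end
  end.

(* Any list may be returned as rounded series, since the rounding error is
   computed from it. *)
Definition mround (k : Z) (n : nat) (t : model) : model :=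
  let l := trim (map (fun z => Z.shiftr (z + Z.shiftl 1 (k - 1)) k) (firstn n (mpoly t))) in
  Model l ((norm1 (ladd (mpoly t) (lscal (- 2 ^ k) l)) + merr t) / 2 ^ k + 1).

Lemma encl_round k s n f t : (0 <= k)%Z -> (0 <= s)%Z ->
  encl (s + k) f t -> encl s f (mround k n t).
Proof.
  intros Hk Hs H x Hx. specialize (H x Hx). unfold mround.
  set (l := trim _). cbn [mpoly merr].
  set (d := ladd _ _). pose proof (ceval_bound d x Hx) as Hd.
  unfold d in Hd at 1. rewrite ceval_ladd, ceval_lscal, opp_IZR in Hd.
  rewrite Z.pow_add_r, mult_IZR in H by lia.
  pose proof (IZR_pow2_pos k Hk) as Hp.
  apply Rmult_le_reg_l with (IZR (2 ^ k)); [exact Hp|].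
  rewrite <- (Rabs_pos_eq (IZR (2 ^ k))) at 1 by lra.
  rewrite <- Rabs_mult, <- mult_IZR.
  apply Rle_trans with (IZR (norm1 d + merr t)).
  - rewrite plus_IZR.
    replace (_ * (_ - _)) with
      ((ceval (mpoly t) x + - IZR (2 ^ k) * ceval l x) +
       (IZR (2 ^ s) * IZR (2 ^ k) * f x - ceval (mpoly t) x)) by ring.
    eapply Rle_trans; [apply Rabs_triang|]. lra.
  (* Integer division rounds down; the final [+ 1] in [mround] compensates. *)
  - apply IZR_le. set (A := (norm1 d + merr t)%Z).
    assert (0 < 2 ^ k)%Z by (apply lt_IZR, Hp).
    pose proof (Z.mul_succ_div_gt A (2 ^ k) ltac:(lia)). lia.
Qed.

(** [cmul2] gives twice the product, and the factors carry 2^s each, so s + 1 bits have to be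
    dropped; the factor 2 in the error has the same origin. *)
Definition mmul (s : Z) (n : nat) (a b : model) : model :=
  mround (s + 1) n
    (Model (cmul2 (mpoly a) (mpoly b))
       (2 * (norm1 (mpoly a) * merr b + norm1 (mpoly b) * merr a + merr a * merr b))).

Lemma encl_mul s n f g a b : (0 <= s)%Z ->
  encl s f a -> encl s g b -> encl s (fun x => f x * g x) (mmul s n a b).
Proof.
  intros Hs Ha Hb. apply encl_round; [lia|lia|].
  intros x Hx. specialize (Ha x Hx). specialize (Hb x Hx). cbn [mpoly merr].
  rewrite ceval_cmul2 by exact Hx.
  replace (s + (s + 1))%Z with (1 + s + s)%Z by ring.
  rewrite !Z.pow_add_r, !mult_IZR, !plus_IZR, !mult_IZR by lia.
  change (IZR (2 ^ 1)) with 2.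
  pose proof (ceval_bound (mpoly a) x Hx) as Na. pose proof (ceval_bound (mpoly b) x Hx) as Nb.
  set (A := ceval (mpoly a) x) in *. set (B := ceval (mpoly b) x) in *.
  set (u := IZR (2 ^ s) * f x - A) in *. set (v := IZR (2 ^ s) * g x - B) in *.
  replace (_ - _) with (2 * (A * v + B * u + u * v)) by (unfold u, v; ring).
  rewrite Rabs_mult, (Rabs_pos_eq 2) by lra.
  apply Rmult_le_compat_l; [lra|].
  eapply Rle_trans; [apply Rabs_triang|]. rewrite Rabs_mult.
  apply Rplus_le_compat; [|apply Rmult_le_compat; auto using Rabs_pos].
  eapply Rle_trans; [apply Rabs_triang|]. rewrite !Rabs_mult.
  apply Rplus_le_compat; apply Rmult_le_compat; auto using Rabs_pos.
Qed.

(** * A fixed-point theorem in the space of bounded continuous functions *)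

Definition cont_ball (r : R) (z : nat -> R -> R) : Prop :=
  (forall i t, continuous (z i) t) /\ (forall i t, Rabs (z i t) <= r).

Lemma geometric_small (C k e : R) : 0 <= k < 1 -> 0 < e ->
  exists n : nat, C * k ^ n < e.
Proof.
  intros Hk He. destruct (pow_lt_1_zero k) with (y := e / (Rabs C + 1)) as [n Hn].
  - rewrite Rabs_pos_eq; lra.
  - apply Rdiv_lt_0_compat; [lra|]. pose proof (Rabs_pos C); lra.
  - exists n. specialize (Hn n (le_n n)).
    pose proof (pow_le k n (proj1 Hk)). rewrite Rabs_pos_eq in Hn by lra.
    pose proof (Rabs_pos C). pose proof (Rle_abs C).
    apply Rle_lt_trans with ((Rabs C + 1) * k ^ n); [nra|].
    apply Rmult_lt_compat_l with (r := Rabs C + 1) in Hn; [|lra].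
    replace ((Rabs C + 1) * (e / (Rabs C + 1))) with e in Hn by (field; lra). exact Hn.
Qed.

Lemma uniform_limit_continuous (u : nat -> R -> R) (f : R -> R) t :
  (forall e, 0 < e -> exists n, forall s, Rabs (f s - u n s) < e) ->
  (forall n, continuous (u n) t) -> continuous f t.
Proof.
  intros Hu Hc. apply continuity_pt_filterlim.
  intros e He. destruct (Hu (e / 3)) as [n Hn]; [lra|].
  specialize (Hc n). apply continuity_pt_filterlim in Hc.
  destruct (Hc (e / 3)) as [d [Hd H]]; [lra|].
  exists d. split; [exact Hd|]. intros s Hs. specialize (H s Hs).
  simpl in *. unfold R_dist in *.
  pose proof (Hn s) as H1. pose proof (Hn t) as H2.
  apply Rabs_def2 in H1. apply Rabs_def2 in H2. apply Rabs_def2 in H.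
  apply Rabs_def1; lra.
Qed.

(** Banach's theorem for the sup norm, by iteration from 0. A number [d] bounding all differences
    takes the place of the distance, so no supremum is ever formed. *)
Lemma continuous_fixed_point (K : (nat -> R -> R) -> nat -> R -> R) (r k : R) :
  0 <= k < 1 -> 0 <= r ->
  (forall z, cont_ball r z -> cont_ball r (K z)) ->
  (forall z z' d, cont_ball r z -> cont_ball r z' ->
     (forall i t, Rabs (z i t - z' i t) <= d) ->
     forall i t, Rabs (K z i t - K z' i t) <= k * d) ->
  exists z, cont_ball r z /\ forall i t, K z i t = z i t.
Proof.
  intros Hk Hr HK HL.
  set (u := fun n => Nat.iter n K (fun _ _ => 0)).
  assert (Hu : forall n, cont_ball r (u n)).
  { induction n as [|n IH]; [|apply HK, IH].
    split; intros i t; simpl; [apply continuous_const|rewrite Rabs_R0; exact Hr]. }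
  assert (Hstep : forall n i t, Rabs (u (S n) i t - u n i t) <= r * k ^ n).
  { induction n as [|n IH]; intros i t.
    - simpl. rewrite Rminus_0_r, Rmult_1_r. apply (Hu 1%nat).
    - replace (r * k ^ S n) with (k * (r * k ^ n)) by (simpl; ring).
      apply HL; auto. }
  set (C := r / (1 - k)).
  assert (HC : 0 <= C) by (apply Rdiv_le_0_compat; lra).
  (* The partial geometric sum is kept in telescoped form, so that the induction on [m] only adds
     one step. *)
  assert (Hdist : forall n m i t, Rabs (u (n + m)%nat i t - u n i t) <= C * (k ^ n - k ^ (n + m))).
  { intros n m i t. induction m as [|m IH].
    - rewrite Nat.add_0_r, Rminus_diag, Rabs_R0. lra.
    - rewrite Nat.add_succ_r. specialize (Hstep (n + m)%nat i t).
      replace (C * (k ^ n - k ^ S (n + m))) with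
        (r * k ^ (n + m) + C * (k ^ n - k ^ (n + m))) by (unfold C; simpl; field; lra).
      apply Rabs_le_between in IH. apply Rabs_le_between in Hstep. apply Rabs_le. lra. }
  assert (Hpow : forall n, 0 <= k ^ n) by (intros; apply pow_le; lra).
  assert (Hdist' : forall n m i t, (n <= m)%nat -> Rabs (u m i t - u n i t) <= C * k ^ n).
  { intros n m i t Hnm. replace m with (n + (m - n))%nat by lia.
    eapply Rle_trans; [apply Hdist|]. pose proof (Hpow (n + (m - n))%nat). nra. }
  assert (Hcv : forall i t, { l : R | Un_cv (fun n => u n i t) l }).
  { intros i t. apply Rcomplete.R_complete. intros e He.
    destruct (geometric_small (2 * C) k e Hk He) as [N HN].
    exists N. intros n m Hn Hm. unfold R_dist.
    pose proof (Hdist' N n i t Hn) as H1. pose proof (Hdist' N m i t Hm) as H2.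
    apply Rabs_le_between in H1. apply Rabs_le_between in H2. apply Rabs_def1; lra. }
  set (z := fun i t => proj1_sig (Hcv i t)).
  assert (Hz : forall n i t, Rabs (z i t - u n i t) <= C * k ^ n).
  { intros n i t. unfold z. destruct (Hcv i t) as [l Hl]; simpl.
    apply Rnot_lt_le. intros Hlt.
    destruct (Hl (Rabs (l - u n i t) - C * k ^ n)) as [N HN]; [lra|].
    specialize (HN (N + n)%nat ltac:(lia)). unfold R_dist in HN.
    pose proof (Hdist' n (N + n)%nat i t ltac:(lia)) as H1.
    pose proof (Rabs_triang (l - u (N + n)%nat i t) (u (N + n)%nat i t - u n i t)) as H2.
    rewrite Rabs_minus_sym in HN.
    replace (l - u (N + n)%nat i t + (u (N + n)%nat i t - u n i t)) with (l - u n i t) in H2 by ring.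
    lra. }
  assert (Bz : cont_ball r z).
  { split; intros i t.
    - apply (uniform_limit_continuous (fun n => u n i)).
      + intros e He. destruct (geometric_small C k e Hk He) as [n Hn].
        exists n. intros s. eapply Rle_lt_trans; [apply Hz|exact Hn].
      + intros n. apply (Hu n).
    - apply Rnot_lt_le. intros Hlt.
      destruct (geometric_small C k (Rabs (z i t) - r) Hk) as [n Hn]; [lra|].
      pose proof (Hz n i t) as H1. pose proof (proj2 (Hu n) i t) as H2.
      pose proof (Rabs_triang_inv (z i t) (u n i t)). lra. }
  exists z. split; [exact Bz|].
  intros i t. apply Rminus_diag_uniq.
  destruct (Req_dec (K z i t - z i t) 0) as [H|H]; [exact H|exfalso].
  apply Rabs_pos_lt in H.
  destruct (geometric_small (2 * C) k _ Hk H) as [n Hn].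
  assert (H1 := HL z (u n) (C * k ^ n) Bz (Hu n) (Hz n) i t).
  change (K (u n) i t) with (u (S n) i t) in H1.
  pose proof (Hz (S n) i t) as H2.
  assert (H3 : 0 <= C * k ^ n) by (apply Rmult_le_pos; auto).
  assert (H4 : k * (C * k ^ n) <= C * k ^ n) by nra.
  replace (C * k ^ S n) with (k * (C * k ^ n)) in H2 by (simpl; ring).
  revert Hn. apply Rle_not_lt.
  replace (K z i t - z i t) with ((K z i t - u (S n) i t) - (z i t - u (S n) i t)) by ring.
  apply Rabs_le_between in H1. apply Rabs_le_between in H2. apply Rabs_le. lra.
Qed.

(** * Boundary value problems near an approximate solution *)

(** Retraction of the line onto [-1, 1]: the iteration can run on functions defined everywhere,
    without one-sided continuity, although the estimates hold on [-1, 1] only. *)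
Definition clamp (t : R) : R := Rmax (-1) (Rmin 1 t).

Lemma clamp_in t : -1 <= clamp t <= 1.
Proof.
  unfold clamp. split; [apply Rmax_l|].
  apply Rmax_lub; [lra|apply Rmin_l].
Qed.

Lemma clamp_id t : -1 <= t <= 1 -> clamp t = t.
Proof. intros H. unfold clamp. rewrite Rmin_right, Rmax_right; lra. Qed.

Lemma continuous_clamp t : continuous clamp t.
Proof.
  apply continuity_pt_filterlim. intros e He. exists e. split; [exact He|].
  intros s [_ Hs]. simpl in *. unfold R_dist, clamp in *.
  eapply Rle_lt_trans; [|exact Hs].
  unfold Rmax, Rmin. repeat destruct Rle_dec; unfold Rabs; repeat destruct Rcase_abs; lra.
Qed.

Lemma continuous_sum (f : nat -> R -> R) n t :
  (forall k, (k <= n)%nat -> continuous (f k) t) ->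
  continuous (fun s => sum_f_R0 (fun k => f k s) n) t.
Proof.
  induction n as [|n IH]; intros H; simpl; [apply H; lia|].
  apply (continuous_plus (K := R_AbsRing) (V := R_NormedModule));
    [apply IH; intros; apply H; lia|apply H; lia].
Qed.

Lemma is_derive_sum (f : nat -> R -> R) (df : nat -> R) n t :
  (forall k, (k <= n)%nat -> is_derive (f k) t (df k)) ->
  is_derive (fun s => sum_f_R0 (fun k => f k s) n) t (sum_f_R0 df n).
Proof.
  induction n as [|n IH]; intros H; simpl; [apply H; lia|].
  apply (is_derive_plus (K := R_AbsRing) (V := R_NormedModule)
    (fun s => sum_f_R0 (fun k => f k s) n)); [apply IH; intros; apply H; lia|apply H; lia].
Qed.

Lemma sum_abs_bound (a x : nat -> R) (b : nat -> R) n :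
  (forall k, (k <= n)%nat -> Rabs (x k) <= b k) ->
  Rabs (sum_f_R0 (fun k => a k * x k) n) <= sum_f_R0 (fun k => Rabs (a k) * b k) n.
Proof.
  intros H. eapply Rle_trans; [apply Rsum_abs|].
  apply sum_Rle. intros k Hk. rewrite Rabs_mult.
  apply Rmult_le_compat_l; [apply Rabs_pos|auto].
Qed.

Lemma sum_minus_distr (a x y : nat -> R) n :
  sum_f_R0 (fun k => a k * x k) n - sum_f_R0 (fun k => a k * y k) n =
  sum_f_R0 (fun k => a k * (x k - y k)) n.
Proof. induction n as [|n IH]; simpl; lra. Qed.

Lemma sum_kronecker (x : nat -> R) n i : (i <= n)%nat ->
  sum_f_R0 (fun l => (if Nat.eqb i l then 1 else 0) * x l) n = x i.
Proof.
  assert (H0 : forall m, (m < i)%nat -> sum_f_R0 (fun l => (if Nat.eqb i l then 1 else 0) * x l) m = 0).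
  { induction m as [|m IH]; intros Hm; simpl.
    - destruct i; [lia|simpl; ring].
    - rewrite IH by lia. destruct (Nat.eqb_spec i (S m)); [lia|]. ring. }
  induction n as [|n IH]; intros Hi.
  - replace i with O by lia. simpl. ring.
  - simpl. destruct (Nat.eqb_spec i (S n)) as [->|H].
    + rewrite H0 by lia. ring.
    + rewrite IH by lia. ring.
Qed.

Lemma sum_exchange (a : nat -> R) (b : nat -> nat -> R) (x : nat -> R) n m :
  sum_f_R0 (fun k => a k * sum_f_R0 (fun l => b k l * x l) m) n =
  sum_f_R0 (fun l => sum_f_R0 (fun k => a k * b k l) n * x l) m.
Proof.
  induction n as [|n IH]; simpl.
  - rewrite scal_sum. apply sum_eq. intros; ring.
  - rewrite IH, scal_sum, <- plus_sum. apply sum_eq. intros; ring.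
Qed.

Lemma is_derive_continuous (f : R -> R) t l : is_derive f t l -> continuous f t.
Proof.
  intros H. apply (ex_derive_continuous (K := R_AbsRing) (V := R_NormedModule)).
  exists l. exact H.
Qed.

Section BVP.

Variable N : nat.
Variables w dw : nat -> R -> R.
Variables Y dY Z : nat -> nat -> R -> R.
Variable c : nat -> R.
Variable F : nat -> (nat -> R) -> R.
Variable g : nat -> R.
Variables r e0 e1 k0 : R.

Let state (x : nat -> R) (t : R) (j : nat) : R :=
  w j t + sum_f_R0 (fun k => Y j k t * x k) N.

Hypothesis w_derive : forall i t, is_derive (w i) t (dw i t).
Hypothesis dw_cont : forall i t, continuous (dw i) t.
Hypothesis Y_derive : forall i k t, is_derive (Y i k) t (dY i k t).
Hypothesis dY_cont : forall i k t, continuous (dY i k) t.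
Hypothesis Z_cont : forall k l t, continuous (Z k l) t.
Hypothesis c_in : forall k, -1 <= c k <= 1.
Hypothesis r_pos : 0 < r.
Hypothesis e1_pos : 0 <= e1.
Hypothesis k0_pos : 0 <= k0.
(** The factor 2 is the length of [-1, 1], over which [Z z] is integrated; hence a bound [d] on [z]
    gives [g k * d] for component k of xi. *)
Hypothesis Z_bound : forall t k, -1 <= t <= 1 -> (k <= N)%nat ->
  2 * sum_f_R0 (fun l => Rabs (Z k l t)) N <= g k.
Hypothesis YZ_inverse : forall t i, -1 <= t <= 1 -> (i <= N)%nat ->
  sum_f_R0 (fun l => Rabs ((if Nat.eqb i l then 1 else 0) -
                           sum_f_R0 (fun k => Y i k t * Z k l t) N)) N <= e1.
Hypothesis residual : forall t i, -1 <= t <= 1 -> (i <= N)%nat ->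
  Rabs (dw i t - F i (state (fun _ => 0) t)) <= e0.
(** Comparing with [dY] instead of the Jacobian applied to [Y] lets [k0] absorb both the defect of
    [Y] in the linearised equation and the nonlinearity of [F]. *)
Hypothesis linearised : forall t i x y d, -1 <= t <= 1 -> (i <= N)%nat ->
  (forall k, (k <= N)%nat -> Rabs (x k) <= g k * r) ->
  (forall k, (k <= N)%nat -> Rabs (y k) <= g k * r) ->
  (forall k, (k <= N)%nat -> Rabs (x k - y k) <= g k * d) ->
  Rabs (F i (state x t) - F i (state y t) -
        sum_f_R0 (fun k => dY i k t * (x k - y k)) N) <= k0 * d.
Hypothesis F_cont : forall (x : nat -> R -> R) t i, -1 <= t <= 1 -> (i <= N)%nat ->
  (forall k, (k <= N)%nat -> continuous (x k) t) ->
  (forall k, (k <= N)%nat -> Rabs (x k t) <= g k * r) ->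
  continuous (fun s => F i (state (fun k => x k s) s)) t.
Hypothesis contracting : e1 + k0 < 1.
Hypothesis into_ball : e0 + (e1 + k0) * r <= r.

(* The unknown is [z], with [xi' = Z z]; [newton z] is [z] minus the residual
   of [w + Y xi] in the differential equation, and it contracts because [Y Z] is
   close to the identity. *)
Let eta (z : nat -> R -> R) (k : nat) (t : R) : R :=
  sum_f_R0 (fun l => Z k l t * z l t) N.
Let xi (z : nat -> R -> R) (k : nat) (t : R) : R := RInt (eta z k) (c k) t.

Let newton (z : nat -> R -> R) (i : nat) (t : R) : R :=
  sum_f_R0 (fun l => ((if Nat.eqb i l then 1 else 0) -
                      sum_f_R0 (fun k => Y i k t * Z k l t) N) * z l t) N
  - (dw i t + sum_f_R0 (fun k => dY i k t * xi z k t) N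
     - F i (state (fun k => xi z k t) t)).

(** Components beyond [N] are set to 0 because [cont_ball] constrains all indices. *)
Let step (z : nat -> R -> R) (i : nat) (t : R) : R :=
  if Nat.leb i N then newton z i (clamp t) else 0.

Lemma eta_cont z k t : (forall i t, continuous (z i) t) -> continuous (eta z k) t.
Proof.
  intros H. apply (continuous_sum (fun l s => Z k l s * z l s)).
  intros l _. apply (continuous_mult (K := R_AbsRing)); auto.
Qed.

Lemma xi_derive z k t : (forall i t, continuous (z i) t) -> is_derive (xi z k) t (eta z k t).
Proof.
  intros H. apply is_derive_RInt with (c k).
  - apply filter_forall. intros s.
    apply (RInt_correct (V := R_CompleteNormedModule) (eta z k)).
    apply (ex_RInt_continuous (V := R_CompleteNormedModule)).
    intros; apply eta_cont, H.
  - apply eta_cont, H.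
Qed.

Lemma xi_diff z z' d k t : (forall i t, continuous (z i) t) -> (forall i t, continuous (z' i) t) ->
  (forall i t, Rabs (z i t - z' i t) <= d) -> (k <= N)%nat -> -1 <= t <= 1 ->
  Rabs (xi z k t - xi z' k t) <= g k * d.
Proof.
  intros Hz Hz' Hd Hk Ht. unfold xi.
  assert (Hd0 : 0 <= d) by (eapply Rle_trans; [apply Rabs_pos|apply (Hd O 0)]).
  assert (E : forall y, (forall i t, continuous (y i) t) -> ex_RInt (eta y k) (c k) t)
    by (intros y Hy; apply (ex_RInt_continuous (V := R_CompleteNormedModule)); intros; apply eta_cont, Hy).
  rewrite <- (RInt_minus (V := R_CompleteNormedModule)) by auto.
  assert (E' : ex_RInt (fun s => minus (eta z k s) (eta z' k s)) (c k) t)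
    by (apply (ex_RInt_minus (V := R_NormedModule)); auto).
  assert (B : forall s, -1 <= s <= 1 -> Rabs (minus (eta z k s) (eta z' k s)) <= g k / 2 * d).
  { intros s Hs. unfold minus, plus, opp; simpl. fold (eta z k s - eta z' k s). unfold eta.
    change (sum_f_R0 (fun l => Z k l s * z l s) N + - sum_f_R0 (fun l => Z k l s * z' l s) N)
      with (sum_f_R0 (fun l => Z k l s * z l s) N - sum_f_R0 (fun l => Z k l s * z' l s) N).
    rewrite sum_minus_distr.
    eapply Rle_trans; [apply sum_abs_bound with (b := fun _ => d); auto|].
    rewrite <- scal_sum. specialize (Z_bound s k Hs Hk). nra. }
  assert (Hg : 0 <= g k).
  { eapply Rle_trans; [|apply (Z_bound t k Ht Hk)].
    apply Rmult_le_pos; [lra|]. apply cond_pos_sum. intros; apply Rabs_pos. }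
  assert (P : 0 <= g k / 2 * d) by (apply Rmult_le_pos; lra).
  replace (g k * d) with (2 * (g k / 2 * d)) by field.
  specialize (c_in k).
  destruct (Rle_dec (c k) t) as [Hc|Hc].
  - eapply Rle_trans; [apply abs_RInt_le_const with (M := g k / 2 * d); auto|].
    + intros s Hs. apply B. lra.
    + apply Rmult_le_compat_r; lra.
  - rewrite <- (opp_RInt_swap (V := R_CompleteNormedModule)) by (apply ex_RInt_swap; exact E').
    unfold opp; simpl. rewrite Rabs_Ropp.
    eapply Rle_trans; [apply abs_RInt_le_const with (M := g k / 2 * d)|].
    + lra.
    + apply ex_RInt_swap; exact E'.
    + intros s Hs. apply B. lra.
    + apply Rmult_le_compat_r; lra.
Qed.

Lemma xi_zero k t : xi (fun _ _ => 0) k t = 0.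
Proof.
  unfold xi. rewrite (RInt_ext _ (fun _ => 0)).
  - rewrite RInt_const. apply Rmult_0_r.
  - intros s _. unfold eta. rewrite (sum_eq _ (fun _ => 0 * 0)) by (intros; ring).
    rewrite <- scal_sum. apply Rmult_0_l.
Qed.

Lemma xi_le z k t : cont_ball r z -> (k <= N)%nat -> -1 <= t <= 1 ->
  Rabs (xi z k t) <= g k * r.
Proof.
  intros [Hc Hb] Hk Ht.
  rewrite <- (Rminus_0_r (xi z k t)), <- (xi_zero k t).
  apply xi_diff; auto; intros; [apply continuous_const|].
  rewrite Rminus_0_r. apply Hb.
Qed.

(** [dw] cancels in the difference. What remains is (I - Y Z)(z - z'), of size [e1 * d], and exactly
    the expression bounded in [linearised]. *)
Lemma step_diff z z' d : cont_ball r z -> cont_ball r z' ->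
  (forall i t, Rabs (z i t - z' i t) <= d) ->
  forall i t, Rabs (step z i t - step z' i t) <= (e1 + k0) * d.
Proof.
  intros Bz Bz' Hd i t. unfold step.
  assert (Hd0 : 0 <= d) by (eapply Rle_trans; [apply Rabs_pos|apply (Hd O 0)]).
  destruct (Nat.leb_spec i N) as [Hi|Hi].
  2:{ rewrite Rminus_diag, Rabs_R0. nra. }
  pose proof (clamp_in t) as Ht. generalize (clamp t) Ht; clear t Ht; intros t Ht.
  unfold newton.
  set (A := fun l => (if Nat.eqb i l then 1 else 0) - sum_f_R0 (fun k => Y i k t * Z k l t) N).
  assert (H1 : Rabs (sum_f_R0 (fun l => A l * (z l t - z' l t)) N) <= e1 * d).
  { eapply Rle_trans; [apply sum_abs_bound with (b := fun _ => d); auto|].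
    rewrite <- scal_sum. rewrite Rmult_comm.
    apply Rmult_le_compat_r; [exact Hd0|]. exact (YZ_inverse t i Ht Hi). }
  assert (H2 := linearised t i (fun k => xi z k t) (fun k => xi z' k t) d Ht Hi
            (fun k Hk => xi_le z k t Bz Hk Ht) (fun k Hk => xi_le z' k t Bz' Hk Ht)
            (fun k Hk => xi_diff z z' d k t (proj1 Bz) (proj1 Bz') Hd Hk Ht)).
  change (fun l => ((if (i =? l)%nat then 1 else 0) - sum_f_R0 (fun k => Y i k t * Z k l t) N) * z l t)
    with (fun l => A l * z l t).
  change (fun l => ((if (i =? l)%nat then 1 else 0) - sum_f_R0 (fun k => Y i k t * Z k l t) N) * z' l t)
    with (fun l => A l * z' l t).
  rewrite <- sum_minus_distr in H1, H2.
  apply Rabs_le_between in H1. apply Rabs_le_between in H2. apply Rabs_le. lra.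
Qed.

Lemma step_ball z : cont_ball r z -> cont_ball r (step z).
Proof.
  intros Bz.
  assert (B0 : cont_ball r (fun _ _ => 0)).
  { split; intros; [apply continuous_const|rewrite Rabs_R0; lra]. }
  split; intros i t.
  - unfold step. destruct (Nat.leb_spec i N) as [Hi|Hi]; [|apply continuous_const].
    apply (continuous_comp clamp (newton z i)); [apply continuous_clamp|].
    pose proof (clamp_in t) as Ht. revert Ht. generalize (clamp t); clear t; intros t Ht.
    assert (Hxi : forall k, continuous (xi z k) t)
      by (intros k; eapply is_derive_continuous, xi_derive, Bz).
    assert (HY : forall k, continuous (Y i k) t)
      by (intros k; eapply is_derive_continuous, Y_derive).
    unfold newton.
    apply (continuous_minus (K := R_AbsRing) (V := R_NormedModule)).
    + apply (continuous_sum (fun l s => ((if Nat.eqb i l then 1 else 0) -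
                      sum_f_R0 (fun k => Y i k s * Z k l s) N) * z l s)).
      intros l _. apply (continuous_mult (K := R_AbsRing)); [|apply Bz].
      apply (continuous_minus (K := R_AbsRing) (V := R_NormedModule)); [apply continuous_const|].
      apply (continuous_sum (fun k s => Y i k s * Z k l s)).
      intros k _. apply (continuous_mult (K := R_AbsRing)); auto.
    + apply (continuous_minus (K := R_AbsRing) (V := R_NormedModule)).
      * apply (continuous_plus (K := R_AbsRing) (V := R_NormedModule)); [apply dw_cont|].
        apply (continuous_sum (fun k s => dY i k s * xi z k s)).
        intros k _. apply (continuous_mult (K := R_AbsRing)); auto.
      * apply (F_cont (fun k => xi z k)); auto. intros; apply xi_le; auto.
  - assert (H := step_diff z (fun _ _ => 0) r Bz B0
      ltac:(intros; rewrite Rminus_0_r; apply Bz) i t).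
    (* At z = 0 also xi = 0, and [newton] reduces to minus the residual of [w]. *)
    assert (H0 : Rabs (step (fun _ _ => 0) i t) <= e0).
    { unfold step. destruct (Nat.leb_spec i N) as [Hi|Hi].
      - pose proof (clamp_in t) as Ht. revert Ht. generalize (clamp t); intros s Hs.
        unfold newton.
        rewrite (sum_eq _ (fun _ => 0 * 0)) by (intros; ring).
        rewrite (sum_eq (fun k => dY i k s * _) (fun _ => 0 * 0))
          by (intros; rewrite xi_zero; ring).
        rewrite <- scal_sum.
        replace (fun k => xi (fun _ _ => 0) k s) with (fun _ : nat => 0)
          by (apply functional_extensionality; intros; rewrite xi_zero; reflexivity).
        specialize (residual s i Hs Hi).
        rewrite Rmult_0_l, Rplus_0_r, Rminus_0_l, Rabs_Ropp. exact residual.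
      - rewrite Rabs_R0. eapply Rle_trans; [apply Rabs_pos|].
        apply (residual 0 O); [lra|lia]. }
    pose proof (Rabs_triang_inv (step z i t) (step (fun _ _ => 0) i t)). lra.
Qed.

Theorem bvp_solution : exists x : nat -> R -> R,
  (forall k, x k (c k) = 0) /\
  (forall k t, (k <= N)%nat -> -1 <= t <= 1 -> Rabs (x k t) <= g k * r) /\
  (forall i t, (i <= N)%nat -> -1 <= t <= 1 ->
     is_derive (fun s => state (fun k => x k s) s i) t (F i (state (fun k => x k t) t))).
Proof.
  destruct (continuous_fixed_point step r (e1 + k0)) as [z [Bz Hz]].
  - lra.
  - lra.
  - apply step_ball.
  - apply step_diff.
  - exists (xi z). split; [|split].
    + intros k. unfold xi. apply (RInt_point (V := R_CompleteNormedModule)).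
    + intros; apply xi_le; auto.
    + intros i t Hi Ht. specialize (Hz i t). unfold step in Hz.
      rewrite (proj2 (Nat.leb_le i N) Hi), clamp_id in Hz by exact Ht.
      assert (D : is_derive (fun s => state (fun k => xi z k s) s i) t
                (dw i t + sum_f_R0 (fun k => dY i k t * xi z k t + Y i k t * eta z k t) N)).
      { apply (is_derive_plus (K := R_AbsRing) (V := R_NormedModule)); [apply w_derive|].
        apply (is_derive_sum (fun k s => Y i k s * xi z k s)). intros k _.
        apply (is_derive_mult (K := R_AbsRing) (Y i k) (xi z k)); auto using Rmult_comm.
        apply xi_derive, Bz. }
      (* The exchange of sums rewrites Y (Z z) as (Y Z) z, the form in which it occurs in the
         fixed-point equation. *)
      rewrite plus_sum in D. unfold eta in D. rewrite sum_exchange in D.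
      unfold newton in Hz.
      replace (F i (state (fun k => xi z k t) t)) with
        (dw i t + (sum_f_R0 (fun k => dY i k t * xi z k t) N +
          sum_f_R0 (fun l => sum_f_R0 (fun k => Y i k t * Z k l t) N * z l t) N)); [exact D|].
      rewrite (sum_eq _ (fun l => (if Nat.eqb i l then 1 else 0) * z l t +
             (-1) * (sum_f_R0 (fun k => Y i k t * Z k l t) N * z l t))) in Hz by (intros; ring).
      rewrite plus_sum, (sum_kronecker (fun l => z l t)) in Hz by exact Hi.
      rewrite (sum_eq (fun l => -1 * _)
         (fun l => (sum_f_R0 (fun k => Y i k t * Z k l t) N * z l t) * -1)) in Hz by (intros; ring).
      rewrite <- scal_sum in Hz. lra.
Qed.

End BVP.

(** * The Newtonian force *)

(** First component of the vector (X, Y) divided by the cube of its length; the second component is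
    [kepler Y X]. *)
Definition kepler (X Y : R) : R := X / sqrt (X ^ 2 + Y ^ 2) ^ 3.

(** Homogeneity of degree -2. With [u] close to the inverse length it brings the estimates to the
    unit circle; with a constant [u] it rescales the orbit. *)
Lemma kepler_homogeneous u X Y : 0 < u -> 0 < X ^ 2 + Y ^ 2 ->
  kepler X Y = u ^ 2 * kepler (u * X) (u * Y).
Proof.
  intros Hu H. unfold kepler.
  replace ((u * X) ^ 2 + (u * Y) ^ 2) with (u ^ 2 * (X ^ 2 + Y ^ 2)) by ring.
  rewrite sqrt_mult, sqrt_pow2 by nra.
  pose proof (sqrt_lt_R0 _ H). field. lra.
Qed.

(** The slope of s^(-1/2) at 1 is -1/2, and 6/10 leaves room for the curvature. The witness v is the
    inverse square root, and s v^2 = 1 makes the later estimates polynomial in v. *)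
Lemma inv_sqrt_near s m : Rabs (s - 1) <= m -> m <= 1 / 10 ->
  exists v, 0 < v /\ s * v ^ 2 = 1 /\ / sqrt s ^ 3 = v ^ 3 /\ Rabs (v - 1) <= 6 / 10 * m.
Proof.
  intros H Hm. apply Rabs_le_between in H.
  assert (Hs : 0 < s) by lra. pose proof (sqrt_lt_R0 s Hs) as Hq.
  pose proof (sqrt_sqrt s ltac:(lra)) as Hqq.
  exists (/ sqrt s). assert (Hv : 0 < / sqrt s) by (apply Rinv_0_lt_compat, Hq).
  assert (E : s * (/ sqrt s) ^ 2 = 1) by (rewrite <- Hqq at 1; field; lra).
  split; [exact Hv|]. split; [exact E|]. split; [field; lra|].
  set (v := / sqrt s) in *. clearbody v. clear Hq Hqq.
  assert (Hv1 : v <= 107 / 100) by nra. assert (Hv2 : 93 / 100 <= v) by nra.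
  (* A smaller v would give s v^2 < (1 + m)(1 - 6/10 m)^2 <= 1; the upper bound is analogous. *)
  apply Rabs_le. split; apply Rnot_lt_le; intros Hlt.
  - assert (Hv3 : v ^ 2 < (1 - 6 / 10 * m) ^ 2) by nra.
    assert (Hp : (1 + m) * (1 - 6 / 10 * m) ^ 2 <= 1) by nra.
    assert (s * v ^ 2 <= (1 + m) * v ^ 2) by (apply Rmult_le_compat_r; nra).
    assert ((1 + m) * v ^ 2 < (1 + m) * (1 - 6 / 10 * m) ^ 2) by (apply Rmult_lt_compat_l; lra).
    lra.
  - assert (Hv3 : (1 + 6 / 10 * m) ^ 2 < v ^ 2) by nra.
    assert (Hp : 1 <= (1 - m) * (1 + 6 / 10 * m) ^ 2) by nra.
    assert ((1 - m) * v ^ 2 <= s * v ^ 2) by (apply Rmult_le_compat_r; nra).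
    assert ((1 - m) * (1 + 6 / 10 * m) ^ 2 < (1 - m) * v ^ 2) by (apply Rmult_lt_compat_l; lra).
    lra.
Qed.

Lemma Rabs_mult_le a b A B : Rabs a <= A -> Rabs b <= B -> Rabs (a * b) <= A * B.
Proof.
  intros. rewrite Rabs_mult. apply Rmult_le_compat; auto using Rabs_pos.
Qed.

Lemma Rabs_plus_le a b A B : Rabs a <= A -> Rabs b <= B -> Rabs (a + b) <= A + B.
Proof. intros. eapply Rle_trans; [apply Rabs_triang|lra]. Qed.

(** The slope of s^(-3/2) at 1 is -3/2, and within distance m of 1 the slope changes by a multiple
    of m. *)
Lemma inv_sqrt3_lipschitz s t m : Rabs (s - 1) <= m -> Rabs (t - 1) <= m -> m <= 1 / 10 ->
  Rabs (/ sqrt s ^ 3 - / sqrt t ^ 3 + 3 / 2 * (s - t)) <= 10 * m * Rabs (s - t).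
Proof.
  intros Hs Ht Hm.
  assert (Hm0 : 0 <= m) by (eapply Rle_trans; [apply Rabs_pos|exact Hs]).
  destruct (inv_sqrt_near s m Hs Hm) as [v [Hv [Ev [-> Nv]]]].
  destruct (inv_sqrt_near t m Ht Hm) as [y [Hy [Ey [-> Ny]]]].
  assert (Es : s = / v ^ 2) by (field_simplify_eq; [lra|lra]).
  assert (Et : t = / y ^ 2) by (field_simplify_eq; [lra|lra]).
  (* Here v^3 - y^3 = (v - y) A and v - y = - (s - t) B / (v + y), so s - t factors out exactly; the
     remaining factor [A * B - 3 / 2 * (v + y)] vanishes at v = y = 1. *)
  set (A := v ^ 2 + v * y + y ^ 2). set (B := (v * y) ^ 2).
  assert (E : v ^ 3 - y ^ 3 + 3 / 2 * (s - t) = - ((A * B - 3 / 2 * (v + y)) / (v + y)) * (s - t)).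
  { unfold A, B. rewrite Es, Et. field. repeat split; lra. }
  rewrite E, Rabs_mult. apply Rmult_le_compat_r; [apply Rabs_pos|].
  rewrite Rabs_Ropp. apply Rabs_le_between in Nv. apply Rabs_le_between in Ny.
  assert (HA : Rabs (A - 3) <= 4 * m) by (apply Rabs_le; unfold A; nra).
  assert (Hvy : Rabs (v * y - 1) <= 125 / 100 * m) by (apply Rabs_le; nra).
  assert (HB : Rabs (B - 1) <= 28 / 10 * m).
  { apply Rabs_le. apply Rabs_le_between in Hvy. unfold B. nra. }
  unfold Rdiv. rewrite Rabs_mult, Rabs_inv, (Rabs_pos_eq (v + y)) by lra.
  assert (H : Rabs (A * B - 3 / 2 * (v + y)) <= 16 * m).
  { replace (A * B - 3 / 2 * (v + y)) with
      ((A - 3) * (B - 1) + ((A - 3) + (3 * (B - 1) + - (3 / 2) * (v + y - 2)))) by field.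
    assert (H1 := Rabs_mult_le _ _ _ _ HA HB).
    apply Rabs_le_between in H1. apply Rabs_le_between in HA. apply Rabs_le_between in HB.
    apply Rabs_le. nra. }
  apply Rle_trans with (16 * m * / (v + y)).
  - apply Rmult_le_compat_r; [|exact H]. apply Rlt_le, Rinv_0_lt_compat; lra.
  - apply Rmult_le_reg_r with (v + y); [lra|]. rewrite Rmult_assoc, Rinv_l by lra. nra.
Qed.

Lemma inv_sqrt3_near s m : Rabs (s - 1) <= m -> m <= 1 / 10 ->
  Rabs (/ sqrt s ^ 3 - 1) <= 2 * m.
Proof.
  intros Hs Hm.
  assert (Hm0 : 0 <= m) by (eapply Rle_trans; [apply Rabs_pos|exact Hs]).
  destruct (inv_sqrt_near s m Hs Hm) as [v [Hv [Ev [-> Nv]]]].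
  apply Rabs_le_between in Nv.
  replace (v ^ 3 - 1) with ((v - 1) * (1 + v + v ^ 2)) by ring.
  apply Rle_trans with ((6 / 10 * m) * (33 / 10)); [|lra].
  apply Rabs_mult_le; apply Rabs_le; nra.
Qed.

(** On the unit circle the gradient of [kepler] at (a, b) is (1 - 3 a^2, -3 a b). Leaving the circle
    by [e] and the base point by [p] changes it by a multiple of e + p. *)
Lemma kepler_linearised_unit a b h1 h2 k1 k2 e p d :
  Rabs (a ^ 2 + b ^ 2 - 1) <= e -> e <= 1 / 100 -> p <= 1 / 100 ->
  Rabs h1 <= p -> Rabs h2 <= p -> Rabs k1 <= p -> Rabs k2 <= p ->
  Rabs (h1 - k1) <= d -> Rabs (h2 - k2) <= d ->
  Rabs (kepler (a + h1) (b + h2) - kepler (a + k1) (b + k2) -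
        ((1 - 3 * a ^ 2) * (h1 - k1) + -3 * (a * b) * (h2 - k2)))
    <= 250 * (e + p) * d.
Proof.
  intros He He' Hp' Hh1 Hh2 Hk1 Hk2 Hd1 Hd2.
  assert (He0 : 0 <= e) by (eapply Rle_trans; [apply Rabs_pos|exact He]).
  assert (Hp0 : 0 <= p) by (eapply Rle_trans; [apply Rabs_pos|exact Hh1]).
  assert (Hd0 : 0 <= d) by (eapply Rle_trans; [apply Rabs_pos|exact Hd1]).
  assert (Ha : Rabs a <= 101 / 100) by (apply Rabs_le_between in He; apply Rabs_le; nra).
  assert (Hb : Rabs b <= 101 / 100) by (apply Rabs_le_between in He; apply Rabs_le; nra).
  (* Moving both coordinates by at most p changes the squared length by at most 2 p (2 * 101/100 +
     p), which is below 5 p. *)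
  set (m := e + 5 * p).
  assert (Hs : forall x y, Rabs x <= p -> Rabs y <= p ->
            Rabs ((a + x) ^ 2 + (b + y) ^ 2 - 1) <= m).
  { intros x y Hx Hy.
    replace ((a + x) ^ 2 + (b + y) ^ 2 - 1) with
      ((a ^ 2 + b ^ 2 - 1) + (x * (2 * a + x) + y * (2 * b + y))) by ring.
    apply Rle_trans with (e + (p * (203 / 100) + p * (203 / 100))); [|unfold m; lra].
    apply Rabs_plus_le; [exact He|].
    apply Rabs_le_between in Ha. apply Rabs_le_between in Hb.
    assert (Hx' := proj1 (Rabs_le_between _ _) Hx). assert (Hy' := proj1 (Rabs_le_between _ _) Hy).
    apply Rabs_plus_le; apply Rabs_mult_le; auto; apply Rabs_le; lra. }
  assert (Hm : m <= 1 / 10) by (unfold m; lra).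
  unfold kepler, Rdiv.
  set (s := (a + h1) ^ 2 + (b + h2) ^ 2). set (t := (a + k1) ^ 2 + (b + k2) ^ 2).
  assert (Ns := Hs h1 h2 Hh1 Hh2). assert (Nt := Hs k1 k2 Hk1 Hk2). fold s in Ns. fold t in Nt.
  assert (L := inv_sqrt3_lipschitz s t m Ns Nt Hm).
  assert (G := inv_sqrt3_near s m Ns Hm).
  set (gs := / sqrt s ^ 3) in *. set (gt := / sqrt t ^ 3) in *.
  assert (Est : s - t = (h1 - k1) * (2 * a + h1 + k1) + (h2 - k2) * (2 * b + h2 + k2))
    by (unfold s, t; ring).
  assert (Hh1' := proj1 (Rabs_le_between _ _) Hh1). assert (Hh2' := proj1 (Rabs_le_between _ _) Hh2).
  assert (Hk1' := proj1 (Rabs_le_between _ _) Hk1). assert (Hk2' := proj1 (Rabs_le_between _ _) Hk2).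
  assert (Ha' := proj1 (Rabs_le_between _ _) Ha). assert (Hb' := proj1 (Rabs_le_between _ _) Hb).
  assert (Hst : Rabs (s - t) <= 41 / 10 * d).
  { rewrite Est. apply Rle_trans with (d * (204 / 100) + d * (204 / 100)); [|lra].
    apply Rabs_plus_le; apply Rabs_mult_le; auto; apply Rabs_le; lra. }
  set (E := gs - gt + 3 / 2 * (s - t)) in *.
  (* Product rule: the deviation of [gs] from 1, the nonlinear part [E] of the inverse cube, and two
     terms of second order in the displacements. *)
  replace (_ - _) with
    ((h1 - k1) * (gs - 1) + ((a + k1) * E + (- (3 / 2) * (k1 * (s - t)) +
      - (3 / 2) * (a * ((h1 - k1) * (h1 + k1) + (h2 - k2) * (h2 + k2))))))
    by (unfold E; rewrite Est; field).
  assert (HE : Rabs E <= 10 * m * (41 / 10 * d)).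
  { eapply Rle_trans; [exact L|]. apply Rmult_le_compat_l; [unfold m; lra|exact Hst]. }
  apply Rle_trans with
    (d * (2 * m) + (102 / 100 * (10 * m * (41 / 10 * d)) +
     (3 / 2 * (p * (41 / 10 * d)) + 3 / 2 * (101 / 100 * (d * (2 * p) + d * (2 * p)))))).
  2:{ unfold m. assert (0 <= e * d) by nra. assert (0 <= p * d) by nra. nra. }
  assert (H32 : Rabs (- (3 / 2)) <= 3 / 2) by (apply Rabs_le; lra).
  repeat apply Rabs_plus_le; repeat apply Rabs_mult_le; auto.
  - apply Rabs_le; lra.
  - repeat apply Rabs_plus_le; repeat apply Rabs_mult_le; auto; apply Rabs_le; lra.
Qed.

Lemma near_unit_pos a b h1 h2 e p :
  Rabs (a ^ 2 + b ^ 2 - 1) <= e -> e <= 1 / 100 -> p <= 1 / 100 ->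
  Rabs h1 <= p -> Rabs h2 <= p -> 0 < (a + h1) ^ 2 + (b + h2) ^ 2.
Proof.
  intros He He' Hp H1 H2. apply Rabs_le_between in He.
  apply Rabs_le_between in H1. apply Rabs_le_between in H2.
  assert (0 <= (5 * h1 + 4 * h1 + a) ^ 2) by apply pow2_ge_0.
  assert (a ^ 2 <= 101/100) by nra. assert (b ^ 2 <= 101/100) by nra.
  assert (-(11/10) <= a <= 11/10) by nra. assert (-(11/10) <= b <= 11/10) by nra.
  nra.
Qed.

Lemma pos_of_scaled u x y : 0 < u -> 0 < (u * x) ^ 2 + (u * y) ^ 2 -> 0 < x ^ 2 + y ^ 2.
Proof. intros Hu H. nra. Qed.

Lemma perturbed_pos u a b h1 h2 e p :
  0 < u -> Rabs ((u * a) ^ 2 + (u * b) ^ 2 - 1) <= e -> e <= 1 / 100 -> u * p <= 1 / 100 ->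
  Rabs h1 <= p -> Rabs h2 <= p -> 0 < (a + h1) ^ 2 + (b + h2) ^ 2.
Proof.
  intros Hu He He' Hp H1 H2. apply (pos_of_scaled u); [exact Hu|].
  rewrite !Rmult_plus_distr_l. apply near_unit_pos with e (u * p); auto;
    rewrite Rabs_mult, (Rabs_pos_eq u) by lra; apply Rmult_le_compat_l; lra.
Qed.

(** The estimate near the unit circle, transported by homogeneity: u^2 comes from the degree -2 and
    one more u from scaling the displacements. *)
Lemma kepler_linearised u a b h1 h2 k1 k2 e p d :
  0 < u -> Rabs ((u * a) ^ 2 + (u * b) ^ 2 - 1) <= e -> e <= 1 / 100 -> u * p <= 1 / 100 ->
  Rabs h1 <= p -> Rabs h2 <= p -> Rabs k1 <= p -> Rabs k2 <= p ->
  Rabs (h1 - k1) <= d -> Rabs (h2 - k2) <= d ->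
  Rabs (kepler (a + h1) (b + h2) - kepler (a + k1) (b + k2) -
        (u ^ 3 * (1 - 3 * (u * a) ^ 2) * (h1 - k1) +
         u ^ 3 * (-3 * ((u * a) * (u * b))) * (h2 - k2)))
    <= u ^ 3 * (250 * (e + u * p)) * d.
Proof.
  intros Hu He He' Hp Hh1 Hh2 Hk1 Hk2 Hd1 Hd2.
  assert (S : forall x q, Rabs x <= q -> Rabs (u * x) <= u * q).
  { intros x q Hx. rewrite Rabs_mult, (Rabs_pos_eq u) by lra. apply Rmult_le_compat_l; lra. }
  rewrite (kepler_homogeneous u (a + h1)), (kepler_homogeneous u (a + k1));
    try exact Hu; try (eapply perturbed_pos; eassumption).
  assert (L := kepler_linearised_unit (u * a) (u * b) (u * h1) (u * h2) (u * k1) (u * k2) e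
    (u * p) (u * d) He He' Hp (S _ _ Hh1) (S _ _ Hh2) (S _ _ Hk1) (S _ _ Hk2)
    ltac:(rewrite <- Rmult_minus_distr_l; auto) ltac:(rewrite <- Rmult_minus_distr_l; auto)).
  rewrite (Rmult_plus_distr_l u a h1), (Rmult_plus_distr_l u b h2),
    (Rmult_plus_distr_l u a k1), (Rmult_plus_distr_l u b k2).
  match type of L with Rabs ?x <= _ => replace (_ - _) with (u ^ 2 * x) by ring end.
  rewrite Rabs_mult, (Rabs_pos_eq (u ^ 2)) by nra.
  replace (u ^ 3 * (250 * (e + u * p)) * d) with (u ^ 2 * (250 * (e + u * p) * (u * d))) by ring.
  apply Rmult_le_compat_l; [nra|exact L].
Qed.

(** This removes the root and the division from the residual: u^2 (u a) is a polynomial as soon as u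
    and a are. *)
Lemma kepler_approx u a b e :
  0 < u -> Rabs ((u * a) ^ 2 + (u * b) ^ 2 - 1) <= e -> e <= 1 / 100 ->
  Rabs (kepler a b - u ^ 2 * (u * a)) <= 3 * u ^ 2 * e.
Proof.
  intros Hu He He'.
  assert (He0 : 0 <= e) by (eapply Rle_trans; [apply Rabs_pos|exact He]).
  assert (H : 0 < a ^ 2 + b ^ 2).
  { apply (pos_of_scaled u); auto. apply Rabs_le_between in He. lra. }
  rewrite (kepler_homogeneous u) by auto. unfold kepler, Rdiv.
  assert (G := inv_sqrt3_near _ e He ltac:(lra)).
  replace (_ - _) with (u ^ 2 * ((u * a) * (/ sqrt ((u * a) ^ 2 + (u * b) ^ 2) ^ 3 - 1))) by ring.
  rewrite Rabs_mult, (Rabs_pos_eq (u ^ 2)) by nra.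
  apply Rle_trans with (u ^ 2 * (11 / 10 * (2 * e))); [|nra].
  apply Rmult_le_compat_l; [nra|]. apply Rabs_mult_le; [|exact G].
  apply Rabs_le_between in He. apply Rabs_le. nra.
Qed.

Lemma continuous_pow (f : R -> R) n t : continuous f t -> continuous (fun s => f s ^ n) t.
Proof.
  intros Hf. induction n as [|n IH]; simpl; [apply continuous_const|].
  apply (continuous_mult (K := R_AbsRing)); assumption.
Qed.

Lemma continuous_kepler (X Y : R -> R) t : continuous X t -> continuous Y t ->
  0 < X t ^ 2 + Y t ^ 2 -> continuous (fun s => kepler (X s) (Y s)) t.
Proof.
  intros HX HY H. unfold kepler, Rdiv.
  apply (continuous_mult (K := R_AbsRing)); [exact HX|].
  apply continuous_Rinv_comp.
  - apply continuous_pow, continuous_sqrt_comp.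
    apply (continuous_plus (K := R_AbsRing) (V := R_NormedModule)); apply continuous_pow; assumption.
  - apply pow_nonzero. pose proof (sqrt_lt_R0 _ H). lra.
Qed.

(** * The numerical data *)

(* Chebyshev coefficients on [-1, 1] of the coordinates of q1 and q2 (times
   2^72), of the inverse square roots of the lengths of the four separations
   (times 2^56), and of the position rows of the approximate fundamental matrix
   (times 2^32). The boundary conditions hold exactly after rounding. *)
Definition p_data : list (list Z) := [
   [4366626787907467903184; 3986693762419855659168; -180816083561259729232; 155053251719302161456;
    -52223693449392244736; 1316523007882944800; 2702495084412399600; -3243110263015527232;
    2207073768009324160; -1024955026810773248; 372896097054648976; -71052503038249488;
    -34690503274995296; 49438676648992928; -35574978945285376; 19038578697458960;
    -7635570213469712; 1716901383796128; 574701131891792; -1032414433291184; 803791647568080;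
    -456478845831280; 195374345888480; -50154487764784; -10541527736208; 25127105103808;
    -20882488916688; 12425982037632; -5593462815216; 1591763689760; 179569787104; -663767620352;
    587427775728; -364126013648; 171147053424; -53001287520; -1850561456; 18400969936;
    -17379101712; 11192667520; -5469297088; 1819696352; -52686592; -525034576; 532029616;
    -355636080; 180154432; -63795040; 5262032; 15217776; -16683552; 11574544; -6066448; 2270160;
    -291072; -443376; 532272; -383520; 207696; -81680; 13712; 12864; -17200; 12880; -7200; 2960;
    -608; -368; 560; -432; 256; -112; 32; 16; -16];
   [-896604861632881872304; -2321798422614868422336; 194559820051677460432; 161701492142172470704;
    -38655894997097188032; 23393767060641913488; -10990009076050073296; 2959261037653003280;
    -428529632133026528; -341843820833210832; 415286164115901952; -272092302527010832;
    136585760317723360; -51526118338923600; 9951575943616224; 4930885930867392; -7297691907331680;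
    5379886839382992; -2936480429264320; 1203795482241904; -280707802538816; -86848632213152;
    164842526301808; -130833405627024; 75481646192160; -32865175498688; 8717733526992;
    1586628771472; -4177297311968; 3540215745984; -2136522549808; 976574387280; -286223064592;
    -24791949488; 112962339648; -102133967712; 64180234096; -30601151152; 9731949312; 112442960;
    -3175704880; 3073042512; -2006514544; 994030144; -338800528; 16810064; 91328368; -95188672;
    64534064; -33130064; 11993488; -1209040; -2655520; 3010096; -2119296; 1125424; -429808; 62144;
    77280; -96608; 70704; -38784; 15552; -2832; -2224; 3136; -2384; 1344; -560; 128; 64; -96; 80;
    -48];
   [10751092504756941241246; -1944237984670156331352; -536189942618053120230;
    -9503003881583765920; 12582457321736625568; 3837649784097256048; 202696701760035536;
    -125153472190042384; -68797850924249728; -6854069406054912; 1204490976706672;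
    1204637900833888; 315435080678336; -58697139463744; 2075188954288; -17985647618064;
    3138372525904; -91750149792; -115090605216; 398854011888; -254319194144; 116998275648;
    -46843918704; 10297308976; 2515687360; -4605770992; 3479671152; -1898959312; 787996752;
    -210686304; -18759600; 73035456; -61076992; 35787296; -16008784; 4833520; -17728; -1326288;
    1229248; -765040; 362656; -120160; 8608; 26368; -27152; 17840; -8880; 3168; -400; -560; 640;
    -448; 224];
   [1718218290145005084564; 1525865036082930133680; -264324064565983272900; -84423499838074751008;
    -11803897771507892880; 1365313507231759856; 898008767876924592; 191537999327929424;
    -2013776620600608; -14949949576338624; -3634340537510560; -502484203706880; 310836756332880;
    73571126068080; 15463840482688; -840068007328; -4760175384736; 1041598761104; -657618670704;
    292114571328; -31315241904; -16834027664; 24587465760; -18406156896; 9297038080; -3680711728;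
    913911744; 148403488; -363733456; 286624832; -162094192; 69870400; -19821168; -861584;
    6189152; -5427408; 3273664; -1506544; 476208; -17584; -118112; 114816; -73344; 35616; -12240;
    1200; 2416; -2624; 1776; -896; 336; -48; -48]]%Z.

Definition v_data : list (list Z) := [
   [83906440901732067; -40168615421525948; 10936885495176060; -1572244485583583; -861949469071035;
    1170368957979602; -824350814460246; 434089969304955; -171965640057785; 36690396737674;
    15457046913641; -25482352070422; 19690843899638; -11179000230510; 4759755016516;
    -1165026676848; -342704981474; 695542559400; -570611538375; 338767671074; -151506244535;
    41260738468; 7619729519; -20642962945; 17893143690; -11028117653; 5139238786; -1528674503;
    -145554841; 638139934; -585251862; 373497002; -180622787; 57917147; 1265588; -20146582;
    19634861; -12964154; 6489509; -2221309; 87128; 642129; -669517; 457391; -236585; 85796; -7801;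
    -20492; 23072; -16320; 8712; -3327; 451; 650; -800; 587; -323; 129; -23; -20; 28; -21];
   [47528990250084236; 3791855020100254; 1322752181352376; 215819609252419; 28764237009659;
    103757026789; -704132925959; -195550776325; 33171758989; 15573914814; 5763610349; 96416886;
    -404985769; -30010057; -56183845; 24652612; -3621143; 1532634; 411456; -706893; 414016;
    -214305; 83267; -18244; -3794; 7983; -6104; 3342; -1402; 381; 28; -127; 107; -63; 28];
   [56261307696747014; 10672454032062061; -1185752751455604; -422090179124202; -149113704923314;
    -20401686341625; 23008138944086; -4377718587754; 3901493268649; -1369775417160; 98087056197;
    121874887905; -168745121168; 120357869308; -60734356671; 23801527891; -4969931983;
    -2168470312; 3405940823; -2573706526; 1434378498; -600481142; 146370369; 39083605; -81004683;
    65689615; -38495800; 17049970; -4683248; -697902; 2111264; -1827520; 1118385; -518826; 156528;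
    9396; -58055; 53673; -34176; 16516; -5385; 56; 1648; -1635; 1081; -543; 189; -13; -48; 51;
    -35];
   [40384080969313690; -2780073651677891; 1113446696987929; -316348534202630; 108918017515155;
    -30008033552252; 4323264272637; 2450995945857; -2909884144617; 1889065764146; -928157852205;
    342835193769; -66552624552; -30205535712; 45156503286; -32980730798; 17818893052; -7231131575;
    1668157548; 514873499; -966416693; 760673181; -435338223; 187894043; -49124529; -9423464;
    23817313; -19990751; 11972186; -5426366; 1566199; 155347; -633742; 566341; -353095; 166954;
    -52298; -1273; 17646; -16835; 10901; -5355; 1799; -67; -505; 517; -347; 177; -63; 6; 15; -16]]%Z.

Definition y_data : list (list (list Z)) := [
 [
   [19242034865; 24169131235; 4181079052; -516988236; 80967679; -212913294; -15042757; 19718563;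
    -11788359; 11373479; -5471297; 2028318; -471569; -218385; 345626; -266099; 154610; -67889;
    18035; 3641; -9325; 8043; -4967; 2336; -717; -43; 275; -259; 169; -84; 28; -1; -8; 9; -6];
   [-643075454; -927611453; -292710565; 29370522; 49701097; 13450071; 830618; -851228; -458971;
    -49933; 19173; 5881; 6614; -2034; 148; 87; -320; 251; -128; 48];
   [7879470694; 9315592331; 1389790893; -137701663; -78841089; -15257187; -22334745; 8996925;
    260198; -835185; 1253491; -887094; 383134; -102270; -27545; 61357; -50322; 29420; -12477;
    2626; 1506; -2359; 1845; -1055; 440; -89; -57; 86; -67; 39; -16; 3; 2];
   [-397791876; -668325795; -381289740; -124062543; -2231303; 17336175; 7476693; 1052083; -350579;
    -237639; -50527; 4558; 6154; 2123; -11; -151];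
   [425345994; -216133114; -260781061; 121723216; -149544999; 93308821; -32053143; 5599610;
    5270525; -7237414; 5312348; -2942116; 1205334; -241993; -147756; 224231; -174500; 100390;
    -43012; 10085; 3989; -7263; 5931; -3534; 1580; -417; -103; 240; -206; 127; -59; 17; 2; -8; 7;
    -5];
   [-1257097839; -1466007616; -159083178; -9347414; -48897064; 18386105; 3641668; -1502202;
    1284585; -1119069; 468677; -164863; 28875; 27318; -33080; 23577; -12954; 5297; -1164; -505;
    861; -686; 403; -179; 49; 9; -25; 22; -13];
   [-3198323003; 1834800627; 38186563; -48386952; 301289165; -237068749; 105480927; -37908782;
    2209858; 10521324; -10664045; 7170375; -3657077; 1295649; -105827; -312603; 343724; -239234;
    125758; -47089; 5832; 9564; -11427; 8255; -4484; 1764; -287; -294; 388; -291; 163; -67; 13; 9;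
    -13; 10; -6];
   [-73660029; 233321958; 240822372; 20506528; 49750910; -37132909; 6335364; -418960; -2118066;
    2489656; -1564589; 765588; -258968; 5370; 75975; -76257; 50829; -25542; 8826; -468; -2402;
    2535; -1735; 897; -325; 30; 77; -86; 61; -32; 12; -2]];
 [
   [13224729729; 9538140521; 970309022; 1098126285; 486649411; -147628465; 46188265; -49421002;
    12064485; -1020137; -1508134; 2387578; -1690417; 903401; -380686; 87796; 31691; -57847; 46980;
    -27921; 12608; -3563; -507; 1643; -1465; 924; -443; 142; 3; -49; 48; -32; 16; -6];
   [-488092662; -836515379; -498571310; -178218348; -25265534; 6609665; 4819101; 998119; -70652;
    -90185; -47374; 1868; 2716; -311; 1395; -760; 241; -36; -62; 71; -48];
   [1969876014; 2573303608; 702488024; 252173540; 147963079; -28224829; -13618176; 2427672;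
    -4745483; 2627424; -540920; -97115; 310085; -273868; 158496; -67200; 14090; 8330; -12782;
    9906; -5611; 2301; -436; -326; 469; -359; 203; -84; 16; 11; -17; 13; -7];
   [-67668161; -168520786; -201685204; -157755939; -72952770; -16166405; 1493797; 2256684; 683364;
    29669; -53423; -23469; -2821; 1160; 611; 202];
   [-2369461798; 1079472718; 382216959; -153851061; -35962184; 46938452; -46965721; 33207366;
    -16712669; 6358283; -994785; -1067877; 1357330; -999664; 554138; -226827; 46238; 27384;
    -42154; 32986; -19090; 8250; -1985; -719; 1367; -1128; 678; -306; 83; 18; -45; 39; -25; 12;
    -3];
   [-874879728; -239759899; 295992199; -1649803; -53080587; 5975732; -6427980; 4825547; -812019;
    46952; 179213; -237336; 151969; -77046; 30250; -5345; -3893; 5381; -4060; 2291; -974; 237; 75;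
    -149; 123; -74; 34; -10];
   [5729891605; -2307566261; -1294271200; 654940712; -93271282; -13382999; 71116890; -68977851;
    41938348; -20346334; 6764059; -118937; -2000199; 2010127; -1345466; 683216; -242922; 20126;
    58680; -64768; 45278; -23935; 9049; -1190; -1775; 2161; -1574; 862; -343; 59; 54; -74; 56;
    -32; 13; -3; -2; 3];
   [1282363496; 263016254; -215755432; 106891803; 37037713; -12235675; 13416088; -10605927;
    4299388; -1345201; -17455; 482559; -448972; 287529; -140518; 45927; -325; -14403; 14349;
    -9540; 4804; -1668; 93; 451; -479; 330; -172; 63; -6; -14; 16; -12; 6]];
 [
   [-2129991831; -3385082971; -1554867869; -187855783; 212775285; 125023224; 22248326; -4812039;
    -3813813; -932939; 49608; 101856; 32849; 1996; -2740; -932; -207];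
   [5476856506; 1622744291; 443547571; -29036252; -44243030; -13776683; -720617; 921416; 423823;
    59136; -15730; -11530; -2655; 218; 271];
   [-628371906; -961531759; -380489557; 2660493; 82345053; 38940032; 5446510; -2166713; -1284264;
    -251366; 32502; 37546; 9381; 82; -949; -363];
   [431474912; 716587858; 397722228; 126334715; 3193675; -16736366; -7402619; -1039292; 357372;
    235437; 50932; -4349; -6446; -1938; -61; 159];
   [-357795757; 143014380; 151378181; 62958637; -1445941; -7629402; -1920751; -8611; 180734;
    76048; -920; -1923; -2902; -160; 177; -46];
   [-5406368417; 2635352887; -254238243; 105389997; 13307554; -8978182; -4125335; -160658; 286481;
    134224; 11105; -7413; -3868; -777; 240];
   [-277656577; -423213511; -395795918; -164350877; 1526904; 19885683; 4886792; 116180; -503192;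
    -187545; -1218; 5213; 8127; -50; -175; -15; -173; 90];
   [931677616; -217769333; -207071814; -82417169; 1932096; 10102938; 2766819; 582; -253303;
    -96064; -4230; 5165; 3098; 387; -170]];
 [
   [-1809948060; -3271641097; -2309021202; -1133189691; -305918966; 4689465; 35364459; 12021441;
    894016; -834826; -385746; -54604; 15628; 11667; 2335; -189; -298];
   [576889448; 957145295; 534762265; 183931292; 26001958; -7027536; -4602116; -1030571; 49509;
    113162; 34491; 2371; -2616; -1074];
   [-791330461; -1365853972; -859746703; -365527262; -80986571; 8361954; 12395658; 3631404; 69304;
    -316264; -122499; -12644; 7265; 3652; 725; -150];
   [4230935795; 4270038881; 130445957; 149060573; 73663445; 16056496; -1531675; -2258111; -683555;
    -32291; 54888; 22746; 3005; -1127; -693];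
   [567106714; 492911342; -54068469; 42656062; 26627685; 3163860; -1494655; -728086; -145013;
    31411; 21227; 4251; 385; -974];
   [624171136; 425238583; -221476181; 2034479; 34098524; 8887913; -1696914; -1333495; -277538;
    33405; 40982; 9457; 51; -1168; -334];
   [-1439305196; -1242952420; 151841919; -103530721; -69533654; -8290726; 3756441; 1912947;
    386400; -86303; -52067; -13045; -259; 2307; 3; 223];
   [-2964536672; 1484665446; 115964409; -67109859; -34764185; -4657163; 2016734; 1022097; 188064;
    -38987; -29479; -6517; 99; 943]]]%Z.

(** * Models of the quantities entering the estimates *)

Definition tab (n : nat) (f : nat -> model) : list model := map f (seq 0 n).
Definition tget (t : list model) (k : nat) : model := nth k t (mexact nil).
Definition tab2 (n m : nat) (f : nat -> nat -> model) : list (list model) :=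
  map (fun i => tab m (f i)) (seq 0 n).
Definition tget2 (t : list (list model)) (i k : nat) : model := tget (nth i t nil) k.

Lemma tget_tab n f k : (k < n)%nat -> tget (tab n f) k = f k.
Proof.
  intros H. unfold tget, tab.
  rewrite nth_indep with (d' := f O) by (rewrite length_map, length_seq; exact H).
  rewrite map_nth, seq_nth by exact H. reflexivity.
Qed.

Lemma tget2_tab2 n m f i k : (i < n)%nat -> (k < m)%nat -> tget2 (tab2 n m f) i k = f i k.
Proof.
  intros Hi Hk. unfold tget2, tab2.
  rewrite nth_indep with (d' := tab m (f O)) by (rewrite length_map, length_seq; exact Hi).
  rewrite (map_nth (fun i => tab m (f i))), seq_nth by exact Hi. apply tget_tab, Hk.
Qed.

Fixpoint msum (f : nat -> model) (n : nat) : model :=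
  match n with O => f O | S m => madd (msum f m) (f (S m)) end.

Fixpoint zsum (f : nat -> Z) (n : nat) : Z :=
  match n with O => f O | S m => (zsum f m + f (S m))%Z end.

(** Three precisions. The orbit is stored at 2^-72 because two differentiations amplify the rounding
    of its high coefficients. The residual is evaluated at 2^-56. For [Y] and the Jacobian 2^-32
    suffices, since they only enter a contraction constant. *)
Definition sW : Z := 72.
Definition sP : Z := 56.
Definition to_sP : model -> model := mround 16 80.
Definition mulP : model -> model -> model := mmul 56 64.
Definition sY : Z := 32.
Definition mulY : model -> model -> model := mmul 32 36.

Definition w_coef (i : nat) : list Z :=
  if Nat.ltb i 4 then nth i p_data nil else cder (nth (i - 4) p_data nil).
Definition v_coef (k : nat) : list Z := nth k v_data nil.
Definition y_coef (i k : nat) : list Z :=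
  if Nat.ltb i 4 then nth k (nth i y_data nil) nil
  else cder (nth k (nth (i - 4) y_data nil) nil).

(* The mutual separations are [q1, q2, q1 - q2, q1 + q2], that is
   [sep_coef 0 k * q1 + sep_coef 1 k * q2] for [k = 0, ..., 3]. The first two
   stand for opposite bodies, at twice that distance, hence the weights
   1/4, 1/4, 1, 1; [weight4] is four times them. *)
Definition sep_coef (j k : nat) : Z := nth k (nth j [[1; 0; 1; 1]; [0; 1; -1; 1]]%Z nil) 0%Z.
Definition weight4 (k : nat) : Z := nth k [1; 1; 4; 4]%Z 0%Z.

Definition m_sep (c k : nat) (z : nat -> model) : model :=
  madd (mscal (sep_coef 0 k) (z c)) (mscal (sep_coef 1 k) (z (2 + c)%nat)).

(** The tables are stored in normal form, so that later computations do not repeat the products;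
    lemmas such as [u_tab_eq] recover the defining formulas. *)
Definition u_tab : list model := Eval vm_compute in
  tab 4 (fun k => mulP (mexact (v_coef k)) (mexact (v_coef k))).
Definition n_tab : list (list model) := Eval vm_compute in
  tab2 2 4 (fun c k => mulP (tget u_tab k) (m_sep c k (fun i => to_sP (mexact (w_coef i))))).
Definition norm_err (k : nat) : model :=
  madd (madd (mulP (tget2 n_tab 0 k) (tget2 n_tab 0 k))
             (mulP (tget2 n_tab 1 k) (tget2 n_tab 1 k))) (mconst sP (-1)).
Definition usq_tab : list model := Eval vm_compute in
  tab 4 (fun k => mulP (tget u_tab k) (tget u_tab k)).
Definition force_tab : list (list model) := Eval vm_compute in
  tab2 2 4 (fun c k => mulP (tget usq_tab k) (tget2 n_tab c k)).
(** Four times the residual of the acceleration, so that the weights 1/4 become integers. *)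
Definition m_residual (j c : nat) : model :=
  madd (to_sP (mscal 4 (mexact (cder (w_coef (4 + (2 * j + c)))))))
    (msum (fun k => mscal (weight4 k * sep_coef j k) (tget2 force_tab c k)) 3).

Definition to_sY : model -> model := mround 24 36.
Definition u3Y_tab : list model := Eval vm_compute in
  tab 4 (fun k => let u := to_sY (tget u_tab k) in mulY u (mulY u u)).
Definition nY_tab : list (list model) := Eval vm_compute in
  tab2 2 4 (fun c k => to_sY (tget2 n_tab c k)).
(* Derivative of component [c] of [q / |q|^3] in direction [c'] at the [k]-th
   separation. *)
Definition m_jac (c c' k : nat) : model :=
  mulY (tget u3Y_tab k)
    (madd (mconst sY (if Nat.eqb c c' then 1 else 0)%Z)
          (mscal (-3) (mulY (tget2 nY_tab c k) (tget2 nY_tab c' k)))).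
Definition jac_tab : list (list (list model)) := Eval vm_compute in
  [tab2 2 4 (m_jac 0); tab2 2 4 (m_jac 1)].
Definition y_tab : list (list model) := Eval vm_compute in
  tab2 8 8 (fun i k => mexact (y_coef i k)).
(** Four times an entry of Y' minus the approximate Jacobian applied to Y. Only velocity rows occur:
    the velocity rows of [Y] are by construction the derivatives of its position rows. *)
Definition m_defect (j c l : nat) : model :=
  madd (mscal 4 (mexact (cder (y_coef (4 + (2 * j + c)) l))))
    (msum (fun k => mscal (weight4 k * sep_coef j k)
       (madd (mulY (tget2 (nth c jac_tab nil) c k) (m_sep c k (fun i => tget2 y_tab i l)))
             (mulY (tget2 (nth c jac_tab nil) (1 - c) k)
                   (m_sep (1 - c) k (fun i => tget2 y_tab i l))))) 3).

(* The inverse of a symplectic fundamental matrix is obtained by permuting its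
   entries: entry [(k, l)] of the inverse is [inv_sign k l] times entry
   [(inv_row l, inv_col k)]. *)
Definition inv_sign (k l : nat) : Z := if Bool.eqb (Nat.ltb k 4) (Nat.ltb l 4) then 1 else -1.
Definition inv_row (l : nat) : nat := if Nat.ltb l 4 then (4 + l)%nat else (l - 4)%nat.
Definition inv_col (k : nat) : nat := if Nat.ltb k 4 then (4 + k)%nat else (k - 4)%nat.
(** Entries of Y J Y^T, the symplectic products of the rows of Y, in which columns k and 4 + k are
    conjugate. By antisymmetry the entries with a < b suffice. *)
Definition bracket_tab : list (list model) := Eval vm_compute in
  tab2 8 8 (fun a b => if Nat.ltb a b then
    msum (fun k => madd (mulY (tget2 y_tab a k) (tget2 y_tab b (4 + k)))
                        (mscal (-1) (mulY (tget2 y_tab a (4 + k)) (tget2 y_tab b k)))) 3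
    else mexact nil).
Definition m_bracket (a b : nat) : model :=
  if Nat.ltb a b then tget2 bracket_tab a b else mscal (-1) (tget2 bracket_tab b a).
Definition m_inv_err (i l : nat) : model :=
  madd (mconst sY (if Nat.eqb i l then 1 else 0)%Z)
    (mscal (if Nat.ltb l 4 then -1 else 1)%Z (m_bracket i (inv_row l))).

(** The rows of the approximate inverse differ in size by a factor of about ten, so each component
    of xi has its own bound, per unit bound on z. *)
Definition xi_bound (k : nat) : Z := nth k [11; 12; 27; 9; 98; 14; 32; 15]%Z 0%Z.

Lemma u_tab_eq : u_tab = tab 4 (fun k => mulP (mexact (v_coef k)) (mexact (v_coef k))).
Proof. vm_compute. reflexivity. Qed.
Lemma n_tab_eq : n_tab = tab2 2 4 (fun c k =>
  mulP (tget u_tab k) (m_sep c k (fun i => to_sP (mexact (w_coef i))))).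
Proof. vm_compute. reflexivity. Qed.
Lemma usq_tab_eq : usq_tab = tab 4 (fun k => mulP (tget u_tab k) (tget u_tab k)).
Proof. vm_compute. reflexivity. Qed.
Lemma force_tab_eq : force_tab = tab2 2 4 (fun c k => mulP (tget usq_tab k) (tget2 n_tab c k)).
Proof. vm_compute. reflexivity. Qed.
Lemma u3Y_tab_eq : u3Y_tab = tab 4 (fun k => let u := to_sY (tget u_tab k) in mulY u (mulY u u)).
Proof. vm_compute. reflexivity. Qed.
Lemma nY_tab_eq : nY_tab = tab2 2 4 (fun c k => to_sY (tget2 n_tab c k)).
Proof. vm_compute. reflexivity. Qed.
Lemma jac_tab_eq : jac_tab = [tab2 2 4 (m_jac 0); tab2 2 4 (m_jac 1)].
Proof. vm_compute. reflexivity. Qed.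
Lemma y_tab_eq : y_tab = tab2 8 8 (fun i k => mexact (y_coef i k)).
Proof. vm_compute. reflexivity. Qed.

Lemma bracket_tab_eq : bracket_tab = tab2 8 8 (fun a b => if Nat.ltb a b then
    msum (fun k => madd (mulY (tget2 y_tab a k) (tget2 y_tab b (4 + k)))
                        (mscal (-1) (mulY (tget2 y_tab a (4 + k)) (tget2 y_tab b k)))) 3
    else mexact nil).
Proof. vm_compute. reflexivity. Qed.

Definition all_below (n : nat) (P : nat -> bool) : bool := forallb P (seq 0 n).

Lemma all_below_spec n P k : all_below n P = true -> (k < n)%nat -> P k = true.
Proof.
  intros H Hk. unfold all_below in H. rewrite forallb_forall in H.
  apply H, in_seq. lia.
Qed.

Lemma u_check : all_below 4 (fun k => Z.leb (10 * mbound (tget u_tab k)) (38 * 2 ^ sP)) = true.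
Proof. vm_compute. reflexivity. Qed.
Lemma norm_check : all_below 4 (fun k => Z.leb (10 ^ 14 * mbound (norm_err k)) (2 * 2 ^ sP)) = true.
Proof. vm_compute. reflexivity. Qed.
Lemma residual_check : all_below 2 (fun j => all_below 2 (fun c =>
  Z.leb (10 ^ 13 * mbound (m_residual j c)) (8 * 2 ^ sP))) = true.
Proof. vm_compute. reflexivity. Qed.
Lemma defect_check : all_below 2 (fun j => all_below 2 (fun c =>
  Z.leb (10 * zsum (fun l => mbound (m_defect j c l) * xi_bound l)%Z 7) (6 * 2 ^ sY))) = true.
Proof. vm_compute. reflexivity. Qed.
Lemma inv_check : all_below 8 (fun i =>
  Z.leb (1000 * zsum (fun l => mbound (m_inv_err i l)) 7) (2 ^ sY)) = true.
Proof. vm_compute. reflexivity. Qed.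
Lemma xi_check : all_below 8 (fun k =>
  Z.leb (2 * zsum (fun l => mbound (tget2 y_tab (inv_row l) (inv_col k))) 7)
        (xi_bound k * 2 ^ sY)) = true.
Proof. vm_compute. reflexivity. Qed.
Lemma y_check : all_below 4 (fun i =>
  Z.leb (zsum (fun k => mbound (tget2 y_tab i k) * xi_bound k)%Z 7) (340 * 2 ^ sY)) = true.
Proof. vm_compute. reflexivity. Qed.

(** * The solution on the fundamental interval *)

Definition wf (i : nat) (x : R) : R := ceval (w_coef i) x / IZR (2 ^ sW).
Definition dwf (i : nat) (x : R) : R := ceval (cder (w_coef i)) x / IZR (2 ^ sW).
Definition yf (i k : nat) (x : R) : R := ceval (y_coef i k) x / IZR (2 ^ sY).
Definition dyf (i k : nat) (x : R) : R := ceval (cder (y_coef i k)) x / IZR (2 ^ sY).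
Definition zf (k l : nat) (x : R) : R := IZR (inv_sign k l) * yf (inv_row l) (inv_col k) x.
(* The inverse length of a separation; being a square, it is nonnegative, so only
   its square has to be compared with the inverse squared length. *)
Definition uf (k : nat) (x : R) : R :=
  (ceval (v_coef k) x / IZR (2 ^ sP)) * (ceval (v_coef k) x / IZR (2 ^ sP)).

Definition sep (c k : nat) (z : nat -> R) : R :=
  IZR (sep_coef 0 k) * z c + IZR (sep_coef 1 k) * z (2 + c)%nat.

Definition force (j c : nat) (z : nat -> R) : R :=
  - (1 / 4) * sum_f_R0 (fun k => IZR (weight4 k * sep_coef j k) *
                          kepler (sep c k z) (sep (1 - c) k z)) 3.

Definition field (i : nat) (z : nat -> R) : R :=
  if Nat.ltb i 4 then z (4 + i)%nat
  else force (Nat.div2 (i - 4)) (if Nat.odd i then 1 else 0)%nat z.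

Definition nf (c k : nat) (x : R) : R := uf k x * sep c k (fun i => wf i x).

(** * Enclosures of the functions represented by the models *)

Lemma sum_IZR f n : IZR (zsum f n) = sum_f_R0 (fun k => IZR (f k)) n.
Proof. induction n as [|n IH]; simpl; [reflexivity|]. rewrite plus_IZR, IH. reflexivity. Qed.

Lemma encl_msum s (f : nat -> R -> R) t n : (forall k, (k <= n)%nat -> encl s (f k) (t k)) ->
  encl s (fun x => sum_f_R0 (fun k => f k x) n) (msum t n).
Proof.
  induction n as [|n IH]; intros H; simpl; [apply H; lia|].
  apply (encl_add s (fun x => sum_f_R0 (fun k => f k x) n)); [apply IH; intros; apply H; lia|].
  apply H; lia.
Qed.

Lemma encl_sep s (z : nat -> R -> R) m c k : (forall i, encl s (z i) (m i)) ->
  encl s (fun x => sep c k (fun i => z i x)) (m_sep c k m).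
Proof. intros H. apply encl_add; apply encl_scal, H. Qed.

Lemma encl_w i : encl sP (wf i) (to_sP (mexact (w_coef i))).
Proof. apply encl_round; [easy|easy|]. apply (encl_exact 72). easy. Qed.

Lemma encl_u k : (k < 4)%nat -> encl sP (uf k) (tget u_tab k).
Proof.
  intros Hk. rewrite u_tab_eq, tget_tab by exact Hk.
  apply encl_mul; [easy| |]; apply (encl_exact 56); easy.
Qed.

Lemma encl_n c k : (c < 2)%nat -> (k < 4)%nat -> encl sP (nf c k) (tget2 n_tab c k).
Proof.
  intros Hc Hk. rewrite n_tab_eq, tget2_tab2 by assumption.
  apply encl_mul; [easy|apply encl_u, Hk|]. apply encl_sep. apply encl_w.
Qed.

Lemma encl_force c k : (c < 2)%nat -> (k < 4)%nat ->
  encl sP (fun x => (uf k x * uf k x) * nf c k x) (tget2 force_tab c k).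
Proof.
  intros Hc Hk. rewrite force_tab_eq, tget2_tab2, usq_tab_eq, tget_tab by assumption.
  apply encl_mul; [easy| |apply encl_n; assumption].
  apply encl_mul; [easy| |]; apply encl_u, Hk.
Qed.

Lemma encl_uY k : (k < 4)%nat -> encl sY (uf k) (to_sY (tget u_tab k)).
Proof. intros Hk. apply encl_round; [easy|easy|]. apply encl_u, Hk. Qed.

Lemma encl_nY c k : (c < 2)%nat -> (k < 4)%nat -> encl sY (nf c k) (tget2 nY_tab c k).
Proof.
  intros Hc Hk. rewrite nY_tab_eq, tget2_tab2 by assumption.
  apply encl_round; [easy|easy|]. apply encl_n; assumption.
Qed.

Definition jac (c c' k : nat) (x : R) : R :=
  (uf k x * (uf k x * uf k x)) *
  (IZR (if Nat.eqb c c' then 1 else 0) + IZR (-3) * (nf c k x * nf c' k x)).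

Lemma encl_jac c c' k : (c < 2)%nat -> (c' < 2)%nat -> (k < 4)%nat ->
  encl sY (jac c c' k) (tget2 (nth c jac_tab nil) c' k).
Proof.
  intros Hc Hc' Hk.
  assert (E : nth c jac_tab nil = tab2 2 4 (m_jac c)).
  { rewrite jac_tab_eq. destruct c as [|[|c]]; [reflexivity|reflexivity|lia]. }
  rewrite E, tget2_tab2 by assumption. apply encl_mul; [easy| |].
  - rewrite u3Y_tab_eq, tget_tab by exact Hk.
    apply encl_mul; [easy|apply encl_uY, Hk|]. apply encl_mul; [easy| |]; apply encl_uY, Hk.
  - apply encl_add; [apply encl_const|]. apply encl_scal.
    apply encl_mul; [easy| |]; apply encl_nY; assumption.
Qed.

Lemma encl_y i k : (i < 8)%nat -> (k < 8)%nat -> encl sY (yf i k) (tget2 y_tab i k).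
Proof.
  intros Hi Hk. rewrite y_tab_eq, tget2_tab2 by assumption. apply (encl_exact 32). easy.
Qed.

Definition defect (j c l : nat) (x : R) : R :=
  4 * dyf (4 + (2 * j + c)) l x +
  sum_f_R0 (fun k => IZR (weight4 k * sep_coef j k) *
     (jac c c k x * sep c k (fun i => yf i l x) +
      jac c (1 - c) k x * sep (1 - c) k (fun i => yf i l x))) 3.

Lemma encl_sepY c k l : (c < 2)%nat -> (l < 8)%nat ->
  encl sY (fun x => sep c k (fun i => yf i l x)) (m_sep c k (fun i => tget2 y_tab i l)).
Proof. intros Hc Hl. apply encl_add; apply encl_scal, encl_y; lia. Qed.

Lemma encl_defect j c l : (j < 2)%nat -> (c < 2)%nat -> (l < 8)%nat ->
  encl sY (defect j c l) (m_defect j c l).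
Proof.
  intros Hj Hc Hl. apply encl_add.
  - apply encl_scal. apply (encl_exact 32). easy.
  - apply encl_msum. intros k Hk. apply encl_scal.
    apply encl_add; (apply encl_mul; [easy| |]);
      (apply encl_jac; lia) || (apply encl_sepY; lia).
Qed.

Definition bracket (a b : nat) (x : R) : R :=
  sum_f_R0 (fun k => yf a k x * yf b (4 + k) x + IZR (-1) * (yf a (4 + k) x * yf b k x)) 3.

Lemma encl_bracket a b : (a < 8)%nat -> (b < 8)%nat -> encl sY (bracket a b) (m_bracket a b).
Proof.
  assert (H : forall a b, (a < 8)%nat -> (b < 8)%nat -> (a < b)%nat ->
            encl sY (bracket a b) (tget2 bracket_tab a b)).
  { clear. intros a b Ha Hb Hab. rewrite bracket_tab_eq, tget2_tab2 by assumption.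
    rewrite (proj2 (Nat.ltb_lt a b) Hab). apply encl_msum. intros k Hk.
    apply encl_add; [|apply encl_scal]; apply encl_mul; try easy; apply encl_y; lia. }
  intros Ha Hb. unfold m_bracket. destruct (Nat.ltb_spec a b) as [Hab|Hab]; [auto|].
  apply (encl_ext sY (fun x => IZR (-1) * bracket b a x)).
  - intros x _. unfold bracket. simpl. ring.
  (* On the diagonal the bracket vanishes identically, in agreement with the empty series stored
     there. *)
  - apply encl_scal. destruct (Nat.eq_dec a b) as [->|Hne]; [|apply H; lia].
    rewrite bracket_tab_eq, tget2_tab2, Nat.ltb_irrefl by assumption.
    apply (encl_ext sY (fun x => ceval nil x / IZR (2 ^ sY))); [|apply encl_exact; easy].
    intros x _. unfold bracket, ceval. simpl. unfold Rdiv. ring.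
Qed.

(** Since [zf] consists of signed entries of [yf], each entry of the product is, up to sign, a
    bracket of two rows of Y. *)
Lemma yz_bracket i l x : (l < 8)%nat ->
  (if Nat.eqb i l then 1 else 0) - sum_f_R0 (fun k => yf i k x * zf k l x) 7 =
  IZR (if Nat.eqb i l then 1 else 0) +
  IZR (if Nat.ltb l 4 then -1 else 1) * bracket i (inv_row l) x.
Proof.
  intros Hl. unfold bracket, zf, inv_sign, inv_col.
  replace (IZR (if (i =? l)%nat then 1 else 0)) with (if (i =? l)%nat then 1 else 0)
    by (destruct (i =? l)%nat; reflexivity).
  simpl. destruct (l <? 4)%nat; simpl; ring.
Qed.

Lemma encl_inv i l : (i < 8)%nat -> (l < 8)%nat ->
  encl sY (fun x => (if Nat.eqb i l then 1 else 0) - sum_f_R0 (fun k => yf i k x * zf k l x) 7)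
    (m_inv_err i l).
Proof.
  intros Hi Hl. eapply encl_ext; [intros x _; symmetry; apply yz_bracket, Hl|].
  apply encl_add; [apply encl_const|]. apply encl_scal, encl_bracket; [exact Hi|].
  unfold inv_row. destruct (Nat.ltb_spec l 4); lia.
Qed.

(** * Estimates on [-1, 1] read off from the enclosures *)

Lemma encl_le s (f : R -> R) t (A B : Z) (x : R) : (0 <= s)%Z -> encl s f t ->
  (0 < A)%Z -> (A * mbound t <= B * 2 ^ s)%Z -> -1 <= x <= 1 -> Rabs (f x) <= IZR B / IZR A.
Proof.
  intros Hs He HA H Hx. pose proof (encl_bound s f t He x Hx) as Hb.
  pose proof (IZR_pow2_pos s Hs) as Hp. apply IZR_le in H. apply IZR_lt in HA.
  rewrite !mult_IZR in H.
  apply Rmult_le_reg_l with (IZR A * IZR (2 ^ s)); [nra|].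
  replace (IZR A * IZR (2 ^ s) * (IZR B / IZR A)) with (IZR B * IZR (2 ^ s)) by (field; lra).
  apply Rle_trans with (IZR A * IZR (mbound t)); [|exact H].
  rewrite Rmult_assoc. apply Rmult_le_compat_l; lra.
Qed.

Lemma encl_sum_le s n (f : nat -> R -> R) t (g : nat -> Z) (A B : Z) x : (0 <= s)%Z ->
  (forall k, (k <= n)%nat -> encl s (f k) (t k)) ->
  (forall k, (k <= n)%nat -> (0 <= g k)%Z) ->
  (0 < A)%Z -> (A * zsum (fun k => mbound (t k) * g k) n <= B * 2 ^ s)%Z -> -1 <= x <= 1 ->
  sum_f_R0 (fun k => Rabs (f k x) * IZR (g k)) n <= IZR B / IZR A.
Proof.
  intros Hs He Hg HA H Hx.
  pose proof (IZR_pow2_pos s Hs) as Hp. apply IZR_le in H. apply IZR_lt in HA.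
  rewrite !mult_IZR, sum_IZR in H.
  apply Rmult_le_reg_l with (IZR A * IZR (2 ^ s)); [nra|].
  replace (IZR A * IZR (2 ^ s) * (IZR B / IZR A)) with (IZR B * IZR (2 ^ s)) by (field; lra).
  eapply Rle_trans; [|exact H]. rewrite Rmult_assoc. apply Rmult_le_compat_l; [lra|].
  rewrite scal_sum. apply sum_Rle. intros k Hk. rewrite mult_IZR.
  replace (Rabs (f k x) * IZR (g k) * IZR (2 ^ s)) with
    ((IZR (2 ^ s) * Rabs (f k x)) * IZR (g k)) by ring.
  apply Rmult_le_compat_r; [apply IZR_le, Hg, Hk|]. apply encl_bound; auto.
Qed.

Lemma xi_bound_pos k : (0 <= xi_bound k)%Z.
Proof. do 8 (destruct k as [|k]; [easy|]). unfold xi_bound. simpl. destruct k; easy. Qed.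

Lemma uf_bound k x : (k < 4)%nat -> -1 <= x <= 1 -> uf k x <= 38 / 10.
Proof.
  intros Hk Hx. eapply Rle_trans; [apply Rle_abs|].
  apply (encl_le sP _ (tget u_tab k) 10 38); [easy|apply encl_u, Hk|easy| |exact Hx].
  apply Z.leb_le. exact (all_below_spec 4 _ k u_check Hk).
Qed.

Definition e_norm : R := 2 / 10 ^ 14.

Lemma nf_norm c k x : (c < 2)%nat -> (k < 4)%nat -> -1 <= x <= 1 ->
  Rabs (nf c k x ^ 2 + nf (1 - c) k x ^ 2 - 1) <= e_norm.
Proof.
  intros Hc Hk Hx.
  assert (H : Rabs (nf 0 k x * nf 0 k x + nf 1 k x * nf 1 k x + IZR (-1)) <= IZR 2 / IZR (10 ^ 14)).
  { apply (encl_le sP (fun x => nf 0 k x * nf 0 k x + nf 1 k x * nf 1 k x + IZR (-1))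
             (norm_err k)); [easy| |easy| |exact Hx].
    - apply encl_add; [|apply encl_const].
      apply encl_add; apply encl_mul; try easy; apply encl_n; lia.
    - apply Z.leb_le. exact (all_below_spec 4 _ k norm_check Hk). }
  replace (IZR 2 / IZR (10 ^ 14)) with e_norm in H by (unfold e_norm; simpl; lra).
  destruct c as [|[|c]]; [| |lia]; simpl;
    (match type of H with Rabs ?a <= _ =>
       match goal with |- Rabs ?b <= _ => replace b with a by ring end end);
    exact H.
Qed.

(** A zero of [uf] would make both components of [nf] vanish, whereas their squares add up to nearly
    1. *)
Lemma uf_pos k x : (k < 4)%nat -> -1 <= x <= 1 -> 0 < uf k x.
Proof.
  intros Hk Hx. pose proof (nf_norm 0 k x ltac:(lia) Hk Hx) as H.
  assert (H0 : 0 <= uf k x) by (unfold uf; apply Rle_0_sqr).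
  destruct H0 as [H0|H0]; [exact H0|exfalso].
  unfold nf in H. rewrite <- H0 in H. rewrite !Rmult_0_l in H.
  apply Rabs_le_between in H. unfold e_norm in H. simpl in H. lra.
Qed.

(** Chosen for the condition e0 + (e1 + k0) r <= r: with e0 = 25/10^13, e1 = 1/1000 and k0 = 37/100
    the left side is 3.984/10^12. *)
Definition radius : R := 4 / 10 ^ 12.
Definition gr (k : nat) : R := IZR (xi_bound k).

Lemma yf_row_bound i x (a : nat -> R) s : (i < 4)%nat -> -1 <= x <= 1 -> 0 <= s ->
  (forall k, (k <= 7)%nat -> Rabs (a k) <= gr k * s) ->
  Rabs (sum_f_R0 (fun k => yf i k x * a k) 7) <= 340 * s.
Proof.
  intros Hi Hx Hs Ha.
  eapply Rle_trans; [apply sum_abs_bound, Ha|].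
  apply Rle_trans with (s * sum_f_R0 (fun k => Rabs (yf i k x) * gr k) 7).
  - rewrite scal_sum. right. apply sum_eq. intros; ring.
  - rewrite (Rmult_comm 340). apply Rmult_le_compat_l; [exact Hs|].
    replace 340 with (340 / 1) by field.
    apply (encl_sum_le sY 7 (fun k => yf i k) (fun k => tget2 y_tab i k) xi_bound 1 340);
      [easy| | |easy| |exact Hx].
    + intros; apply encl_y; lia.
    + intros; apply xi_bound_pos.
    + rewrite Z.mul_1_l. apply Z.leb_le. exact (all_below_spec 4 _ i y_check Hi).
Qed.

Lemma zf_bound k x : (k <= 7)%nat -> -1 <= x <= 1 ->
  2 * sum_f_R0 (fun l => Rabs (zf k l x)) 7 <= gr k.
Proof.
  intros Hk Hx.
  assert (H : sum_f_R0 (fun l => Rabs (yf (inv_row l) (inv_col k) x) * IZR 1) 7 <= gr k / 2).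
  { unfold gr. apply (encl_sum_le sY 7 (fun l => yf (inv_row l) (inv_col k))
      (fun l => tget2 y_tab (inv_row l) (inv_col k)) (fun _ => 1%Z) 2);
      [easy| |easy|easy| |exact Hx].
    - intros l Hl. apply encl_y; unfold inv_row, inv_col;
        destruct (Nat.ltb_spec l 4), (Nat.ltb_spec k 4); lia.
    - pose proof (all_below_spec 8 _ k xi_check ltac:(lia)) as C. apply Z.leb_le in C.
      eapply Z.le_trans; [|exact C]. apply Z.eq_le_incl.
      cbn [zsum]. rewrite !Z.mul_1_r. reflexivity. }
  assert (E : sum_f_R0 (fun l => Rabs (zf k l x)) 7 =
              sum_f_R0 (fun l => Rabs (yf (inv_row l) (inv_col k) x) * IZR 1) 7).
  { apply sum_eq. intros l _. unfold zf, inv_sign. rewrite Rabs_mult.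
    destruct (Bool.eqb _ _).
    - rewrite (Rabs_pos_eq 1) by lra. ring.
    - rewrite Rabs_left by lra. ring. }
  lra.
Qed.

Lemma inv_bound i x : (i <= 7)%nat -> -1 <= x <= 1 ->
  sum_f_R0 (fun l => Rabs ((if Nat.eqb i l then 1 else 0) -
                           sum_f_R0 (fun k => yf i k x * zf k l x) 7)) 7 <= 1 / 1000.
Proof.
  intros Hi Hx.
  rewrite (sum_eq _ (fun l => Rabs ((if Nat.eqb i l then 1 else 0) -
                           sum_f_R0 (fun k => yf i k x * zf k l x) 7) * IZR 1))
    by (intros; ring).
  apply (encl_sum_le sY 7 (fun l x => (if Nat.eqb i l then 1 else 0) -
                           sum_f_R0 (fun k => yf i k x * zf k l x) 7)
           (m_inv_err i) (fun _ => 1%Z) 1000 1); [easy| |easy|easy| |exact Hx].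
  - intros l Hl. apply encl_inv; lia.
  - pose proof (all_below_spec 8 _ i inv_check ltac:(lia)) as C. apply Z.leb_le in C.
    rewrite Z.mul_1_l. eapply Z.le_trans; [|exact C]. apply Z.eq_le_incl.
    cbn [zsum]. rewrite !Z.mul_1_r. reflexivity.
Qed.

Definition state (x : nat -> R) (t : R) (j : nat) : R :=
  wf j t + sum_f_R0 (fun k => yf j k t * x k) 7.

Lemma phase_index i : (i <= 7)%nat ->
  (i < 4)%nat \/ exists j c, (j < 2)%nat /\ (c < 2)%nat /\ i = (4 + (2 * j + c))%nat.
Proof.
  intros H. destruct (Nat.lt_ge_cases i 4) as [Hi|Hi]; [left; exact Hi|right].
  exists ((i - 4) / 2)%nat, ((i - 4) mod 2)%nat.
  pose proof (Nat.div_mod_eq (i - 4) 2). pose proof (Nat.mod_upper_bound (i - 4) 2 ltac:(lia)).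
  repeat split; lia.
Qed.

Lemma field_position i z : (i < 4)%nat -> field i z = z (4 + i)%nat.
Proof. intros H. unfold field. rewrite (proj2 (Nat.ltb_lt i 4) H). reflexivity. Qed.

Lemma field_velocity j c z : (j < 2)%nat -> (c < 2)%nat ->
  field (4 + (2 * j + c)) z = force j c z.
Proof.
  intros Hj Hc. destruct j as [|[|j]], c as [|[|c]]; try lia; reflexivity.
Qed.

Lemma wf_velocity i t : (i < 4)%nat -> wf (4 + i) t = dwf i t.
Proof.
  intros H. unfold wf, dwf, w_coef.
  rewrite (proj2 (Nat.ltb_lt i 4) H). replace (4 + i - 4)%nat with i by lia. reflexivity.
Qed.

Lemma yf_velocity i k t : (i < 4)%nat -> yf (4 + i) k t = dyf i k t.
Proof.
  intros H. unfold yf, dyf, y_coef.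
  rewrite (proj2 (Nat.ltb_lt i 4) H). replace (4 + i - 4)%nat with i by lia. reflexivity.
Qed.

Lemma sep_coef_abs j k : Rabs (IZR (sep_coef j k)) <= 1.
Proof.
  rewrite <- abs_IZR. apply IZR_le.
  destruct j as [|[|[|j]]]; do 5 (try destruct k as [|k]); easy.
Qed.

Lemma weight_sum j : (j < 2)%nat ->
  sum_f_R0 (fun k => Rabs (IZR (weight4 k * sep_coef j k)) * 1) 3 = 9.
Proof.
  intros Hj.
  rewrite (sum_eq _ (fun k => IZR (Z.abs (weight4 k * sep_coef j k))))
    by (intros; rewrite abs_IZR; ring).
  rewrite <- (sum_IZR (fun k => Z.abs (weight4 k * sep_coef j k))). f_equal.
  destruct j as [|[|j]]; [reflexivity|reflexivity|lia].
Qed.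

Lemma sep_bound c k h s : (forall i, (i < 4)%nat -> Rabs (h i) <= s) -> (c < 2)%nat ->
  Rabs (sep c k h) <= 2 * s.
Proof.
  intros Hh Hc. unfold sep. replace (2 * s) with (1 * s + 1 * s) by ring.
  apply Rabs_plus_le; apply Rabs_mult_le; auto using sep_coef_abs; apply Hh; lia.
Qed.

Lemma sep_plus c k a b : sep c k (fun i => a i + b i) = sep c k a + sep c k b.
Proof. unfold sep. ring. Qed.

Lemma sep_sum c k (a : nat -> nat -> R) (x : nat -> R) n :
  sep c k (fun i => sum_f_R0 (fun l => a i l * x l) n) =
  sum_f_R0 (fun l => sep c k (fun i => a i l) * x l) n.
Proof.
  unfold sep. induction n as [|n IH]; cbn [sum_f_R0]; [ring|]. rewrite <- IH. ring.
Qed.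

(** The polynomial residual contributes 2/10^13, a quarter of the checked 8/10^13. Replacing the
    true force by its polynomial form costs 9/4 * 3 * (38/10)^2 * 2/10^14, less than 20/10^13; here
    9 is the sum of the absolute weights. *)
Lemma residual_small t i : -1 <= t <= 1 -> (i <= 7)%nat ->
  Rabs (dwf i t - field i (state (fun _ => 0) t)) <= 25 / 10 ^ 13.
Proof.
  intros Ht Hi.
  replace (state (fun _ => 0) t) with (fun j => wf j t).
  2:{ apply functional_extensionality; intros j. unfold state.
      rewrite (sum_eq _ (fun _ => 0 * 0)) by (intros; ring).
      rewrite <- scal_sum. ring. }
  destruct (phase_index i Hi) as [Hi4|[j [c [Hj [Hc ->]]]]].
  { rewrite field_position, wf_velocity, Rminus_diag, Rabs_R0 by exact Hi4. simpl; lra. }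
  rewrite field_velocity by assumption. unfold force.
  set (b := fun k => IZR (weight4 k * sep_coef j k)).
  set (K := fun k => kepler (sep c k (fun i => wf i t)) (sep (1 - c) k (fun i => wf i t))).
  set (L := fun k => (uf k t * uf k t) * nf c k t).
  assert (R1 : Rabs (4 * dwf (4 + (2 * j + c)) t + sum_f_R0 (fun k => b k * L k) 3) <= 8 / 10 ^ 13).
  { replace (8 / 10 ^ 13) with (IZR 8 / IZR (10 ^ 13)) by (simpl; lra).
    apply (encl_le sP (fun t => 4 * dwf (4 + (2 * j + c)) t +
        sum_f_R0 (fun k => IZR (weight4 k * sep_coef j k) * ((uf k t * uf k t) * nf c k t)) 3)
        (m_residual j c)); [easy| |easy| |exact Ht].
    - apply encl_add.
      + apply encl_round; [easy|easy|]. apply encl_scal, (encl_exact 72). easy.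
      + apply encl_msum. intros k Hk. apply encl_scal, encl_force; lia.
    - apply Z.leb_le.
      exact (all_below_spec 2 _ c (all_below_spec 2 _ j residual_check Hj) Hc). }
  assert (R2 : Rabs (sum_f_R0 (fun k => b k * (K k - L k)) 3) <= 9 * (3 * (38 / 10) ^ 2 * e_norm)).
  { eapply Rle_trans.
    - apply sum_abs_bound with (b := fun _ => 3 * (38 / 10) ^ 2 * e_norm). intros k Hk.
      eapply Rle_trans.
      + unfold K, L, nf. replace (uf k t * uf k t) with (uf k t ^ 2) by ring.
        apply (kepler_approx (uf k t) _ _ e_norm).
        * apply uf_pos; [lia|exact Ht].
        * apply (nf_norm c k t); [exact Hc|lia|exact Ht].
        * unfold e_norm; simpl; lra.
      + pose proof (uf_pos k t ltac:(lia) Ht). pose proof (uf_bound k t ltac:(lia) Ht).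
        apply Rmult_le_compat_r; [unfold e_norm; simpl; lra|].
        apply Rmult_le_compat_l; [lra|]. apply pow_incr. lra.
    - rewrite <- (weight_sum j Hj), (Rmult_comm (sum_f_R0 _ _)), scal_sum. right.
      apply sum_eq. intros. unfold b. ring. }
  rewrite <- sum_minus_distr in R2.
  apply Rabs_le_between in R1. apply Rabs_le_between in R2.
  change (sum_f_R0 (fun k => IZR (weight4 k * sep_coef j k) *
      kepler (sep c k (fun j => wf j t)) (sep (1 - c) k (fun j => wf j t))) 3)
    with (sum_f_R0 (fun k => b k * K k) 3).
  unfold e_norm in R2. apply Rabs_le. lra.
Qed.

(** The constant is (6/10 + 88/100) / 4: the first summand is the defect of Y in the linearised
    equation, the second the variation of the Jacobian over the ball, where positions move by at
    most 340 * [radius]. *)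
Lemma field_linearised t i x y d : -1 <= t <= 1 -> (i <= 7)%nat ->
  (forall k, (k <= 7)%nat -> Rabs (x k) <= gr k * radius) ->
  (forall k, (k <= 7)%nat -> Rabs (y k) <= gr k * radius) ->
  (forall k, (k <= 7)%nat -> Rabs (x k - y k) <= gr k * d) ->
  Rabs (field i (state x t) - field i (state y t) -
        sum_f_R0 (fun k => dyf i k t * (x k - y k)) 7) <= 37 / 100 * d.
Proof.
  intros Ht Hi Hx Hy Hd.
  assert (Hd0 : 0 <= d).
  { specialize (Hd O ltac:(lia)). pose proof (Rabs_pos (x O - y O)).
    change (gr 0) with 11 in Hd. lra. }
  assert (Hr0 : 0 <= radius) by (unfold radius; simpl; lra).
  destruct (phase_index i Hi) as [Hi4|[j [c [Hj [Hc ->]]]]].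
  { rewrite !field_position by exact Hi4. unfold state.
    rewrite (sum_eq (fun k => dyf i k t * _) (fun k => yf (4 + i) k t * (x k - y k)))
      by (intros; rewrite yf_velocity by exact Hi4; reflexivity).
    rewrite <- sum_minus_distr.
    replace (_ - _) with 0 by ring. rewrite Rabs_R0. lra. }
  rewrite !field_velocity by assumption. unfold force.
  set (b := fun k => IZR (weight4 k * sep_coef j k)).
  set (w := fun i => wf i t).
  set (hx := fun i => sum_f_R0 (fun l => yf i l t * x l) 7).
  set (hy := fun i => sum_f_R0 (fun l => yf i l t * y l) 7).
  assert (Bx : forall i, (i < 4)%nat -> Rabs (hx i) <= 340 * radius)
    by (intros; apply yf_row_bound; auto).
  assert (By : forall i, (i < 4)%nat -> Rabs (hy i) <= 340 * radius)
    by (intros; apply yf_row_bound; auto).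
  assert (Bd : forall i, (i < 4)%nat -> Rabs (hx i - hy i) <= 340 * d).
  { intros. unfold hx, hy. rewrite sum_minus_distr. apply yf_row_bound; auto. }
  assert (Sd : forall c k, sep c k hx - sep c k hy =
             sum_f_R0 (fun l => sep c k (fun i => yf i l t) * (x l - y l)) 7).
  { intros. unfold hx, hy. rewrite !sep_sum. apply sum_minus_distr. }
  assert (Bs : forall c k, (c < 2)%nat -> Rabs (sep c k hx - sep c k hy) <= 2 * (340 * d)).
  { intros c' k Hc'. replace (sep c' k hx - sep c' k hy) with (sep c' k (fun i => hx i - hy i))
      by (unfold sep; ring). apply sep_bound; auto. }
  set (Kx := fun k => kepler (sep c k (state x t)) (sep (1 - c) k (state x t))).
  set (Ky := fun k => kepler (sep c k (state y t)) (sep (1 - c) k (state y t))).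
  set (L := fun k => jac c c k t * (sep c k hx - sep c k hy) +
                     jac c (1 - c) k t * (sep (1 - c) k hx - sep (1 - c) k hy)).
  assert (R1 : forall k, (k <= 3)%nat -> Rabs (Kx k - Ky k - L k) <=
             (38 / 10) ^ 3 * (250 * (e_norm + 38 / 10 * (2 * (340 * radius)))) * (2 * (340 * d))).
  { intros k Hk.
    pose proof (uf_pos k t ltac:(lia) Ht) as U1. pose proof (uf_bound k t ltac:(lia) Ht) as U2.
    unfold Kx, Ky.
    change (state x t) with (fun i => w i + hx i). change (state y t) with (fun i => w i + hy i).
    rewrite !sep_plus.
    assert (Ej : L k = uf k t ^ 3 * (1 - 3 * (uf k t * sep c k w) ^ 2) * (sep c k hx - sep c k hy) +
         uf k t ^ 3 * (-3 * ((uf k t * sep c k w) * (uf k t * sep (1 - c) k w))) *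
           (sep (1 - c) k hx - sep (1 - c) k hy)).
    { unfold L, jac, nf. fold w. rewrite Nat.eqb_refl.
      replace (c =? 1 - c)%nat with false
        by (destruct c as [|[|c]]; [reflexivity|reflexivity|lia]). ring. }
    rewrite Ej.
    eapply Rle_trans.
    - apply (kepler_linearised (uf k t) _ _ _ _ _ _ e_norm (2 * (340 * radius)) (2 * (340 * d)));
        try (apply sep_bound; auto; lia); try (apply Bs; lia).
      + exact U1.
      + apply (nf_norm c k t); [exact Hc|lia|exact Ht].
      + unfold e_norm; simpl; lra.
      + apply Rle_trans with (38 / 10 * (2 * (340 * radius))).
        * apply Rmult_le_compat_r; lra.
        * unfold radius; simpl; lra.
    - apply Rmult_le_compat_r; [lra|].
      assert (0 <= e_norm) by (unfold e_norm; simpl; lra).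
      apply Rmult_le_compat.
      + apply pow_le; lra.
      + apply Rmult_le_pos; [lra|]. apply Rplus_le_le_0_compat; [lra|]. apply Rmult_le_pos; lra.
      + apply pow_incr; lra.
      + apply Rmult_le_compat_l; [lra|]. apply Rplus_le_compat_l.
        apply Rmult_le_compat_r; lra. }
  assert (R2 : Rabs (sum_f_R0 (fun l => defect j c l t * (x l - y l)) 7) <= 6 / 10 * d).
  { eapply Rle_trans.
    - apply sum_abs_bound with (b := fun l => gr l * d). exact Hd.
    - rewrite (sum_eq _ (fun l => (Rabs (defect j c l t) * gr l) * d)) by (intros; ring).
      rewrite <- scal_sum, Rmult_comm. apply Rmult_le_compat_r; [exact Hd0|].
      apply (encl_sum_le sY 7 (defect j c) (m_defect j c) xi_bound 10 6).
      + easy.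
      + intros l Hl. apply encl_defect; lia.
      + intros; apply xi_bound_pos.
      + easy.
      + apply Z.leb_le.
        exact (all_below_spec 2 _ c (all_below_spec 2 _ j defect_check Hj) Hc).
      + exact Ht. }
  assert (E2 : sum_f_R0 (fun l => defect j c l t * (x l - y l)) 7 =
     4 * sum_f_R0 (fun l => dyf (4 + (2 * j + c)) l t * (x l - y l)) 7 + sum_f_R0 (fun k => b k * L k) 3).
  { assert (E3 : sum_f_R0 (fun k => b k * L k) 3 =
       sum_f_R0 (fun k => b k * sum_f_R0 (fun l =>
          (jac c c k t * sep c k (fun i => yf i l t) +
           jac c (1 - c) k t * sep (1 - c) k (fun i => yf i l t)) * (x l - y l)) 7) 3).
    { apply sum_eq. intros k _. f_equal. unfold L. rewrite !Sd, !scal_sum, <- plus_sum.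
      apply sum_eq. intros; ring. }
    rewrite E3, sum_exchange, scal_sum, <- plus_sum. apply sum_eq. intros l _.
    unfold defect, b. cbv beta. ring. }
  set (M := (38 / 10) ^ 3 * (250 * (e_norm + 38 / 10 * (2 * (340 * radius)))) * (2 * (340 * d))) in *.
  assert (R3 : Rabs (sum_f_R0 (fun k => b k * (Kx k - Ky k - L k)) 3) <= 9 * M).
  { eapply Rle_trans; [apply sum_abs_bound with (b := fun _ => M); exact R1|].
    rewrite <- (weight_sum j Hj), (Rmult_comm (sum_f_R0 _ _)), scal_sum. right.
    apply sum_eq. intros. unfold b. ring. }
  rewrite <- sum_minus_distr, <- (sum_minus_distr b Kx Ky) in R3.
  assert (HM : 9 * M <= 88 / 100 * d).
  { unfold M, e_norm, radius.
    replace (9 * _) with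
      (((38 / 10) ^ 3 * (250 * (2 / 10 ^ 14 + 38 / 10 * (2 * (340 * (4 / 10 ^ 12))))) * (2 * 340) * 9) * d)
      by ring.
    apply Rmult_le_compat_r; [exact Hd0|]. simpl. lra. }
  change (sum_f_R0 (fun k => IZR (weight4 k * sep_coef j k) *
      kepler (sep c k (state x t)) (sep (1 - c) k (state x t))) 3) with (sum_f_R0 (fun k => b k * Kx k) 3).
  change (sum_f_R0 (fun k => IZR (weight4 k * sep_coef j k) *
      kepler (sep c k (state y t)) (sep (1 - c) k (state y t))) 3) with (sum_f_R0 (fun k => b k * Ky k) 3).
  apply Rabs_le_between in R2. apply Rabs_le_between in R3.
  apply Rabs_le. lra.
Qed.

(** Collisions are excluded because the correction, scaled by the inverse length of a separation,
    stays below 1/100. *)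
Lemma state_sep_pos t x k : -1 <= t <= 1 -> (k < 4)%nat ->
  (forall k, (k <= 7)%nat -> Rabs (x k) <= gr k * radius) ->
  0 < sep 0 k (state x t) ^ 2 + sep 1 k (state x t) ^ 2.
Proof.
  intros Ht Hk Hx.
  assert (Hr0 : 0 <= radius) by (unfold radius; simpl; lra).
  set (h := fun i => sum_f_R0 (fun l => yf i l t * x l) 7).
  assert (Bx : forall i, (i < 4)%nat -> Rabs (h i) <= 340 * radius)
    by (intros; apply yf_row_bound; auto).
  change (state x t) with (fun i => wf i t + h i). rewrite !sep_plus.
  pose proof (uf_pos k t Hk Ht). pose proof (uf_bound k t Hk Ht).
  apply (perturbed_pos (uf k t) _ _ _ _ e_norm (2 * (340 * radius))); auto.
  - apply (nf_norm 0 k t); [lia|exact Hk|exact Ht].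
  - unfold e_norm; simpl; lra.
  - apply Rle_trans with (38 / 10 * (2 * (340 * radius))).
    + apply Rmult_le_compat_r; lra.
    + unfold radius; simpl; lra.
  - apply sep_bound; auto.
  - apply sep_bound; auto.
Qed.

Lemma is_derive_wf i t : is_derive (wf i) t (dwf i t).
Proof.
  unfold wf, dwf, Rdiv.
  apply (is_derive_ext (fun x => / IZR (2 ^ sW) * ceval (w_coef i) x)).
  - intros; apply Rmult_comm.
  - rewrite Rmult_comm. apply is_derive_scal, is_derive_ceval.
Qed.

Lemma is_derive_yf i k t : is_derive (yf i k) t (dyf i k t).
Proof.
  unfold yf, dyf, Rdiv.
  apply (is_derive_ext (fun x => / IZR (2 ^ sY) * ceval (y_coef i k) x)).
  - intros; apply Rmult_comm.
  - rewrite Rmult_comm. apply is_derive_scal, is_derive_ceval.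
Qed.

Lemma continuous_ceval l t : continuous (ceval l) t.
Proof. eapply is_derive_continuous, is_derive_ceval. Qed.

Lemma continuous_scaled_ceval l c t : continuous (fun x => ceval l x / c) t.
Proof.
  apply (continuous_mult (K := R_AbsRing)); [apply continuous_ceval|apply continuous_const].
Qed.

Lemma continuous_zf k l t : continuous (zf k l) t.
Proof.
  apply (continuous_mult (K := R_AbsRing)); [apply continuous_const|apply continuous_scaled_ceval].
Qed.

Lemma continuous_sep c k (z : R -> nat -> R) t : (forall i, continuous (fun s => z s i) t) ->
  continuous (fun s => sep c k (z s)) t.
Proof.
  intros H. apply (continuous_plus (K := R_AbsRing) (V := R_NormedModule));
    apply (continuous_mult (K := R_AbsRing)); auto using continuous_const.
Qed.

Lemma continuous_field (x : nat -> R -> R) t i : -1 <= t <= 1 -> (i <= 7)%nat ->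
  (forall k, (k <= 7)%nat -> continuous (x k) t) ->
  (forall k, (k <= 7)%nat -> Rabs (x k t) <= gr k * radius) ->
  continuous (fun s => field i (state (fun k => x k s) s)) t.
Proof.
  intros Ht Hi Hc Hb.
  assert (Hs : forall j, continuous (fun s => state (fun k => x k s) s j) t).
  { intros j. apply (continuous_plus (K := R_AbsRing) (V := R_NormedModule)).
    - apply continuous_scaled_ceval.
    - apply (continuous_sum (fun k s => yf j k s * x k s)). intros k Hk.
      apply (continuous_mult (K := R_AbsRing)); [apply continuous_scaled_ceval|auto]. }
  destruct (phase_index i Hi) as [Hi4|[j [c [Hj [Hc2 ->]]]]].
  - apply (continuous_ext (fun s => state (fun k => x k s) s (4 + i)%nat)); [|apply Hs].
    intros s. symmetry. apply field_position, Hi4.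
  - apply (continuous_ext (fun s => force j c (state (fun k => x k s) s))).
    { intros s. symmetry. apply field_velocity; assumption. }
    apply (continuous_mult (K := R_AbsRing)); [apply continuous_const|].
    apply (continuous_sum (fun k s => IZR (weight4 k * sep_coef j k) *
        kepler (sep c k (state (fun k => x k s) s)) (sep (1 - c) k (state (fun k => x k s) s)))).
    intros k Hk. apply (continuous_mult (K := R_AbsRing)); [apply continuous_const|].
    apply continuous_kepler; try (apply (continuous_sep _ _ (fun s => state (fun k => x k s) s)), Hs).
    pose proof (state_sep_pos t (fun k => x k t) k Ht ltac:(lia) Hb) as P.
    destruct c as [|[|c]]; [exact P|simpl Nat.sub; lra|lia].
Qed.

(** Columns 0-3 satisfy the conditions at -1, so their coefficients are free there and have to
    vanish at 1; for columns 4-7 the ends are exchanged. *)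
Definition node (k : nat) : R := if Nat.ltb k 4 then 1 else -1.

(** [altsum] and [sum1] are the values at -1 and 1, so the boundary conditions are integer
    identities. The margin 1/10 in the sign conditions exceeds the distance from the polynomial to
    the true orbit. *)
Lemma bc_check :
  all_below 4 (fun k => Z.eqb (altsum (y_coef 0 k)) 0 && Z.eqb (altsum (y_coef 3 k)) 0 &&
    Z.eqb (altsum (y_coef 5 k)) 0 && Z.eqb (altsum (y_coef 6 k)) 0)%bool = true /\
  all_below 4 (fun k => Z.eqb (sum1 (y_coef 0 (4 + k))) (sum1 (y_coef 2 (4 + k))) &&
    Z.eqb (sum1 (y_coef 1 (4 + k))) (- sum1 (y_coef 3 (4 + k))) &&
    Z.eqb (sum1 (y_coef 4 (4 + k))) (- sum1 (y_coef 6 (4 + k))) &&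
    Z.eqb (sum1 (y_coef 5 (4 + k))) (sum1 (y_coef 7 (4 + k))))%bool = true /\
  (altsum (w_coef 0) = 0 /\ altsum (w_coef 3) = 0 /\ altsum (w_coef 5) = 0 /\ altsum (w_coef 6) = 0)%Z /\
  (sum1 (w_coef 0) = sum1 (w_coef 2) /\ sum1 (w_coef 1) = - sum1 (w_coef 3) /\
   sum1 (w_coef 4) = - sum1 (w_coef 6) /\ sum1 (w_coef 5) = sum1 (w_coef 7))%Z /\
  (2 ^ sW < 10 * altsum (w_coef 1) /\ 2 ^ sW < 10 * altsum (w_coef 2) /\
   2 ^ sW < 10 * sum1 (w_coef 0) /\ 10 * sum1 (w_coef 1) < - 2 ^ sW)%Z.
Proof. vm_compute. repeat split; reflexivity. Qed.

(* Time is normalised to [-1, 1]; [z 0, ..., z 3] are the coordinates of [q1]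
   and [q2], and [z 4, ..., z 7] their velocities. *)
Theorem local_orbit : exists z : nat -> R -> R,
  (forall i t, (i <= 7)%nat -> -1 <= t <= 1 ->
     is_derive (z i) t (field i (fun j => z j t))) /\
  (forall k t, (k < 4)%nat -> -1 <= t <= 1 ->
     0 < sep 0 k (fun j => z j t) ^ 2 + sep 1 k (fun j => z j t) ^ 2) /\
  (z 0%nat (-1) = 0 /\ z 3%nat (-1) = 0 /\ z 5%nat (-1) = 0 /\ z 6%nat (-1) = 0) /\
  (z 0%nat 1 = z 2%nat 1 /\ z 1%nat 1 = - z 3%nat 1 /\
   z 4%nat 1 = - z 6%nat 1 /\ z 5%nat 1 = z 7%nat 1) /\
  (0 < z 1%nat (-1) /\ 0 < z 2%nat (-1) /\ 0 < z 0%nat 1 /\ z 1%nat 1 < 0).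
Proof.
  destruct (bvp_solution 7 wf dwf yf dyf zf node field gr radius (25 / 10 ^ 13) (1 / 1000) (37 / 100))
    as [x [X0 [Xb Xd]]].
  - exact is_derive_wf.
  - intros. apply continuous_scaled_ceval.
  - exact is_derive_yf.
  - intros. apply continuous_scaled_ceval.
  - apply continuous_zf.
  - intros k. unfold node. destruct (k <? 4)%nat; lra.
  - unfold radius; simpl; lra.
  - lra.
  - lra.
  - intros; apply zf_bound; assumption.
  - intros; apply inv_bound; assumption.
  - exact residual_small.
  - exact field_linearised.
  - exact continuous_field.
  - lra.
  - unfold radius; simpl; lra.
  - exists (fun i t => state (fun k => x k t) t i).
    assert (HS : 0 < IZR (2 ^ sW)) by (apply IZR_pow2_pos; easy).
    assert (H0 : forall k, (k < 4)%nat -> x k 1 = 0).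
    { intros k Hk. pose proof (X0 k) as E. unfold node in E.
      rewrite (proj2 (Nat.ltb_lt k 4) Hk) in E. exact E. }
    assert (H1 : forall k, (k < 4)%nat -> x (4 + k)%nat (-1) = 0)
      by (intros k Hk; exact (X0 (4 + k)%nat)).
    destruct bc_check as [C1 [C2 [C3 [C4 C5]]]].
    (* At -1 only columns 0-3 contribute, at 1 only columns 4-7, which is why each end inherits its
       linear conditions exactly. *)
    assert (Hm1 : forall i, state (fun k => x k (-1)) (-1) i =
       IZR (altsum (w_coef i)) / IZR (2 ^ sW) +
       sum_f_R0 (fun k => IZR (altsum (y_coef i k)) / IZR (2 ^ sY) * x k (-1)) 3).
    { intros i. unfold state, wf, yf. rewrite ceval_m1. f_equal.
      cbn [sum_f_R0]. rewrite !ceval_m1.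
      rewrite (H1 0%nat ltac:(lia) : x 4%nat (-1) = 0), (H1 1%nat ltac:(lia) : x 5%nat (-1) = 0),
        (H1 2%nat ltac:(lia) : x 6%nat (-1) = 0), (H1 3%nat ltac:(lia) : x 7%nat (-1) = 0). ring. }
    assert (Hp1 : forall i, state (fun k => x k 1) 1 i =
       IZR (sum1 (w_coef i)) / IZR (2 ^ sW) +
       sum_f_R0 (fun k => IZR (sum1 (y_coef i (4 + k))) / IZR (2 ^ sY) * x (4 + k)%nat 1) 3).
    { intros i. unfold state, wf, yf. rewrite ceval_1. f_equal.
      cbn [sum_f_R0]. rewrite !ceval_1.
      rewrite (H0 0%nat), (H0 1%nat), (H0 2%nat), (H0 3%nat) by lia. simpl. ring. }
    assert (Y1 : forall i, In i [0; 3; 5; 6]%nat ->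
       forall k, (k < 4)%nat -> altsum (y_coef i k) = 0%Z).
    { intros i Hi k Hk. apply (fun H => all_below_spec 4 _ k H Hk) in C1.
      rewrite !Bool.andb_true_iff, !Z.eqb_eq in C1. simpl in Hi.
      destruct Hi as [<-|[<-|[<-|[<-|[]]]]]; tauto. }
    assert (Z1 : forall i, In i [0; 3; 5; 6]%nat -> altsum (w_coef i) = 0%Z ->
       state (fun k => x k (-1)) (-1) i = 0).
    { intros i Hi Hw. rewrite Hm1, Hw. cbn [sum_f_R0].
      rewrite (Y1 i Hi 0%nat), (Y1 i Hi 1%nat), (Y1 i Hi 2%nat), (Y1 i Hi 3%nat) by lia.
      unfold Rdiv. ring. }
    assert (Y2 : forall k, (k < 4)%nat ->
       (sum1 (y_coef 0 (4 + k)) = sum1 (y_coef 2 (4 + k)) /\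
        sum1 (y_coef 1 (4 + k)) = - sum1 (y_coef 3 (4 + k)) /\
        sum1 (y_coef 4 (4 + k)) = - sum1 (y_coef 6 (4 + k)) /\
        sum1 (y_coef 5 (4 + k)) = sum1 (y_coef 7 (4 + k)))%Z).
    { intros k Hk. apply (fun H => all_below_spec 4 _ k H Hk) in C2.
      rewrite !Bool.andb_true_iff, !Z.eqb_eq in C2. tauto. }
    assert (Hsmall : forall i t, (i < 4)%nat -> -1 <= t <= 1 ->
       Rabs (state (fun k => x k t) t i - wf i t) < 1 / 100).
    { intros i t Hi Ht. unfold state. rewrite Rplus_minus_l.
      apply Rle_lt_trans with (340 * radius); [|unfold radius; lra].
      apply (yf_row_bound i t (fun k => x k t) radius Hi Ht); [unfold radius; lra|].
      intros; apply Xb; auto. }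
    assert (Wpos : forall a, (2 ^ sW < 10 * a)%Z -> 1 / 10 < IZR a / IZR (2 ^ sW)).
    { intros a Ha. apply IZR_lt in Ha. rewrite mult_IZR in Ha.
      apply Rmult_lt_reg_r with (IZR (2 ^ sW)); [exact HS|].
      unfold Rdiv. rewrite (Rmult_assoc (IZR a)), Rinv_l by lra. lra. }
    assert (I1 : -1 <= -1 <= 1) by lra. assert (I2 : -1 <= 1 <= 1) by lra.
    split; [exact Xd|]. split; [|split; [|split]].
    + intros k t Hk Ht. apply state_sep_pos; auto.
    + destruct C3 as [W0 [W3 [W5 W6]]].
      repeat split; apply Z1; auto; simpl; tauto.
    + assert (Eq : forall s i i', sum1 (w_coef i) = (s * sum1 (w_coef i'))%Z ->
        (forall k, (k < 4)%nat -> sum1 (y_coef i (4 + k)) = s * sum1 (y_coef i' (4 + k)))%Z ->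
        state (fun k => x k 1) 1 i = IZR s * state (fun k => x k 1) 1 i').
      { intros s i i' Hw Hy. rewrite !Hp1, Hw, mult_IZR, Rmult_plus_distr_l, scal_sum.
        f_equal; [unfold Rdiv; ring|]. apply sum_eq. intros k Hk.
        rewrite Hy, mult_IZR by lia. unfold Rdiv. ring. }
      destruct C4 as [W0 [W1 [W2 W3]]].
      repeat split.
      * rewrite (Eq 1%Z 0%nat 2%nat), Rmult_1_l; [reflexivity|lia|].
        intros k Hk. destruct (Y2 k Hk) as [H _]. lia.
      * rewrite (Eq (-1)%Z 1%nat 3%nat); [ring|lia|].
        intros k Hk. destruct (Y2 k Hk) as [_ [H _]]. lia.
      * rewrite (Eq (-1)%Z 4%nat 6%nat); [ring|lia|].
        intros k Hk. destruct (Y2 k Hk) as [_ [_ [H _]]]. lia.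
      * rewrite (Eq 1%Z 5%nat 7%nat), Rmult_1_l; [reflexivity|lia|].
        intros k Hk. destruct (Y2 k Hk) as [_ [_ [_ H]]]. lia.
    + destruct C5 as [P1 [P2 [P3 P4]]].
      pose proof (Hsmall 1%nat (-1) ltac:(lia) I1) as S1.
      pose proof (Hsmall 2%nat (-1) ltac:(lia) I1) as S2.
      pose proof (Hsmall 0%nat 1 ltac:(lia) I2) as S3.
      pose proof (Hsmall 1%nat 1 ltac:(lia) I2) as S4.
      unfold wf in S1, S2, S3, S4. rewrite ceval_m1 in S1, S2. rewrite ceval_1 in S3, S4.
      apply Wpos in P1. apply Wpos in P2. apply Wpos in P3.
      assert (P4' : (2 ^ sW < 10 * - sum1 (w_coef 1))%Z) by lia. apply Wpos in P4'.
      rewrite opp_IZR, Ropp_div in P4'.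
      apply Rabs_def2 in S1. apply Rabs_def2 in S2. apply Rabs_def2 in S3. apply Rabs_def2 in S4.
      repeat split; lra.
Qed.

(** * Extension by reflections *)

Lemma is_derive_glue (f f1 f2 : R -> R) (t l : R) :
  is_derive f1 t l -> is_derive f2 t l ->
  locally t (fun s => (s <= t -> f s = f1 s) /\ (t <= s -> f s = f2 s)) ->
  is_derive f t l.
Proof.
  intros H1 H2 [d H]. apply is_derive_Reals in H1. apply is_derive_Reals in H2.
  apply is_derive_Reals. intros eps Heps.
  destruct (H1 eps Heps) as [d1 D1]. destruct (H2 eps Heps) as [d2 D2].
  assert (Hd : 0 < Rmin d (Rmin d1 d2)).
  { repeat apply Rmin_glb_lt; apply cond_pos. }
  exists (mkposreal _ Hd). intros h Hh0 Hh. simpl in Hh.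
  pose proof (Rmin_l d (Rmin d1 d2)). pose proof (Rmin_r d (Rmin d1 d2)).
  pose proof (Rmin_l d1 d2). pose proof (Rmin_r d1 d2).
  assert (B : forall s, Rabs (s - t) < d -> (s <= t -> f s = f1 s) /\ (t <= s -> f s = f2 s)).
  { intros s Hs. apply H. exact Hs. }
  destruct (B t) as [Bl Br]; [rewrite Rminus_diag, Rabs_R0; apply cond_pos|].
  destruct (B (t + h)) as [Cl Cr]; [rewrite Rplus_minus_l; lra|].
  destruct (Rle_dec h 0) as [Hn|Hn].
  - rewrite Cl, Bl by lra. apply D1; [exact Hh0|lra].
  - rewrite Cr, Br by lra. apply D2; [exact Hh0|lra].
Qed.

Lemma locally_lt t c : t < c -> locally t (fun s => s < c).
Proof.
  intros H. assert (Hd : 0 < c - t) by lra. exists (mkposreal _ Hd).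
  intros s Hs. change (Rabs (s - t) < c - t) in Hs. apply Rabs_def2 in Hs. lra.
Qed.

Lemma locally_gt t c : c < t -> locally t (fun s => c < s).
Proof.
  intros H. assert (Hd : 0 < t - c) by lra. exists (mkposreal _ Hd).
  intros s Hs. change (Rabs (s - t) < t - c) in Hs. apply Rabs_def2 in Hs. lra.
Qed.

Lemma is_derive_comp_shift (f : R -> R) c t l :
  is_derive f (t - c) l -> is_derive (fun s => f (s - c)) t l.
Proof.
  intros H. apply is_derive_Reals in H. apply is_derive_Reals.
  intros eps He. destruct (H eps He) as [d D]. exists d. intros h h0 hd.
  replace (t + h - c) with (t - c + h) by ring. apply D; assumption.
Qed.

Lemma is_derive_comp_reflect (f : R -> R) c e t l :
  is_derive f (c - t) l -> is_derive (fun s => e * f (c - s)) t (- e * l).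
Proof.
  intros H. replace (- e * l) with (e * (-1 * l)) by ring.
  apply is_derive_scal. apply (is_derive_comp f (fun s => c - s)).
  - exact H.
  - auto_derive; [exact I|ring].
Qed.

Definition refl (c e : R) (f h : R -> R) (t : R) : R :=
  if Rle_dec t c then f t else e * h (2 * c - t).

Lemma refl_le c e f h t : t <= c -> refl c e f h t = f t.
Proof. intros H. unfold refl. destruct Rle_dec; [reflexivity|lra]. Qed.

Lemma refl_ge c e f h t : f c = e * h c -> c <= t -> refl c e f h t = e * h (2 * c - t).
Proof.
  intros E H. unfold refl. destruct Rle_dec as [H1|H1]; [|reflexivity].
  replace t with c by lra. replace (2 * c - c) with c by ring. exact E.
Qed.

(** Time reversal negates derivatives, so the derivative extends with sign [- e]. The function [h]
    may differ from [f], since q1 is continued by the mirror image of q2. *)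
Lemma is_derive_refl c e (f h f' h' : R -> R) t :
  (t <= c -> is_derive f t (f' t)) ->
  (c <= t -> is_derive h (2 * c - t) (h' (2 * c - t))) ->
  f c = e * h c -> f' c = - e * h' c ->
  is_derive (refl c e f h) t (refl c (- e) f' h' t).
Proof.
  intros Hf Hh E E'. destruct (Rtotal_order t c) as [H|[H|H]].
  - rewrite refl_le by lra. apply is_derive_ext_loc with f; [|apply Hf; lra].
    eapply filter_imp; [|apply (locally_lt t c H)]. intros s Hs. simpl in Hs.
    symmetry. apply refl_le. lra.
  - subst t. rewrite refl_le by lra.
    apply is_derive_glue with f (fun s => e * h (2 * c - s)).
    + apply Hf; lra.
    + rewrite E'. apply is_derive_comp_reflect.
      replace (2 * c - c) with c in * by ring. apply Hh; lra.
    + apply filter_forall. intros s. split; intros Hs.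
      * apply refl_le; exact Hs.
      * apply refl_ge; assumption.
  - rewrite refl_ge by (assumption || lra).
    apply is_derive_ext_loc with (fun s => e * h (2 * c - s)).
    + eapply filter_imp; [|apply (locally_gt t c H)]. intros s Hs. simpl in Hs.
      symmetry. apply refl_ge; [assumption|lra].
    + apply is_derive_comp_reflect. apply Hh; lra.
Qed.

Definition periodize (P : R) (f : R -> R) (t : R) : R := f (t - P * IZR (Int_part (t / P))).

Lemma periodize_eq P f n t : 0 < P -> P * IZR n <= t < P * IZR n + P ->
  periodize P f t = f (t - P * IZR n).
Proof.
  intros HP [H1 H2]. unfold periodize. replace (Int_part (t / P)) with n; [reflexivity|].
  apply Int_part_spec. split.
  - apply Rmult_lt_reg_l with P; [exact HP|].
    replace (P * (t / P - 1)) with (t - P) by (field; lra). lra.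
  - apply Rmult_le_reg_l with P; [exact HP|].
    replace (P * (t / P)) with t by (field; lra). exact H1.
Qed.

Lemma periodize_range P t : 0 < P -> exists n : Z, P * IZR n <= t < P * IZR n + P.
Proof.
  intros HP. exists (Int_part (t / P)). destruct (base_Int_part (t / P)) as [H1 H2].
  apply (Rmult_le_compat_l P) in H1; [|lra].
  apply (Rmult_gt_compat_l P) in H2; [|lra].
  replace (P * (t / P)) with t in H1 by (field; lra).
  replace (P * (IZR (Int_part (t / P)) - t / P)) with (P * IZR (Int_part (t / P)) - t) in H2
    by (field; lra).
  lra.
Qed.

Lemma is_derive_periodize P (f f' : R -> R) t : 0 < P ->
  (forall s, 0 <= s <= P -> is_derive f s (f' s)) -> f P = f 0 -> f' P = f' 0 ->
  is_derive (periodize P f) t (periodize P f' t).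
Proof.
  intros HP Hf E E'. destruct (periodize_range P t HP) as [n [H1 H2]].
  rewrite (periodize_eq P f' n t HP) by lra.
  destruct H1 as [H1|H1].
  - apply is_derive_ext_loc with (fun s => f (s - P * IZR n)).
    + eapply filter_imp; [|apply filter_and; [apply (locally_lt t _ H2)|apply (locally_gt t _ H1)]].
      intros s [Hs1 Hs2]. symmetry. apply periodize_eq; [exact HP|]. simpl in *. lra.
    + apply is_derive_comp_shift, Hf. lra.
  - apply is_derive_glue with (fun s => f (s - P * IZR (n - 1))) (fun s => f (s - P * IZR n)).
    + apply is_derive_comp_shift. rewrite minus_IZR.
      replace (t - P * (IZR n - 1)) with P by lra. replace (t - P * IZR n) with 0 by lra.
      rewrite <- E'. apply Hf; lra.
    + apply is_derive_comp_shift, Hf. lra.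
    + eapply filter_imp; [|apply filter_and; [apply (locally_lt t _ H2)|apply (locally_gt t (t - P)); lra]].
      simpl. intros s [Hs1 Hs2]. split; intros Hs.
      * destruct Hs as [Hs|Hs].
        -- apply periodize_eq; [exact HP|]. rewrite minus_IZR. lra.
        -- rewrite (periodize_eq P f n s HP) by lra. rewrite minus_IZR.
           replace (s - P * (IZR n - 1)) with P by lra. replace (s - P * IZR n) with 0 by lra.
           symmetry; exact E.
      * apply periodize_eq; [exact HP|]. lra.
Qed.

(* [a] on [0, 2], then the mirror images of [b] about 2 and of the results
   about 4 and about 8, with signs [e], [e] and [- e]. *)
Definition ext4 (e : R) (a b : R -> R) : R -> R := refl 2 e a b.
Definition ext8 (e : R) (a b : R -> R) : R -> R := refl 4 e (ext4 e a b) (ext4 e a b).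
Definition ext16 (e : R) (a b : R -> R) : R -> R := refl 8 (- e) (ext8 e a b) (ext8 e a b).
Definition ext (e : R) (a b : R -> R) : R -> R := periodize 16 (ext16 e a b).

(** What makes all the gluings consistent. The mirror at 2 needs the first equation; the one at 4 is
    an obstruction only for e = -1, and the one at 8, like the closing at 16, only for e = 1. *)
Definition compatible (e : R) (a b : R -> R) : Prop :=
  a 2 = e * b 2 /\ ((e = 1 /\ a 0 = 0) \/ (e = -1 /\ b 0 = 0)).

Section Extension.

Variables (e : R) (a b : R -> R).
Hypothesis comp : compatible e a b.

Lemma ext4_left t : t <= 2 -> ext4 e a b t = a t.
Proof. apply refl_le. Qed.

Lemma ext4_right t : 2 <= t -> ext4 e a b t = e * b (4 - t).
Proof.
  intros H. unfold ext4. rewrite refl_ge; [|apply comp|exact H].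
  replace (2 * 2 - t) with (4 - t) by ring. reflexivity.
Qed.

Lemma ext4_mid : ext4 e a b 4 = e * ext4 e a b 4.
Proof.
  rewrite ext4_right by lra. replace (4 - 4) with 0 by ring.
  destruct comp as [_ [[-> _]|[-> ->]]]; ring.
Qed.

Lemma ext8_left t : t <= 4 -> ext8 e a b t = ext4 e a b t.
Proof. apply refl_le. Qed.

Lemma ext8_right t : 4 <= t -> ext8 e a b t = e * ext4 e a b (8 - t).
Proof.
  intros H. unfold ext8. rewrite refl_ge; [|apply ext4_mid|exact H].
  replace (2 * 4 - t) with (8 - t) by ring. reflexivity.
Qed.

Lemma ext8_mid : ext8 e a b 8 = - e * ext8 e a b 8.
Proof.
  rewrite ext8_right by lra. replace (8 - 8) with 0 by ring. rewrite ext4_left by lra.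
  destruct comp as [_ [[-> ->]|[-> _]]]; ring.
Qed.

Lemma ext16_left t : t <= 8 -> ext16 e a b t = ext8 e a b t.
Proof. apply refl_le. Qed.

Lemma ext16_right t : 8 <= t -> ext16 e a b t = - e * ext8 e a b (16 - t).
Proof.
  intros H. unfold ext16. rewrite refl_ge; [|apply ext8_mid|exact H].
  replace (2 * 8 - t) with (16 - t) by ring. reflexivity.
Qed.

Lemma sign_sq : e * e = 1.
Proof. destruct comp as [_ [[-> _]|[-> _]]]; ring. Qed.

Lemma ext16_ends : ext16 e a b 16 = ext16 e a b 0.
Proof.
  rewrite ext16_right, ext16_left by lra. replace (16 - 16) with 0 by ring.
  rewrite ext8_left, ext4_left by lra. destruct comp as [_ [[-> ->]|[-> _]]]; ring.
Qed.

Lemma ext_base n t : 0 <= t <= 16 -> ext e a b (t + 16 * IZR n) = ext16 e a b t.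
Proof.
  intros H. unfold ext. destruct (Rlt_dec t 16) as [Ht|Ht].
  (* Times t < 16 lie in period n; the right end 16 belongs to the next one, where the values agree
     by [ext16_ends]. *)
  - rewrite (periodize_eq 16 _ n) by lra. f_equal. ring.
  - rewrite (periodize_eq 16 _ (n + 1)) by (rewrite ?plus_IZR; lra).
    rewrite plus_IZR. replace t with 16 by lra. rewrite ext16_ends. f_equal. ring.
Qed.

Lemma ext8_reflect t : 0 <= t <= 8 -> ext8 e a b (8 - t) = e * ext8 e a b t.
Proof.
  intros H. destruct (Rle_dec t 4) as [Ht|Ht].
  - rewrite ext8_right, ext8_left by lra. do 2 f_equal. ring.
  - rewrite ext8_left, (ext8_right t) by lra. rewrite <- Rmult_assoc, sign_sq. ring.
Qed.

Lemma ext_odd t : ext e a b (- t) = - e * ext e a b t.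
Proof.
  destruct (periodize_range 16 t) as [n Hn]; [lra|]. set (u := t - 16 * IZR n).
  replace (- t) with ((16 - u) + 16 * IZR (- n - 1))
    by (unfold u; rewrite minus_IZR, opp_IZR; ring).
  replace t with (u + 16 * IZR n) by (unfold u; ring).
  assert (Hu : 0 <= u <= 16) by (unfold u; lra).
  rewrite !ext_base by lra.
  destruct (Rle_dec u 8) as [H|H].
  - rewrite ext16_right, ext16_left by lra. do 2 f_equal. ring.
  - rewrite ext16_left, (ext16_right u) by lra.
    replace (- e * (- e * ext8 e a b (16 - u))) with ((e * e) * ext8 e a b (16 - u)) by ring.
    rewrite sign_sq. ring.
Qed.

Lemma ext_reflect t : ext e a b (8 - t) = e * ext e a b t.
Proof.
  destruct (periodize_range 16 t) as [n Hn]; [lra|]. set (u := t - 16 * IZR n).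
  assert (Hu : 0 <= u <= 16) by (unfold u; lra).
  assert (Et : t = u + 16 * IZR n) by (unfold u; ring).
  destruct (Rle_dec u 8) as [H|H].
  - replace (8 - t) with ((8 - u) + 16 * IZR (- n)) by (rewrite Et, opp_IZR; ring).
    rewrite Et, !ext_base, !ext16_left by lra. apply ext8_reflect. lra.
  - replace (8 - t) with ((24 - u) + 16 * IZR (- n - 1))
      by (rewrite Et, minus_IZR, opp_IZR; ring).
    rewrite Et, !ext_base, !ext16_right by lra.
    replace (16 - (24 - u)) with (8 - (16 - u)) by ring. rewrite ext8_reflect by lra.
    ring.
Qed.

Lemma ext_left t : 0 <= t <= 2 -> ext e a b t = a t.
Proof.
  intros H. replace t with (t + 16 * IZR 0) at 1 by ring.
  rewrite ext_base, ext16_left, ext8_left, ext4_left by lra. reflexivity.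
Qed.

Lemma ext_right t : 0 <= t <= 2 -> ext e a b (4 - t) = e * b t.
Proof.
  intros H. replace (4 - t) with ((4 - t) + 16 * IZR 0) by ring.
  rewrite ext_base, ext16_left, ext8_left, ext4_right by lra. do 2 f_equal. ring.
Qed.

End Extension.

(** All three reflections reverse time, so the signs e, e, - e turn into - e, - e, e: the same
    pattern for [- e]. *)
Lemma is_derive_ext_all e a b a' b' t : compatible e a b -> compatible (- e) a' b' ->
  (forall s, 0 <= s <= 2 -> is_derive a s (a' s)) ->
  (forall s, 0 <= s <= 2 -> is_derive b s (b' s)) ->
  is_derive (ext e a b) t (ext (- e) a' b' t).
Proof.
  intros C C' Da Db.
  assert (D4 : forall s, 0 <= s <= 4 -> is_derive (ext4 e a b) s (ext4 (- e) a' b' s)).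
  { intros s Hs. apply is_derive_refl.
    - intros; apply Da; lra.
    - intros; apply Db; lra.
    - apply C.
    - apply C'. }
  assert (D8 : forall s, 0 <= s <= 8 -> is_derive (ext8 e a b) s (ext8 (- e) a' b' s)).
  { intros s Hs. apply is_derive_refl.
    - intros; apply D4; lra.
    - intros; apply D4; lra.
    - apply ext4_mid, C.
    - apply ext4_mid, C'. }
  assert (D16 : forall s, 0 <= s <= 16 -> is_derive (ext16 e a b) s (ext16 (- e) a' b' s)).
  { intros s Hs. apply is_derive_refl.
    - intros; apply D8; lra.
    - intros; apply D8; lra.
    - apply ext8_mid, C.
    - apply ext8_mid, C'. }
  apply is_derive_periodize; [lra|exact D16| |]; apply ext16_ends; assumption.
Qed.

(** * The symmetric four-body problem *)

(** One component of the acceleration of a body at (x1, y1) attracted by the bodies at -(x1, y1) and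
    at plus and minus (x2, y2); exchanging x and y gives the other component. *)
Definition pull (x1 y1 x2 y2 : R) : R :=
  - (1 / 4 * kepler x1 y1 + kepler (x1 - x2) (y1 - y2) + kepler (x1 + x2) (y1 + y2)).

Lemma kepler_opp_l x y : kepler (- x) y = - kepler x y.
Proof. unfold kepler. replace ((- x) ^ 2) with (x ^ 2) by ring. unfold Rdiv. ring. Qed.

Lemma kepler_opp_r x y : kepler x (- y) = kepler x y.
Proof. unfold kepler. replace ((- y) ^ 2) with (y ^ 2) by ring. reflexivity. Qed.

Lemma pull_reflect_r x1 y1 x2 y2 : pull x1 (- y1) x2 (- y2) = pull x1 y1 x2 y2.
Proof.
  unfold pull. replace (- y1 - - y2) with (- (y1 - y2)) by ring.
  replace (- y1 + - y2) with (- (y1 + y2)) by ring. rewrite !kepler_opp_r. reflexivity.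
Qed.

Lemma pull_reflect_l x1 y1 x2 y2 : pull (- x1) y1 (- x2) y2 = - pull x1 y1 x2 y2.
Proof.
  unfold pull. replace (- x1 - - x2) with (- (x1 - x2)) by ring.
  replace (- x1 + - x2) with (- (x1 + x2)) by ring. rewrite !kepler_opp_l. ring.
Qed.

Lemma pull_opp x1 y1 x2 y2 : pull x1 y1 (- x2) (- y2) = pull x1 y1 x2 y2.
Proof.
  unfold pull. replace (x1 - - x2) with (x1 + x2) by ring. replace (y1 - - y2) with (y1 + y2) by ring.
  replace (x1 + - x2) with (x1 - x2) by ring. replace (y1 + - y2) with (y1 - y2) by ring. ring.
Qed.

Lemma kepler_swap x1 y1 x2 y2 : kepler (x1 - x2) (y1 - y2) = - kepler (x2 - x1) (y2 - y1).
Proof.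
  rewrite <- kepler_opp_l, <- (kepler_opp_r _ (y2 - y1)). f_equal; ring.
Qed.

Lemma sep_0 c z : sep c 0 z = z c.
Proof. unfold sep, sep_coef. simpl. ring. Qed.
Lemma sep_1 c z : sep c 1 z = z (2 + c)%nat.
Proof. unfold sep, sep_coef. simpl. ring. Qed.
Lemma sep_2 c z : sep c 2 z = z c - z (2 + c)%nat.
Proof. unfold sep, sep_coef. simpl. ring. Qed.
Lemma sep_3 c z : sep c 3 z = z c + z (2 + c)%nat.
Proof. unfold sep, sep_coef. simpl. ring. Qed.

Lemma force_1 c z : force 0 c z = pull (z c) (z (1 - c)%nat) (z (2 + c)%nat) (z (2 + (1 - c))%nat).
Proof.
  unfold force, pull. cbn [sum_f_R0]. rewrite !sep_0, !sep_1, !sep_2, !sep_3.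
  unfold weight4, sep_coef. cbn [nth Z.mul Pos.mul Z.opp]. field.
Qed.

Lemma force_2 c z : force 1 c z = pull (z (2 + c)%nat) (z (2 + (1 - c))%nat) (z c) (z (1 - c)%nat).
Proof.
  unfold force, pull. cbn [sum_f_R0]. rewrite !sep_0, !sep_1, !sep_2, !sep_3.
  rewrite (kepler_swap (z (2 + c)%nat)), (Rplus_comm (z (2 + c)%nat)), (Rplus_comm (z (2 + (1 - c))%nat)).
  unfold weight4, sep_coef. cbn [nth Z.mul Pos.mul Z.opp]. field.
Qed.

Definition separated (x1 y1 x2 y2 : R) : Prop :=
  0 < x1 ^ 2 + y1 ^ 2 /\ 0 < x2 ^ 2 + y2 ^ 2 /\
  0 < (x1 - x2) ^ 2 + (y1 - y2) ^ 2 /\ 0 < (x1 + x2) ^ 2 + (y1 + y2) ^ 2.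

(** A single closed curve carries all four bodies: the symmetries imply q2(t) = q1(t + 4), and a
    shift by 8 is the antipodal map. In these units an eighth of the period is 2, the length of
    [-1, 1]. *)
Theorem symmetric_orbit : exists X Y VX VY AX AY : R -> R,
  (forall t, is_derive X t (VX t) /\ is_derive Y t (VY t)) /\
  (forall t, is_derive VX t (AX t) /\ is_derive VY t (AY t)) /\
  (forall t, X (- t) = - X t /\ Y (- t) = Y t) /\
  (forall t, X (8 - t) = X t /\ Y (8 - t) = - Y t) /\
  (forall t, AX t = pull (X t) (Y t) (X (t + 4)) (Y (t + 4)) /\
             AY t = pull (Y t) (X t) (Y (t + 4)) (X (t + 4))) /\
  (forall t, separated (X t) (Y t) (X (t + 4)) (Y (t + 4))) /\
  0 < Y 0 /\ 0 < X 4 /\ 0 < X 2 /\ Y 2 < 0.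
Proof.
  destruct local_orbit as [z [Dz [Sz [[A0 [A3 [A5 A6]]] [[B0 [B1 [B4 B5]]] [P1 [P2 [P3 P4]]]]]]]].
  set (a := fun i t => z i (t - 1)).
  set (f := fun i t => field i (fun j => z j (t - 1))).
  assert (Da : forall i s, (i <= 7)%nat -> 0 <= s <= 2 -> is_derive (a i) s (f i s)).
  { intros i s Hi Hs. apply (is_derive_comp_shift (z i) 1). apply Dz; [exact Hi|lra]. }
  assert (Ea : forall i, a i 0 = z i (-1)) by (intros i; unfold a; f_equal; ring).
  assert (Eb : forall i, a i 2 = z i 1) by (intros i; unfold a; f_equal; ring).
  assert (F4 : forall t, f 4%nat t = pull (a 0%nat t) (a 1%nat t) (a 2%nat t) (a 3%nat t))
    by (intros t; apply (force_1 0)).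
  assert (F5 : forall t, f 5%nat t = pull (a 1%nat t) (a 0%nat t) (a 3%nat t) (a 2%nat t))
    by (intros t; apply (force_1 1)).
  assert (F6 : forall t, f 6%nat t = pull (a 2%nat t) (a 3%nat t) (a 0%nat t) (a 1%nat t))
    by (intros t; apply (force_2 0)).
  assert (F7 : forall t, f 7%nat t = pull (a 3%nat t) (a 2%nat t) (a 1%nat t) (a 0%nat t))
    by (intros t; apply (force_2 1)).
  assert (Fi : forall i t, (i < 4)%nat -> f i t = a (4 + i)%nat t)
    by (intros i t Hi; apply field_position, Hi).
  assert (Sa : forall s, 0 <= s <= 2 -> separated (a 0%nat s) (a 1%nat s) (a 2%nat s) (a 3%nat s)).
  { intros s Hs. assert (Hs' : -1 <= s - 1 <= 1) by lra.
    pose proof (Sz 0%nat (s - 1) ltac:(lia) Hs') as S0. pose proof (Sz 1%nat (s - 1) ltac:(lia) Hs') as S1.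
    pose proof (Sz 2%nat (s - 1) ltac:(lia) Hs') as S2. pose proof (Sz 3%nat (s - 1) ltac:(lia) Hs') as S3.
    rewrite !sep_0 in S0. rewrite !sep_1 in S1. rewrite !sep_2 in S2. rewrite !sep_3 in S3.
    repeat split; assumption. }
  (* At time 2 the reflection R_x with time reversal exchanges q1 and q2, so x continues with sign 1
     and y with sign -1. Each differentiation negates the sign, which is kept unsimplified to fit
     [is_derive_ext_all]. *)
  assert (CX : compatible 1 (a 0%nat) (a 2%nat)).
  { split; [rewrite !Eb; lra|left; rewrite Ea; auto]. }
  assert (CY : compatible (-1) (a 1%nat) (a 3%nat)).
  { split; [rewrite !Eb; lra|right; rewrite Ea; auto]. }
  assert (CVX : compatible (- (1)) (a 4%nat) (a 6%nat)).
  { split; [rewrite !Eb; lra|right; rewrite Ea; split; [lra|auto]]. }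
  assert (CVY : compatible (- -1) (a 5%nat) (a 7%nat)).
  { split; [rewrite !Eb; lra|left; rewrite Ea; split; [lra|auto]]. }
  (* Accelerations inherit the conditions since the force commutes with reflections. At time 0 a
     reflection fixes q1 and maps q2 to - q2, which does not change the force on q1, so its
     x-component is its own negative. *)
  assert (CAX : compatible (- - (1)) (f 4%nat) (f 6%nat)).
  { split.
    - rewrite F4, F6, !Eb, B0, B1.
      replace (pull (z 2%nat 1) (- z 3%nat 1) (z 2%nat 1) (z 3%nat 1)) with
        (pull (z 2%nat 1) (- z 3%nat 1) (z 2%nat 1) (- - z 3%nat 1)) by (f_equal; ring).
      rewrite pull_reflect_r. ring.
    - left. split; [ring|]. rewrite F4, !Ea, A0, A3.
      pose proof (pull_reflect_l 0 (z 1%nat (-1)) (z 2%nat (-1)) 0) as H.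
      rewrite Ropp_0 in H. rewrite <- (pull_opp 0) in H. rewrite Ropp_involutive, Ropp_0 in H. lra. }
  assert (CAY : compatible (- - -1) (f 5%nat) (f 7%nat)).
  { split.
    - rewrite F5, F7, !Eb, B0, B1.
      rewrite <- (Ropp_involutive (z 3%nat 1)) at 2. rewrite pull_reflect_l. ring.
    - right. split; [ring|]. rewrite F7, !Ea, A0, A3.
      pose proof (pull_reflect_l 0 (z 2%nat (-1)) (z 1%nat (-1)) 0) as H.
      rewrite Ropp_0 in H. rewrite <- (pull_opp 0) in H. rewrite Ropp_involutive, Ropp_0 in H. lra. }
  set (X := ext 1 (a 0%nat) (a 2%nat)). set (Y := ext (-1) (a 1%nat) (a 3%nat)).
  set (AX := ext (- - (1)) (f 4%nat) (f 6%nat)). set (AY := ext (- - -1) (f 5%nat) (f 7%nat)).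
  assert (Xodd : forall t, X (- t) = - X t) by (intros; unfold X; rewrite ext_odd by exact CX; ring).
  assert (Yev : forall t, Y (- t) = Y t) by (intros; unfold Y; rewrite ext_odd by exact CY; ring).
  assert (X8 : forall t, X (8 - t) = X t) by (intros; unfold X; rewrite ext_reflect by exact CX; ring).
  assert (Y8 : forall t, Y (8 - t) = - Y t) by (intros; unfold Y; rewrite ext_reflect by exact CY; ring).
  assert (AXodd : forall t, AX (- t) = - AX t) by (intros; unfold AX; rewrite ext_odd by exact CAX; ring).
  assert (AYev : forall t, AY (- t) = AY t) by (intros; unfold AY; rewrite ext_odd by exact CAY; ring).
  assert (AX8 : forall t, AX (8 - t) = AX t) by (intros; unfold AX; rewrite ext_reflect by exact CAX; ring).
  assert (AY8 : forall t, AY (8 - t) = - AY t) by (intros; unfold AY; rewrite ext_reflect by exact CAY; ring).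
  assert (X4 : forall t, X (- t + 4) = X (t + 4)) by (intros; rewrite <- X8; f_equal; ring).
  assert (Y4 : forall t, Y (- t + 4) = - Y (t + 4))
    by (intros; rewrite <- Y8; f_equal; ring).
  assert (X12 : forall t, X (8 - t + 4) = - X (t + 4)).
  { intros t. replace (8 - t + 4) with (8 - (t - 4)) by ring. rewrite X8.
    replace (t - 4) with (- (- t + 4)) by ring. rewrite Xodd, X4. reflexivity. }
  assert (Y12 : forall t, Y (8 - t + 4) = Y (t + 4)).
  { intros t. replace (8 - t + 4) with (8 - (t - 4)) by ring. rewrite Y8.
    replace (t - 4) with (- (- t + 4)) by ring. rewrite Yev, Y4. ring. }
  set (P := fun t => (AX t = pull (X t) (Y t) (X (t + 4)) (Y (t + 4)) /\
                      AY t = pull (Y t) (X t) (Y (t + 4)) (X (t + 4))) /\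
                     separated (X t) (Y t) (X (t + 4)) (Y (t + 4))).
  (* By the symmetries, the point at t + 4 is the mirror image of the one at 4 - t, that is, q2 of
     the local solution at time t. *)
  assert (Q2 : forall t, 0 <= t <= 2 -> P t).
  { intros t Ht. unfold P. rewrite <- X4. rewrite <- (Ropp_involutive (Y (t + 4))), <- Y4.
    replace (- t + 4) with (4 - t) by ring.
    unfold AX, AY, X, Y.
    rewrite (ext_right _ _ _ CX), (ext_right _ _ _ CY), (ext_left _ _ _ CAX), (ext_left _ _ _ CAY),
      (ext_left _ _ _ CX), (ext_left _ _ _ CY) by assumption.
    rewrite F4, F5. rewrite Rmult_1_l. replace (- (-1 * a 3%nat t)) with (a 3%nat t) by ring.
    split; [split; reflexivity|apply Sa, Ht]. }
  (* On [2, 4] the local solution is run backwards with q1 and q2 exchanged. *)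
  assert (Q4 : forall t, 0 <= t <= 4 -> P t).
  { intros t Ht. destruct (Rle_dec t 2) as [H2|H2]; [apply Q2; lra|].
    set (s := 4 - t). assert (Hs : 0 <= s <= 2) by (unfold s; lra).
    replace t with (4 - s) by (unfold s; ring). unfold P.
    replace (4 - s + 4) with (8 - s) by ring. rewrite X8, Y8.
    unfold AX, AY, X, Y.
    rewrite (ext_right _ _ _ CAX), (ext_right _ _ _ CAY), (ext_right _ _ _ CX), (ext_right _ _ _ CY),
      (ext_left _ _ _ CX), (ext_left _ _ _ CY) by assumption.
    rewrite F6, F7.
    replace (-1 * a 3%nat s) with (- a 3%nat s) by ring. rewrite Rmult_1_l.
    rewrite pull_reflect_r, pull_reflect_l.
    split; [split; ring|].
    destruct (Sa s Hs) as [S0 [S1 [S2 S3]]].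
    unfold separated in *. repeat split; nra. }
  (* The equation and the separation are invariant under t -> 8 - t and t -> - t; with the period 16
     these carry them from [0, 4] to the whole line. *)
  assert (PR : forall t, P t -> P (8 - t)).
  { intros t [[H1 H2] [S0 [S1 [S2 S3]]]]. unfold P.
    rewrite X8, Y8, X12, Y12, AX8, AY8, H1, H2.
    rewrite <- (pull_opp (X t) (- Y t)), Ropp_involutive, pull_reflect_r.
    rewrite <- (pull_opp (- Y t)), Ropp_involutive, pull_reflect_l.
    split; [split; reflexivity|]. unfold separated. repeat split; nra. }
  assert (PN : forall t, P t -> P (- t)).
  { intros t [[H1 H2] [S0 [S1 [S2 S3]]]]. unfold P.
    rewrite Xodd, Yev, X4, Y4, AXodd, AYev, H1, H2.
    rewrite <- (pull_opp (- X t)), Ropp_involutive, pull_reflect_l.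
    rewrite <- (pull_opp (Y t) (- X t)), Ropp_involutive, pull_reflect_r.
    split; [split; reflexivity|]. unfold separated. repeat split; nra. }
  assert (Q8 : forall t, 0 <= t <= 8 -> P t).
  { intros t Ht. destruct (Rle_dec t 4) as [H|H]; [apply Q4; lra|].
    replace t with (8 - (8 - t)) by ring. apply PR, Q4. lra. }
  assert (Q16 : forall t, 0 <= t <= 16 -> P t).
  { intros t Ht. destruct (Rle_dec t 8) as [H|H]; [apply Q8; lra|].
    replace t with (8 - - (t - 8)) by ring. apply PR, PN, Q8. lra. }
  assert (Q : forall t, P t).
  { intros t. destruct (periodize_range 16 t) as [n Hn]; [lra|].
    set (u := t - 16 * IZR n). assert (Pu : P u) by (apply Q16; unfold u; lra).
    assert (E : forall e g h s, compatible e g h -> ext e g h (s + u) = ext e g h (s + t)).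
    { intros e g h s C. destruct (periodize_range 16 (s + u)) as [m Hm]; [lra|].
      set (v := s + u - 16 * IZR m). replace (s + u) with (v + 16 * IZR m) by (unfold v; ring).
      replace (s + t) with (v + 16 * IZR (m + n)) by (unfold v, u; rewrite plus_IZR; ring).
      rewrite !ext_base by (assumption || (unfold v; lra)). reflexivity. }
    unfold P in *. rewrite !(Rplus_comm _ 4) in *.
    unfold X, Y, AX, AY in *.
    rewrite !(E _ _ _ 4) in Pu by assumption.
    rewrite <- (Rplus_0_l u), !(E _ _ _ 0), Rplus_0_l in Pu by assumption. exact Pu. }
  exists X, Y, (ext (- (1)) (a 4%nat) (a 6%nat)), (ext (- -1) (a 5%nat) (a 7%nat)), AX, AY.
  split; [|split; [|split; [|split; [|split; [|split]]]]].
  - assert (Dv : forall i s, (i < 4)%nat -> 0 <= s <= 2 -> is_derive (a i) s (a (4 + i)%nat s))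
      by (intros i s Hi Hs; rewrite <- Fi by exact Hi; apply Da; [lia|exact Hs]).
    intros t. split; apply is_derive_ext_all; try assumption; intros s.
    + apply (Dv 0%nat); lia.
    + apply (Dv 2%nat); lia.
    + apply (Dv 1%nat); lia.
    + apply (Dv 3%nat); lia.
  - intros t. split; apply is_derive_ext_all; try assumption;
      intros s Hs; apply Da; (lia || assumption).
  - auto.
  - auto.
  - apply Q.
  - apply Q.
  - unfold X, Y. replace 4 with (4 - 0) by ring.
    rewrite ext_right, !ext_left by (assumption || lra).
    rewrite !Ea, !Eb. lra.
Qed.

(** * The periodic solution *)

Lemma is_derive_pair (f g : R -> R) (t lf lg : R) :
  is_derive f t lf -> is_derive g t lg ->
  is_derive (fun s => (f s, g s) : plane) t ((lf, lg) : plane).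
Proof.
  intros Hf Hg.
  apply (filterdiff_comp'_2 (K := R_AbsRing) f g
    (fun a b => (a, b) : prod_NormedModule R_AbsRing R_NormedModule R_NormedModule)
    t (fun y => scal y lf) (fun y => scal y lg) (fun a b => (a, b)) Hf Hg).
  apply (filterdiff_ext (fun p => p)).
  - intros [a b]. reflexivity.
  - eapply filterdiff_ext_lin; [apply filterdiff_id|]. intros [a b]. reflexivity.
Qed.

Lemma norm_plane (a b : R) : norm ((a, b) : plane) = sqrt (a ^ 2 + b ^ 2).
Proof.
  change (sqrt (Rabs a ^ 2 + Rabs b ^ 2) = sqrt (a ^ 2 + b ^ 2)).
  rewrite !pow2_abs. reflexivity.
Qed.

(** The default branch serves body 4; it also covers the irrelevant index 0 and those above 4. *)
Definition parallelogram (p r : R -> plane) (k : nat) (t : R) : plane :=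
  match k with
  | 1%nat => p t
  | 2%nat => r t
  | 3%nat => (- fst (p t), - snd (p t))
  | _ => (- fst (r t), - snd (r t))
  end.

Lemma is_derive_parallelogram p r (p' r' : R -> plane) k t :
  is_derive p t (p' t) -> is_derive r t (r' t) ->
  is_derive (parallelogram p r k) t (parallelogram p' r' k t).
Proof.
  intros Hp Hr.
  destruct k as [|[|[|[|k]]]]; [|exact Hp|exact Hr| |];
    first [exact (is_derive_opp _ _ _ Hp) | exact (is_derive_opp _ _ _ Hr)].
Qed.

Lemma kepler_double x y : 0 < x ^ 2 + y ^ 2 -> kepler (2 * x) (2 * y) = 1 / 4 * kepler x y.
Proof. intros H. rewrite (kepler_homogeneous 2 x y); [field|lra|exact H]. Qed.

Lemma pull_homogeneous c x1 y1 x2 y2 : 0 < c -> separated x1 y1 x2 y2 ->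
  pull x1 y1 x2 y2 = c ^ 2 * pull (c * x1) (c * y1) (c * x2) (c * y2).
Proof.
  intros Hc [S0 [S1 [S2 S3]]]. unfold pull.
  rewrite (kepler_homogeneous c x1 y1), (kepler_homogeneous c (x1 - x2)),
    (kepler_homogeneous c (x1 + x2)) by assumption.
  rewrite !Rmult_minus_distr_l, !(Rmult_plus_distr_l c). ring.
Qed.

Lemma scal_plane (c x y : R) : scal c ((x, y) : plane) = ((c * x, c * y) : plane).
Proof. reflexivity. Qed.

Lemma minus_plane (a b x y : R) : minus ((a, b) : plane) ((x, y) : plane) = ((a - x, b - y) : plane).
Proof. reflexivity. Qed.

Lemma plus_plane (a b x y : R) : plus ((a, b) : plane) ((x, y) : plane) = ((a + x, b + y) : plane).
Proof. reflexivity. Qed.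

Lemma opp_plane (a b : R) : opp ((a, b) : plane) = ((- a, - b) : plane).
Proof. reflexivity. Qed.

Lemma attraction (a b x y : R) :
  scal (/ norm (minus ((a, b) : plane) ((x, y) : plane)) ^ 3)
    (minus ((a, b) : plane) ((x, y) : plane)) =
  ((kepler (a - x) (b - y), kepler (b - y) (a - x)) : plane).
Proof.
  rewrite minus_plane, norm_plane, scal_plane. unfold kepler, Rdiv.
  rewrite (Rplus_comm ((b - y) ^ 2)). f_equal; ring.
Qed.

Lemma parallelogram_acceleration p r t k x1 y1 x2 y2 :
  p t = (x1, y1) -> r t = (x2, y2) -> separated x1 y1 x2 y2 -> (1 <= k <= 4)%nat ->
  acceleration 4 (parallelogram p r) k t =
  parallelogram (fun _ => (pull x1 y1 x2 y2, pull y1 x1 y2 x2))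
                (fun _ => (pull x2 y2 x1 y1, pull y2 x2 y1 x1)) k t.
Proof.
  intros Hp Hr [S0 [S1 [S2 S3]]] Hk.
  (* The opposite body lies at twice the distance from the centre, which by homogeneity produces the
     weight 1/4. *)
  assert (Dbl : forall x y, 0 < x ^ 2 + y ^ 2 -> kepler (x + x) (y + y) = 1 / 4 * kepler x y).
  { intros x y H. rewrite <- kepler_double by exact H. f_equal; ring. }
  assert (M : forall x y, x - - y = x + y) by (intros; ring).
  assert (Neg : forall x y x' y', kepler (- x - x') (- y - y') = - kepler (x + x') (y + y')).
  { intros. rewrite <- kepler_opp_l, <- (kepler_opp_r _ (y + y')). f_equal; ring. }
  assert (S0' : 0 < y1 ^ 2 + x1 ^ 2) by lra. assert (S1' : 0 < y2 ^ 2 + x2 ^ 2) by lra.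
  unfold acceleration. do 3 rewrite sum_n_Sm by lia. rewrite sum_n_n.
  destruct k as [|[|[|[|[|k]]]]]; try lia; cbn [Nat.eqb]; unfold parallelogram; rewrite Hp, Hr;
    cbn [fst snd]; rewrite !attraction; change (@zero _) with ((0, 0) : plane);
    rewrite ?plus_plane, opp_plane, ?Neg, ?M, ?Dbl by assumption; unfold pull;
    apply f_equal2; unfold Rminus; ring.
Qed.

Lemma plane_neq (a b x y : R) : 0 < (a - x) ^ 2 + (b - y) ^ 2 -> ((a, b) : plane) <> (x, y).
Proof. intros H E. injection E as -> ->. rewrite !Rminus_diag in H. lra. Qed.

Lemma opp_plane_pair (p : plane) : opp p = (- fst p, - snd p).
Proof. reflexivity. Qed.

Theorem theorem1 :
  exists q : nat -> R -> plane,
    n_body_solution 4 q /\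
    collisionless 4 q /\
    periodic 4 (2 * PI) q /\
    Py (q 1%nat 0) > 0 /\
    Px (q 2%nat 0) > 0 /\
    Px (q 1%nat (PI / 4)) > 0 /\
    Py (q 1%nat (PI / 4)) < 0 /\
    forall t : R,
      q 1%nat t = Ry (q 1%nat (- t)) /\
      q 1%nat t = Rx (q 2%nat (PI / 2 - t)) /\
      q 2%nat t = Rx (q 2%nat (- t)) /\
      q 1%nat t = opp (q 3%nat t) /\
      q 2%nat t = opp (q 4%nat t).
Proof.
  destruct symmetric_orbit as
    [X [Y [VX [VY [AX [AY [D1 [D2 [Sneg [S8 [HA [Sep [P1 [P2 [P3 P4]]]]]]]]]]]]]]].
  pose proof PI_RGT_0 as HPI.
  (* This takes the period 16 to 2 pi, and time 2 to pi / 4. *)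
  set (w := 8 / PI). assert (Hw : 0 < w) by (apply Rdiv_lt_0_compat; lra).
  (* Kepler's third law: the time scale [w] forces the length scale [c]. *)
  set (c := Rpower (PI / 8) (2 / 3)). assert (Hc : 0 < c) by apply exp_pos.
  assert (Hcw : c * w ^ 2 = / c ^ 2).
  { assert (H3 : c ^ 3 = (PI / 8) ^ 2).
    { unfold c. rewrite <- Rpower_pow by apply exp_pos. rewrite Rpower_mult.
      replace (2 / 3 * INR 3) with (INR 2) by (simpl; field).
      apply Rpower_pow. lra. }
    apply Rmult_eq_reg_r with (c ^ 2); [|apply pow_nonzero; lra].
    rewrite Rinv_l by (apply pow_nonzero; lra).
    replace (c * w ^ 2 * c ^ 2) with (c ^ 3 * w ^ 2) by ring.
    rewrite H3. unfold w. field. lra. }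
  assert (Wper : forall t, w * (t + 2 * PI) = w * t + 16) by (intros; unfold w; field; lra).
  assert (Wneg : forall t, w * - t = - (w * t)) by (intros; ring).
  assert (Whalf : forall t, w * (PI / 2 - t) + 4 = 8 - w * t) by (intros; unfold w; field; lra).
  assert (X16 : forall t, X (t + 16) = X t /\ Y (t + 16) = Y t).
  (* The two time reflections compose to the shift by 8, which acts as - 1; its square is the
     period. *)
  { assert (H8 : forall t, X (t + 8) = - X t /\ Y (t + 8) = - Y t).
    { intros t. replace (t + 8) with (8 - - t) by ring.
      rewrite (proj1 (S8 _)), (proj2 (S8 _)), (proj1 (Sneg _)), (proj2 (Sneg _)). split; reflexivity. }
    intros t. replace (t + 16) with (t + 8 + 8) by ring.
    rewrite !(proj1 (H8 _)), !(proj2 (H8 _)). split; ring. }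
  set (p := fun s t => (c * X (w * t + s), c * Y (w * t + s)) : plane).
  set (q := parallelogram (p 0) (p 4)).
  assert (SepC : forall t, separated (c * X (w * t + 0)) (c * Y (w * t + 0))
                                     (c * X (w * t + 4)) (c * Y (w * t + 4))).
  { intros t. rewrite Rplus_0_r. destruct (Sep (w * t)) as [H0 [H1 [H2 H3]]].
    assert (Hc2 : 0 < c ^ 2) by (apply pow_lt; exact Hc).
    assert (K : forall u v, 0 < u ^ 2 + v ^ 2 -> 0 < (c * u) ^ 2 + (c * v) ^ 2).
    { intros u v H. replace ((c * u) ^ 2 + (c * v) ^ 2) with (c ^ 2 * (u ^ 2 + v ^ 2)) by ring.
      apply Rmult_lt_0_compat; assumption. }
    unfold separated. rewrite <- !Rmult_minus_distr_l, <- !Rmult_plus_distr_l. auto. }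
  exists q. split; [|split; [|split; [|split; [|split; [|split; [|split]]]]]].
  - assert (Dc : forall (f f' : R -> R) b s t, is_derive f (w * t + s) (f' (w * t + s)) ->
      is_derive (fun t => b * f (w * t + s)) t (b * w * f' (w * t + s))).
    { intros f f' b s t H. rewrite Rmult_assoc. apply is_derive_scal.
      apply (is_derive_comp f (fun t => w * t + s)); [exact H|]. auto_derive; [exact I|ring]. }
    (* The equation of q2 is that of q1 at t + 4. There the second argument has been shifted by 8
       and hence negated, which [pull_opp] undoes. *)
    assert (A4 : forall t, AX (t + 4) = pull (X (t + 4)) (Y (t + 4)) (X t) (Y t) /\
                           AY (t + 4) = pull (Y (t + 4)) (X (t + 4)) (Y t) (X t)).
    { intros t. destruct (HA (t + 4)) as [H1 H2].
      replace (t + 4 + 4) with (8 - - t) in H1, H2 by ring.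
      rewrite (proj1 (S8 _)), (proj2 (S8 _)), (proj1 (Sneg _)), (proj2 (Sneg _)), pull_opp in H1, H2.
      auto. }
    assert (Hpull : forall x1 y1 x2 y2, separated (c * x1) (c * y1) (c * x2) (c * y2) ->
        pull (c * x1) (c * y1) (c * x2) (c * y2) = c * w * w * pull x1 y1 x2 y2).
    { intros x1 y1 x2 y2 H.
      assert (Hi : 0 < / c) by (apply Rinv_0_lt_compat, Hc).
      rewrite (pull_homogeneous (/ c)) by assumption.
      assert (I : forall x, / c * (c * x) = x) by (intros; field; lra).
      rewrite !I, pow_inv, <- Hcw. ring. }
    intros k Hk.
    set (v := fun s t => (c * w * VX (w * t + s), c * w * VY (w * t + s)) : plane).
    set (g := fun s t => (c * w * w * AX (w * t + s), c * w * w * AY (w * t + s)) : plane).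
    exists (parallelogram (v 0) (v 4) k). split; intros t.
    + apply is_derive_parallelogram; apply is_derive_pair; apply Dc; apply D1.
    + replace (acceleration 4 q k t) with (parallelogram (g 0) (g 4) k t).
      * apply is_derive_parallelogram; apply is_derive_pair; apply Dc; apply D2.
      * unfold q. symmetry. pose proof (SepC t) as S.
        rewrite (parallelogram_acceleration _ _ t k _ _ _ _ eq_refl eq_refl S Hk).
        assert (S' : separated (c * X (w * t + 4)) (c * Y (w * t + 4))
                               (c * X (w * t + 0)) (c * Y (w * t + 0)))
          by (destruct S as [H0 [H1 [H2 H3]]]; unfold separated; repeat split; lra).
        assert (T : forall x1 y1 x2 y2, separated x1 y1 x2 y2 -> separated y1 x1 y2 x2)
          by (intros x1 y1 x2 y2 [H0 [H1 [H2 H3]]]; unfold separated; repeat split; lra).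
        rewrite !Hpull by auto. unfold g, parallelogram.
        rewrite !Rplus_0_r.
        rewrite (proj1 (HA (w * t))), (proj2 (HA (w * t))), (proj1 (A4 (w * t))), (proj2 (A4 (w * t))).
        reflexivity.
  - intros i j Hi Hj Hij t.
    destruct (SepC t) as [H0 [H1 [H2 H3]]].
    destruct i as [|[|[|[|[|i]]]]]; try lia; destruct j as [|[|[|[|[|j]]]]]; try lia;
      unfold q, parallelogram, p; cbn [fst snd]; apply plane_neq; nra.
  - intros k Hk t. unfold q.
    assert (E : forall s, p s (t + 2 * PI) = p s t).
    { intros s. unfold p. rewrite Wper. replace (w * t + 16 + s) with (w * t + s + 16) by ring.
      rewrite (proj1 (X16 _)), (proj2 (X16 _)). reflexivity. }
    unfold parallelogram. rewrite !E. reflexivity.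
  - unfold q, parallelogram, p, Py. cbn [snd].
    replace (w * 0 + 0) with 0 by ring. apply Rmult_lt_0_compat; assumption.
  - unfold q, parallelogram, p, Px. cbn [fst].
    replace (w * 0 + 4) with 4 by ring. apply Rmult_lt_0_compat; assumption.
  - unfold q, parallelogram, p, Px. cbn [fst].
    replace (w * (PI / 4) + 0) with 2 by (unfold w; field; lra). apply Rmult_lt_0_compat; assumption.
  - unfold q, parallelogram, p, Py. cbn [snd].
    replace (w * (PI / 4) + 0) with 2 by (unfold w; field; lra). nra.
  - intros t. unfold q, parallelogram, p, Rx, Ry. rewrite !opp_plane_pair. cbn [fst snd].
    rewrite !Ropp_involutive, !Rplus_0_r, Whalf, Wneg.
    rewrite (proj1 (S8 _)), (proj2 (S8 _)), (proj1 (Sneg _)), (proj2 (Sneg _)).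
    replace (- (w * t) + 4) with (8 - (w * t + 4)) by ring.
    rewrite (proj1 (S8 _)), (proj2 (S8 _)).
    repeat split; apply f_equal2; ring.
Qed.
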